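(* Let $s\in(0,1)$ and let $B_1\subset\mathbf{R}^n$ be the open unit ball centered at the origin. Assume that $u\in\mathcal{L}_{2s}\cap L^{\frac{1}{1-s}}(B_1)$ satisfies $$\begin{cases}(-\Delta)^s u(x)\geq 0 & \text{in }\mathcal{D}'(B_1),\\ u(x)\geq 0 & \text{in } B_1^c.\end{cases}$$ Then $u(x)\geq 0$ in $B_1$.
   Context: $\mathcal{L}_{2s}=\{u:\mathbf{R}^n\to\mathbf{R}\ :\ \int_{\mathbf{R}^n}\frac{|u(x)|}{1+|x|^{n+2s}}dx<\infty\}$ (measurable functions), and $u\in \mathcal{L}_{2s}\cap L^{\frac{1}{1-s}}(B_1)$ means $u\in\mathcal{L}_{2s}$ and $u|_{B_1}\in L^{\frac1{1-s}}(B_1)$. For $\psi\in C_0^\infty(\mathbf{R}^n)$, $(-\Delta)^s\psi(x)=C_{n,s}\,P.V.\int_{\mathbf{R}^n}\frac{\psi(x)-\psi(y)}{|x-y|^{n+2s}}dy$, where $C_{n,s}>0$ is a normalizing constant and P.V. denotes the Cauchy principal value. For $u\in\mathcal{L}_{2s}$, $(-\Delta)^su$ is the distribution $\psi\mapsto\int_{\mathbf{R}^n}u(x)(-\Delta)^s\psi(x)dx$. The inequality $(-\Delta)^su\geq0$ in $\mathcal{D}'(B_1)$ means $\int_{\mathbf{R}^n}u\,(-\Delta)^s\psi\,dx\geq0$ for all nonnegative $\psi\in C_0^\infty(B_1)$. $B_1^c=\mathbf{R}^n\setminus B_1$. Pointwise inequalities for $u$ are understood almost everywhere. *)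

(* Defs.v *)
From HB Require Import structures.
From mathcomp Require Import all_boot all_order all_algebra.
From mathcomp Require Import all_classical all_reals all_analysis.

Set Implicit Arguments.
Unset Strict Implicit.
Unset Printing Implicit Defensive.

Import Order.TTheory GRing.Theory Num.Theory.
Import numFieldNormedType.Exports.

Local Open Scope classical_set_scope.
Local Open Scope ring_scope.

(* R^n is ['rV[R]_n]. The library gives it the sup norm, hence the usual
   topology, but no measurable structure and no Lebesgue measure. *)

Section borel_rV.
Context {R : realType} (n : nat).

Let coord (i : 'I_n) (x : 'rV[R]_n) : measurableTypeR R := x ord0 i.

Let rV_set0 : g_sigma_preimage coord set0.
Proof. exact: sigma_algebra0. Qed.

Let rV_setC A : g_sigma_preimage coord A -> g_sigma_preimage coord (~` A).
Proof. exact: sigma_algebraC. Qed.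

Let rV_bigcup (F : _^nat) : (forall i, g_sigma_preimage coord (F i)) ->
  g_sigma_preimage coord (\bigcup_i (F i)).
Proof. exact: sigma_algebra_bigcup. Qed.

(* The product of n copies of the Borel sigma-algebra of R. *)
HB.instance Definition _ := @isMeasurable.Build default_measure_display
  'rV[R]_n (g_sigma_preimage coord) rV_set0 rV_setC rV_bigcup.

Lemma measurable_coord (i : 'I_n) :
  measurable_fun setT (fun x : 'rV[R]_n => x ord0 i : measurableTypeR R).
Proof.
move=> _ Y mY; rewrite setTI; apply: sub_sigma_algebra => /=.
rewrite -bigcup_seq/=; exists i => /=; first by rewrite mem_index_enum.
by exists Y => //; rewrite setTI.
Qed.

Lemma measurable_box (A : 'I_n -> set (measurableTypeR R)) :
    (forall i, measurable (A i)) ->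
  measurable [set x : 'rV[R]_n | forall i, A i (x ord0 i)].
Proof.
move=> mA; rewrite [X in measurable X](_ : _ =
  \big[setI/setT]_(i < n)
    ((fun x : 'rV[R]_n => x ord0 i : measurableTypeR R) @^-1` A i)).
  apply: bigsetI_measurable => i _; rewrite -[X in measurable X]setTI.
  exact: measurable_coord.
rewrite -bigcap_seq; apply/seteqP; split => x /= h i; first by move=> _; exact: h.
by apply: (h i); rewrite /= mem_index_enum.
Qed.

Lemma measurable_fun_rV d (T : measurableType d) (f : T -> 'rV[R]_n) :
  (forall i, measurable_fun setT (fun t => f t ord0 i : measurableTypeR R)) ->
  measurable_fun setT f.
Proof.
move=> mf; apply: (@measurability _ _ _ _ setT f
  (\big[setU/set0]_(i < n) preimage_set_system setT (coord i) measurable)) => //.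
move=> _ [B + <-]; rewrite -bigcup_seq/= => -[i _ [A mA <-]].
rewrite !setTI -comp_preimage -[X in measurable X]setTI.
exact: mf.
Qed.

End borel_rV.

Section rV_cons.
Context {R : realType} (n : nat).

Definition rV_cons (p : measurableTypeR R * 'rV[R]_n) : 'rV[R]_n.+1 :=
  \row_i oapp (p.2 ord0) p.1 (unlift ord0 i).

Definition rV_uncons (x : 'rV[R]_n.+1) : measurableTypeR R * 'rV[R]_n :=
  (x ord0 ord0, \row_i x ord0 (lift ord0 i)).

Lemma rV_consK : cancel rV_cons rV_uncons.
Proof.
move=> [a v]; rewrite /rV_uncons !mxE unlift_none/=; congr pair.
by apply/rowP => i; rewrite !mxE liftK.
Qed.

Lemma measurable_rV_cons : measurable_fun setT rV_cons.
Proof.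
apply: measurable_fun_rV => i; case: (unliftP ord0 i) => [j ->|->].
  rewrite [X in measurable_fun _ X](_ : _ = (fun x : 'rV[R]_n =>
      x ord0 j : measurableTypeR R) \o snd).
    exact: (measurableT_comp (measurable_coord j) measurable_snd).
  by apply/funext => p /=; rewrite mxE liftK.
rewrite [X in measurable_fun _ X](_ : _ = fst); first exact: measurable_fst.
by apply/funext => p /=; rewrite mxE unlift_none.
Qed.

Lemma measurable_rV_uncons : measurable_fun setT rV_uncons.
Proof.
apply: measurable_fun_pair => /=; first exact: measurable_coord.
apply: measurable_fun_rV => i.
rewrite [X in measurable_fun _ X](_ : _ = fun x : 'rV[R]_n.+1 =>
    x ord0 (lift ord0 i)).
  exact: measurable_coord.
by apply/funext => x; rewrite mxE.
Qed.

End rV_cons.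

Section borel_lebesgue_rV.
Context {R : realType}.
Local Open Scope ereal_scope.

Section step.
Context (n : nat) (mu : {sigma_finite_measure set 'rV[R]_n -> \bar R}).

Definition lebesgue_rV_step : set 'rV[R]_n.+1 -> \bar R :=
  pushforward (lebesgue_measure \x mu) (@rV_cons R n).

Let step0 : lebesgue_rV_step set0 = 0.
Proof. by rewrite /lebesgue_rV_step /pushforward preimage_set0 measure0. Qed.

Let step_ge0 A : 0 <= lebesgue_rV_step A.
Proof. exact: (measure_ge0 (lebesgue_measure \x mu)). Qed.

Let step_sigma_additive : semi_sigma_additive lebesgue_rV_step.
Proof.
move=> F mF tF mUF; rewrite /lebesgue_rV_step /pushforward preimage_bigcup.
have mpre A : measurable A -> measurable (@rV_cons R n @^-1` A).
  by move=> mA; rewrite -[X in measurable X]setTI; exact: measurable_rV_cons.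
apply: measure_semi_sigma_additive.
- by move=> k; exact: mpre.
- apply/trivIsetP => /= i j _ _ ij; rewrite -preimage_setI.
  by move/trivIsetP : tF => /(_ _ _ _ _ ij) ->//; rewrite preimage_set0.
- by rewrite -preimage_bigcup; exact: mpre.
Qed.

HB.instance Definition _ := isMeasure.Build _ _ _ lebesgue_rV_step
  step0 step_ge0 step_sigma_additive.

Let step_sigma_finite : sigma_finite setT lebesgue_rV_step.
Proof.
have /sigma_finiteP[F [TF ndF Foo]] := sigma_finiteT (@lebesgue_measure R).
have /sigma_finiteP[G [TG ndG Goo]] := sigma_finiteT mu.
exists (fun k => @rV_uncons R n @^-1` (F k `*` G k)).
  rewrite -preimage_bigcup -[LHS](preimage_setT (@rV_uncons R n)); congr preimage.
  rewrite -setXTT TF TG; apply/seteqP; split=> [[x y]|[x y]].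
    move=> [/= [i _ Fix] [j _ Gjy]]; exists (maxn i j) => //; split.
    - by move: x Fix; exact/subsetPset/ndF/leq_maxl.
    - by move: y Gjy; exact/subsetPset/ndG/leq_maxr.
  by move=> [i _ []/= ? ?]; split; exists i.
move=> k; have [mF Fkoo] := Foo k; have [mG Gkoo] := Goo k; split.
  rewrite -[X in measurable X]setTI; apply: measurable_rV_uncons => //.
  exact: measurableX.
rewrite /lebesgue_rV_step /pushforward (_ : _ @^-1` _ = F k `*` G k).
  by rewrite product_measure1E// lte_mul_pinfty// ge0_fin_numE.
by rewrite -comp_preimage (_ : _ \o _ = id)//; apply/funext; exact: rV_consK.
Qed.

HB.instance Definition _ := @Measure_isSigmaFinite.Build _ _ _
  lebesgue_rV_step step_sigma_finite.

End step.

Fixpoint borel_lebesgue_rV (n : nat) :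
    {sigma_finite_measure set 'rV[R]_n -> \bar R} :=
  if n is m.+1 then lebesgue_rV_step (borel_lebesgue_rV m)
  else \d_ (0%R : 'rV[R]_0).

Lemma borel_lebesgue_rV_box (n : nat) (A : 'I_n -> set (measurableTypeR R)) :
    (forall i, measurable (A i)) ->
  borel_lebesgue_rV n [set x | forall i, A i (x ord0 i)] =
  \prod_(i < n) lebesgue_measure (A i).
Proof.
elim: n A => [|n IH] A mA.
  rewrite big_ord0/= diracE mem_set//; by case.
rewrite big_ord_recl -IH//= /lebesgue_rV_step /pushforward.
rewrite -product_measure1E//; last first.
  exact: (measurable_box (fun i => mA (lift ord0 i))).
congr (product_measure1 _ _ _); apply/seteqP; split => -[a v] /=.
  move=> h; split; first by move: (h ord0); rewrite mxE unlift_none.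
  by move=> i; move: (h (lift ord0 i)); rewrite mxE liftK.
move=> [Aa Av] i; rewrite mxE; case: (unliftP ord0 i) => [j ->|->].
  by rewrite ?liftK; exact: Av.
by rewrite ?unlift_none.
Qed.

End borel_lebesgue_rV.

Section lebesgue_rV.
Context {R : realType}.

(* ['rV[R]_n] with the sigma-algebra of all Lebesgue-measurable sets (those that
   are Caratheodory-measurable for the outer measure of [borel_lebesgue_rV]). *)
Definition lebesgue_rV_type (n : nat) :=
  caratheodory_type ((@borel_lebesgue_rV R n)^*)%mu.

HB.instance Definition _ (n : nat) := Measurable.on (lebesgue_rV_type n).

Definition lebesgue_rV (n : nat) : set (lebesgue_rV_type n) -> \bar R :=
  @completed_measure_extension _ _ _ (@borel_lebesgue_rV R n).

HB.instance Definition _ (n : nat) := Measure.on (@lebesgue_rV n).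

Let lebesgue_rV_sigma_finite (n : nat) : sigma_finite setT (@lebesgue_rV n).
Proof.
exact/completed_measure_extension_sigma_finite/sigma_finiteT.
Qed.

HB.instance Definition _ (n : nat) := @Measure_isSigmaFinite.Build _ _ _
  (@lebesgue_rV n) (@lebesgue_rV_sigma_finite n).

Lemma lebesgue_rV_box (n : nat) (A : 'I_n -> set (measurableTypeR R)) :
    (forall i, measurable (A i)) ->
  lebesgue_rV [set x : 'rV[R]_n | forall i, A i (x ord0 i)] =
  (\prod_(i < n) lebesgue_measure (A i))%E.
Proof.
move=> mA; rewrite -borel_lebesgue_rV_box//.
apply: measurable_mu_extE; exact: measurable_box.
Qed.

End lebesgue_rV.

Arguments lebesgue_rV_type R n : clear implicits.
Arguments lebesgue_rV R n : clear implicits.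

Section fractional_laplacian.
Context {R : realType} {n : nat}.
Implicit Types (x y : 'rV[R]_n) (s C : R) (u psi : 'rV[R]_n -> R).

(* [`|x|] is the sup norm of ['rV[R]_n]; this is the Euclidean one. *)
Definition enorm x : R := Num.sqrt (\sum_i x ord0 i ^+ 2).

Definition unit_ball : set 'rV[R]_n := [set x | enorm x < 1].

Definition partial (i : 'I_n) psi : 'rV[R]_n -> R :=
  fun x => 'D_(delta_mx ord0 i) psi x.

Definition smooth psi : Prop :=
  forall l : seq 'I_n,
    continuous (foldr partial psi l) /\
    forall i x, derivable (foldr partial psi l) x (delta_mx ord0 i).

Definition tsupport psi : set 'rV[R]_n := closure [set x | psi x != 0].

(* Membership in C_0^oo(Omega), with functions extended by zero to R^n. *)
Definition test_function (Omega : set 'rV[R]_n) psi : Prop :=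
  [/\ smooth psi, compact (tsupport psi) & tsupport psi `<=` Omega].

(* The constant C stands for C_{n,s}. *)
Definition fracLaplacian C s psi x : R :=
  C * lim ((\int[lebesgue_rV R n]_(y in [set y : 'rV[R]_n | eps < enorm (x - y)])
              ((psi x - psi y) / enorm (x - y) `^ (n%:R + 2 * s)))
           @[eps --> 0^'+]).

Definition calL s u : Prop :=
  measurable_fun [set: lebesgue_rV_type R n] (u : _ -> measurableTypeR R) /\
  (\int[lebesgue_rV R n]_x (`|u x| / (1 + enorm x `^ (n%:R + 2 * s)))%:E < +oo)%E.

Definition distr_fracLaplacian C s u psi : R :=
  \int[lebesgue_rV R n]_x (u x * fracLaplacian C s psi x).

Definition fracLaplacian_ge0 (Omega : set 'rV[R]_n) C s u : Prop :=
  forall psi, test_function Omega psi -> (forall x, 0 <= psi x) ->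
    0 <= distr_fracLaplacian C s u psi.

End fractional_laplacian.

Arguments unit_ball R n : clear implicits.

(* Main.v *)
Require Import Defs.
From HB Require Import structures.
From mathcomp Require Import all_boot all_order all_algebra.
From mathcomp Require Import all_classical all_reals all_analysis.
From mathcomp Require Import measurable_realfun.
From mathcomp Require Import ring lra.
Import Order.TTheory GRing.Theory Num.Theory.
Import numFieldNormedType.Exports.
Set Implicit Arguments.
Unset Strict Implicit.
Unset Printing Implicit Defensive.
Local Open Scope classical_set_scope.
Local Open Scope ring_scope.

(* Idea. It suffices to test against Lipschitz functions [f] with values in
   [0, 1] and show [int_(B_1) u f >= 0]. Cut the kernel [|z|^-(n+2s)] off at
   [|z| = d]; the truncated operator [L_d] has an integrable kernel, so monotone
   iteration solves [L_d phi = f] on the ball of radius [1 - 2 e] with [phi = 0]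
   outside, and comparison with the barrier [(1 - |x|)_+^s] (a supersolution,
   because the half-space functions [(1 - e . x)_+^s] are s-harmonic) gives
   [0 <= phi <= A (1 - |x|)_+^s]. Mollifying [phi] at scale [e] and letting [d] be
   tiny yields a test function [psi >= 0] with [(-Delta)^s psi] close to [C f] on
   [|x| < 1 - 3 e], of size [O(e^-s)] on the remaining annulus, and [<= 0] outside
   the ball. Since the annulus has measure [O(e)], Young's inequality with the
   exponents [1 / (1 - s)] and [1 / s], which is where [u] in [L^(1/(1-s))] is used,
   makes its contribution vanish as [e] tends to [0]. *)

(** * Lebesgue measure on R^n *)

(** The exact solution of the Dirichlet problem in the ball is in general not an admissible test
    function: it behaves like (1 - |x|)^s at the sphere. Cutting the kernel off turns the equation
    into M phi = f + J * phi with M = int J finite, which makes sense for merely measurable phi, and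
    mollification commutes with the convolution. The price is an order of choices: a mollification
    at scale e has second differences of size e^-(n+2), so d is fixed after e. The rate e^-s on the
    annulus is the barrier value e^s divided by e^(2s). It is borderline: on a set of measure O(e)
    the L^(1/s) norm of e^-s is bounded but need not tend to 0, so the decay must come from the
    integral of |u|^(1/(1-s)) over the shrinking annulus. A parameter t in Young's inequality
    separates the two factors; e tends to 0 first, t afterwards. Fubini arguments use the Borel
    measure, an iterated product by construction. Since u is only Lebesgue measurable, {u < 0} need
    not be Borel, which shapes the last step. *)

Section integral_lebesgue_rV.
Context {R : realType} (n : nat).
Notation mu := (@borel_lebesgue_rV R n).
Notation mubar := (lebesgue_rV R n).

Lemma measurable_lebesgue_rV (A : set 'rV[R]_n) :
  measurable A -> measurable (A : set (lebesgue_rV_type R n)).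
Proof. by move=> mA; exact: caratheodory_measurable_mu_ext. Qed.

Lemma lebesgue_rVE (A : set 'rV[R]_n) : measurable A -> mubar A = mu A.
Proof. by move=> mA; exact: measurable_mu_extE. Qed.

Lemma measurable_fun_lebesgue_rV d (T : measurableType d) (f : 'rV[R]_n -> T) :
  measurable_fun setT f ->
  measurable_fun [set: lebesgue_rV_type R n] (f : lebesgue_rV_type R n -> T).
Proof.
move=> mf _ Y mY; apply: measurable_lebesgue_rV; exact: mf.
Qed.

(** The identity is measurable from the completed sigma-algebra to the Borel one and pushes the
    completed measure forward to the Borel measure. Borel integrands can therefore be treated with
    the product structure of [borel_lebesgue_rV]. *)
Lemma ge0_integral_lebesgue_rVE (f : 'rV[R]_n -> \bar R) :
  measurable_fun setT f -> (forall x, (0 <= f x)%E) ->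
  (\int[mubar]_x f x = \int[mu]_x f x)%E.
Proof.
move=> mf f0.
have mid : measurable_fun [set: lebesgue_rV_type R n] (idfun : lebesgue_rV_type R n -> 'rV[R]_n).
  by apply: measurable_fun_lebesgue_rV; exact: measurable_id.
transitivity (\int[pushforward mubar (idfun : lebesgue_rV_type R n -> 'rV[R]_n)]_x f x)%E.
  by rewrite ge0_integral_pushforward.
apply: eq_measure_integral => A mA _.
exact: lebesgue_rVE.
Qed.

Lemma integral_lebesgue_rVE (f : 'rV[R]_n -> \bar R) : measurable_fun setT f ->
  (\int[mubar]_x f x = \int[mu]_x f x)%E.
Proof.
move=> mf; rewrite integralE [RHS]integralE; congr (_ - _)%E.
- by apply: ge0_integral_lebesgue_rVE => //; exact: measurable_funepos.
- by apply: ge0_integral_lebesgue_rVE => //; exact: measurable_funeneg.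
Qed.

End integral_lebesgue_rV.

(** * Affine changes of variables *)

Section affine1.
Context {R : realType}.
Local Open Scope ereal_scope.
Notation leb := (@lebesgue_measure R).

(** The pushforward of Lebesgue measure under x -> c x + a, multiplied by |c|, gives half-open
    intervals their length, so uniqueness identifies it. For c < 0 the preimage is closed on the
    other side, which does not change its length. *)
Lemma ge0_integral_affine1 (c a : R) (f : measurableTypeR R -> \bar R) : c != 0%R ->
  measurable_fun setT f -> (forall x, 0 <= f x) ->
  `|c|%:E * \int[leb]_x f (c * x + a)%R = \int[leb]_x f x.
Proof.
move=> c0 mf f0.
have mg : measurable_fun setT ((fun x : measurableTypeR R => (c * x + a)%R) : _ -> measurableTypeR R).
  apply: measurable_funD => //; exact: mulrl_measurable.
have c0' : (0 <= `|c|)%R by [].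
rewrite -(ge0_integral_pushforward mg _ (D := setT) (f := f))//.
pose k := NngNum c0'.
rewrite -[`|c|%R]/(k%:num) -(ge0_integral_mscale _ measurableT k)//.
apply/esym.
apply: eq_measure_integral => A mA _.
apply: lebesgue_measure_unique => // X /= /ocitvP[->|[[x y]/= xy ->]].
  by rewrite !measure0.
rewrite /mscale/= /pushforward.
have [cp|cn] := ltP 0%R c.
  have -> : (fun x0 => (c * x0 + a)%R) @^-1` `]x, y] = `]((x - a) / c)%R, ((y - a) / c)%R]%classic.
    apply/seteqP; split => t /=; rewrite !in_itv/= ltr_pdivrMr// ler_pdivlMr// (mulrC t) ltrBlDr lerBrDr//.
  rewrite !lebesgue_measure_itv/= !lte_fin ltr_pM2r ?invr_gt0// ltrBlDr subrK xy !EFinN -!EFinD -EFinM gtr0_norm//.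
  by congr EFin; field.
have {}cn : (c < 0)%R by rewrite lt_neqAle c0.
have -> : (fun x0 => (c * x0 + a)%R) @^-1` `]x, y] = `[((y - a) / c)%R, ((x - a) / c)%R[%classic.
  apply/seteqP; split => t /=; rewrite !in_itv/= ltr_ndivlMr// ler_ndivrMr// (mulrC t) ltrBlDr lerBrDr// andbC//.
rewrite !lebesgue_measure_itv/= !lte_fin ltr_nM2r ?invr_lt0// ltrBlDr subrK xy !EFinN -!EFinD -EFinM ltr0_norm//.
by congr EFin; field.
Qed.

End affine1.

Section affine.
Context {R : realType}.
Local Open Scope ereal_scope.

Lemma measurable_rV_affine n (c : R) (a : 'rV[R]_n) :
  measurable_fun setT (fun x : 'rV[R]_n => (c *: x + a)%R).
Proof.
apply: measurable_fun_rV => i.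
rewrite (_ : (fun t => _) = (fun t : 'rV[R]_n => (c * t ord0 i + a ord0 i)%R)).
  apply: measurable_funD => //; apply: measurable_funM => //.
  exact: measurable_coord.
by apply/funext => t; rewrite !mxE.
Qed.

Lemma ge0_integral_rVS n (f : 'rV[R]_n.+1 -> \bar R) :
  measurable_fun setT f -> (forall x, 0 <= f x) ->
  \int[borel_lebesgue_rV n.+1]_x f x =
  \int[@lebesgue_measure R]_a \int[borel_lebesgue_rV n]_v f (rV_cons (a, v)).
Proof.
move=> mf f0.
rewrite -[LHS]/(\int[pushforward (lebesgue_measure \x borel_lebesgue_rV n) (@rV_cons R n)]_x f x).
rewrite (ge0_integral_pushforward (@measurable_rV_cons R n))//.
rewrite preimage_setT fubini_tonelli1//.
  by apply: measurableT_comp => //; exact: measurable_rV_cons.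
by move=> x; exact: f0.
Qed.

(** Induction on the dimension: the head coordinate contributes one factor |c| by the
    one-dimensional case, the tail contributes |c|^n. *)
Lemma ge0_integral_affine n (c : R) (a : 'rV[R]_n) (f : 'rV[R]_n -> \bar R) : c != 0%R ->
  measurable_fun setT f -> (forall x, 0 <= f x) ->
  (`|c| ^+ n)%:E * \int[borel_lebesgue_rV n]_x f (c *: x + a)%R =
  \int[borel_lebesgue_rV n]_x f x.
Proof.
move=> c0; elim: n a f => [|n IH] a f mf f0.
  rewrite expr0 mul1e; apply: eq_integral => x _; congr f.
  by apply/rowP => -[].
have mfc : measurable_fun setT (fun p : measurableTypeR R * 'rV[R]_n => f (rV_cons p)).
  by apply: measurableT_comp => //; exact: measurable_rV_cons.
rewrite ge0_integral_rVS//; last first.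
  by apply: measurableT_comp => //; exact: measurable_rV_affine.
pose g (t : R) := \int[borel_lebesgue_rV n]_v f (rV_cons (t, v)).
have mg : measurable_fun setT (g : measurableTypeR R -> _).
  exact: (measurable_fun_fubini_tonelli_F (fun p => f (rV_cons p))).
have g0 t : 0 <= g t by apply: integral_ge0.
pose a' : 'rV[R]_n := (\row_i a ord0 (lift ord0 i))%R.
have E (t : R) : (`|c| ^+ n)%:E * \int[borel_lebesgue_rV n]_v f (c *: rV_cons (t, v) + a)%R = g (c * t + a ord0 ord0)%R.
  rewrite /g -(IH a' (fun v => f (rV_cons ((c * t + a ord0 ord0)%R, v))))//.
    congr (_ * _); apply: eq_integral => v _; congr f.
    apply/rowP => i; rewrite !mxE/=; case: (unliftP ord0 i) => [j ->|->] /=; last first.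
      by rewrite ?unlift_none.
    by rewrite !mxE.
  by apply: (measurableT_comp mfc); exact: measurable_pair1.
rewrite exprS EFinM -muleA -ge0_integralZl//; last 2 first.
- apply: (measurable_fun_fubini_tonelli_F (fun p => f (c *: rV_cons p + a)%R)) => //.
  apply: (measurableT_comp mf).
  apply: (measurableT_comp (measurable_rV_affine c a)); exact: measurable_rV_cons.
- by move=> t _; apply: integral_ge0.
under eq_integral do rewrite E.
by rewrite (ge0_integral_affine1 (a ord0 ord0) c0 mg)// ge0_integral_rVS.
Qed.

Lemma ge0_integral_shift n (a : 'rV[R]_n) (f : 'rV[R]_n -> \bar R) :
  measurable_fun setT f -> (forall x, 0 <= f x) ->
  \int[borel_lebesgue_rV n]_x f (x + a)%R = \int[borel_lebesgue_rV n]_x f x.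
Proof.
move=> mf f0; rewrite -[RHS](@ge0_integral_affine n 1%R a)//.
by rewrite normr1 expr1n mul1e; under [RHS]eq_integral do rewrite scale1r.
Qed.

Lemma ge0_integral_reflect n (a : 'rV[R]_n) (f : 'rV[R]_n -> \bar R) :
  measurable_fun setT f -> (forall x, 0 <= f x) ->
  \int[borel_lebesgue_rV n]_x f (a - x)%R = \int[borel_lebesgue_rV n]_x f x.
Proof.
move=> mf f0; rewrite -[RHS](@ge0_integral_affine n (-1)%R a)//.
  by rewrite normrN1 expr1n mul1e; under [RHS]eq_integral do rewrite scaleN1r addrC.
Qed.

End affine.

(** * The Euclidean norm *)

Section enorm_theory.
Context {R : realType} {n : nat}.
Implicit Types (x y e : 'rV[R]_n).

Definition dotp x y : R := \sum_i x ord0 i * y ord0 i.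

Lemma enorm_ge0 x : 0 <= enorm x.
Proof. exact: sqrtr_ge0. Qed.
Hint Resolve enorm_ge0 : core.

Lemma sqr_enorm x : enorm x ^+ 2 = \sum_i x ord0 i ^+ 2.
Proof. by rewrite sqr_sqrtr// sumr_ge0// => i _; exact: sqr_ge0. Qed.

Lemma enorm0 : enorm (0 : 'rV[R]_n) = 0.
Proof. by rewrite /enorm big1 ?sqrtr0// => i _; rewrite mxE expr0n. Qed.

Lemma enormZ (c : R) x : enorm (c *: x) = `|c| * enorm x.
Proof.
rewrite /enorm -sqrtr_sqr -sqrtrM ?sqr_ge0//; congr Num.sqrt.
by rewrite mulr_sumr; apply: eq_bigr => i _; rewrite mxE exprMn.
Qed.

Lemma enormN x : enorm (- x) = enorm x.
Proof. by rewrite -scaleN1r enormZ normrN1 mul1r. Qed.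

Lemma enormB x y : enorm (x - y) = enorm (y - x).
Proof. by rewrite -opprB enormN. Qed.

Lemma le_coord_enorm x i : `|x ord0 i| <= enorm x.
Proof.
rewrite -sqrtr_sqr ler_wsqrtr// (bigD1 i)//= lerDl sumr_ge0// => j _.
exact: sqr_ge0.
Qed.

Lemma enorm_eq0 x : (enorm x == 0) = (x == 0).
Proof.
apply/idP/idP => [/eqP x0|/eqP ->]; last by rewrite enorm0.
apply/eqP/rowP => i; rewrite mxE; apply/eqP.
by rewrite -normr_le0 -x0 le_coord_enorm.
Qed.

Lemma enorm_gt0 x : (0 < enorm x) = (x != 0).
Proof. by rewrite lt_neqAle enorm_ge0 andbT eq_sym enorm_eq0. Qed.

Lemma dotp_le x y : dotp x y <= enorm x * enorm y.
Proof.
have [->|x0] := eqVneq x 0.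
  by rewrite enorm0 mul0r /dotp big1// => i _; rewrite mxE mul0r.
have [->|y0] := eqVneq y 0.
  by rewrite enorm0 mulr0 /dotp big1// => i _; rewrite mxE mulr0.
rewrite -!enorm_gt0 in x0 y0.
(* Expanded, this sum of squares is 2 |x| |y| (|x| |y| - x . y), whose first factor is positive. *)
have : 0 <= \sum_i (enorm y * x ord0 i - enorm x * y ord0 i) ^+ 2.
  by apply: sumr_ge0 => i _; exact: sqr_ge0.
have -> : \sum_i (enorm y * x ord0 i - enorm x * y ord0 i) ^+ 2 =
    enorm y ^+ 2 * enorm x ^+ 2 + enorm x ^+ 2 * enorm y ^+ 2 +
    (- 2 * enorm x * enorm y) * dotp x y.
  rewrite {1}(sqr_enorm x) {2}(sqr_enorm y) /dotp !mulr_sumr -!big_split/=.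
  by apply: eq_bigr => i _; ring.
rewrite (_ : _ + _ = 2 * (enorm x * enorm y) * (enorm x * enorm y - dotp x y)); last by ring.
by rewrite pmulr_rge0 ?subr_ge0// !mulr_gt0.
Qed.

Lemma enormD x y : enorm (x + y) <= enorm x + enorm y.
Proof.
rewrite -(ler_pXn2r (ltn0Sn 1)) ?nnegrE ?addr_ge0//.
rewrite sqrrD !sqr_enorm.
rewrite (_ : \sum_i _ = \sum_i x ord0 i ^+ 2 + dotp x y *+ 2 + \sum_i y ord0 i ^+ 2).
  by rewrite lerD2r lerD2l lerMn2r/= dotp_le.
rewrite /dotp -sumrMnl -!big_split/=; apply: eq_bigr => i _.
by rewrite mxE sqrrD.
Qed.

Lemma ler_dist_enorm x y : `|enorm x - enorm y| <= enorm (x - y).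
Proof.
have := enormD (x - y) y; have := enormD (y - x) x.
by rewrite !subrK (enormB y) ler_norml => *; apply/andP; split; lra.
Qed.

Lemma enorm_le_coord x (r : R) :
  (forall i, `|x ord0 i| <= r) -> enorm x <= n%:R * r.
Proof.
move=> xr; case: (posnP n) => [n0|n0].
  rewrite (_ : x = 0) ?enorm0 ?n0 ?mul0r//.
  by apply/rowP => i; have := ltn_ord i; rewrite {2}n0.
have r0 : 0 <= r by apply: le_trans (xr (Ordinal n0)).
rewrite -(ler_pXn2r (ltn0Sn 1)) ?nnegrE ?mulr_ge0//.
rewrite sqr_enorm exprMn.
apply: (@le_trans _ _ (\sum_(i < n) r ^+ 2)).
  by apply: ler_sum => i _; rewrite -real_normK ?num_real// ler_pXn2r ?nnegrE.
rewrite sumr_const card_ord -[_ *+ n]mulr_natl ler_wpM2r ?sqr_ge0//.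
by rewrite expr2 ler_peMl// ler1n.
Qed.

Lemma dotpD e x y : dotp e (x + y) = dotp e x + dotp e y.
Proof. by rewrite /dotp -big_split/=; apply: eq_bigr => i _; rewrite mxE mulrDr. Qed.

Lemma dotpZ e (c : R) x : dotp e (c *: x) = c * dotp e x.
Proof. by rewrite /dotp mulr_sumr; apply: eq_bigr => i _; rewrite mxE mulrCA. Qed.

Lemma dotpN e x : dotp e (- x) = - dotp e x.
Proof. by rewrite -scaleN1r dotpZ mulN1r. Qed.

Lemma dotpp x : dotp x x = enorm x ^+ 2.
Proof. by rewrite sqr_enorm; apply: eq_bigr => i _; rewrite expr2. Qed.

Lemma normr_dotp x y : `|dotp x y| <= enorm x * enorm y.
Proof. by rewrite ler_norml lerNl -dotpN dotp_le andbT -(enormN y) dotp_le. Qed.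

Lemma measurable_dotp e : measurable_fun setT (dotp e : 'rV[R]_n -> R).
Proof.
apply: measurable_sum => i; apply: measurable_funM => //; exact: measurable_coord.
Qed.

Lemma measurable_enorm : measurable_fun setT (@enorm R n).
Proof.
apply: measurableT_comp => /=.
  by apply: continuous_measurable_fun => /=; exact: sqrt_continuous.
apply: measurable_sum => i; apply: measurable_funX; exact: measurable_coord.
Qed.

Lemma enorm_le_norm x : enorm x <= n%:R * `|x|.
Proof.
apply: enorm_le_coord => i.
by rewrite [`|x|]mx_normrE; apply: (le_bigmax _ (fun ij => `|x ij.1 ij.2|) (ord0, i)).
Qed.

Lemma norm_le_enorm x : `|x| <= enorm x.
Proof.
rewrite [`|x|]mx_normrE; apply: bigmax_le => // -[i j] _ /=.
by rewrite (ord1 i) le_coord_enorm.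
Qed.

Lemma lipschitz_continuous_rV (C : R) (f : 'rV[R]_n -> R) :
  (forall x y, `|f x - f y| <= C * enorm (x - y)) -> continuous f.
Proof.
move=> fC x; apply/(@cvgrPdist_le _ _ _ _ (nbhs_filter x)) => e e0.
(* Continuity refers to the sup norm, whence the factor n; the two summands 1 keep [D] positive when
   [C] or [n] is 0. *)
pose D := (`|C| + 1) * (n%:R + 1).
have D0 : 0 < D by rewrite mulr_gt0// ltr_wpDl.
have : \forall y \near x, `|x - y| < e / D.
  by apply: (@cvgr_dist_lt _ 'rV[R]_n _ _ (nbhs_filter x) id x); [exact: cvg_id|rewrite divr_gt0].
apply: filterS => y xy.
apply: (le_trans (fC x y)).
apply: (@le_trans _ _ (`|C| * (n%:R * `|x - y|))).
  by rewrite (le_trans (ler_wpM2r _ (ler_norm C)))// ler_wpM2l// enorm_le_norm.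
apply: (@le_trans _ _ (D * `|x - y|)).
  by rewrite /D mulrA ler_wpM2r// ler_pM// lerDl.
by rewrite mulrC -ler_pdivlMr// ltW.
Qed.

Lemma continuous_enorm : continuous (@enorm R n).
Proof.
apply: (@lipschitz_continuous_rV 1) => x y; rewrite mul1r; exact: ler_dist_enorm.
Qed.

End enorm_theory.
#[export] Hint Extern 0 (is_true (0 <= enorm _)) => solve [exact: enorm_ge0] : core.

(** * Integration of radial functions *)

Section ftc_wrappers.
Context {R : realType}.
Implicit Types (f F : R -> R) (a b l : R).
Notation leb := (@lebesgue_measure R).

Lemma derivable_continuous f x : derivable f x 1 -> {for x, continuous f}.
Proof. by move=> df; apply/differentiable_continuous/derivable1_diffP. Qed.

Lemma integral_derivable f F a b : a < b ->
  (forall x, a <= x <= b -> is_derive x 1 F (f x)) ->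
  (forall x, a <= x <= b -> derivable f x 1) ->
  (\int[leb]_(x in `[a, b]) (f x)%:E = (F b - F a)%:E)%E.
Proof.
move=> ab dF df; rewrite (@continuous_FTC2 _ f F)//.
- by apply: derivable_within_continuous => x; rewrite in_itv/=; exact: df.
- have cF x : a <= x <= b -> {for x, continuous F}.
    by move=> /dF [dFx _]; exact: derivable_continuous.
  split.
  + by move=> x; rewrite in_itv/= => /andP[ax xb]; have [|//] := dF x; rewrite !ltW.
  + by apply: cvg_at_right_filter; apply: cF; rewrite lexx ltW.
  + by apply: cvg_at_left_filter; apply: cF; rewrite lexx ltW.
- move=> x; rewrite in_itv/= => /andP[ax xb]; rewrite derive1E.
  by have [|_ ->//] := dF x; rewrite !ltW.
Qed.

Lemma ge0_integral_derivabley f F a l :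
  (forall x, a <= x -> 0 <= f x) ->
  (forall x, a <= x -> is_derive x 1 F (f x)) ->
  (forall x, a <= x -> derivable f x 1) ->
  F x @[x --> +oo] --> l ->
  (\int[leb]_(x in `[a, +oo[) (f x)%:E = (l - F a)%:E)%E.
Proof.
move=> f0 dF df Fl; rewrite (@ge0_continuous_FTC2y _ f F a l)//.
- by apply: derivable_within_continuous => x; rewrite in_itv/= andbT; exact: df.
- by move=> x ax; have [|//] := dF x; exact: ltW.
- apply: cvg_at_right_filter; apply: derivable_continuous.
  by have [] := dF a (lexx _).
- move=> x; rewrite in_itv/= andbT => ax; rewrite derive1E.
  by have [|_ ->//] := dF x; exact: ltW.
Qed.

Lemma powR_cvgy0 (p : R) : p < 0 -> x `^ p @[x --> +oo] --> (0 : R).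
Proof.
move=> p0; apply/cvgrPdist_lt => e e0.
near=> x.
have x0 : 0 < x by near: x; exact: nbhs_pinfty_gt.
rewrite sub0r normrN ger0_norm ?powR_ge0//.
rewrite -[p]opprK powRN -(@invrK _ e) ltf_pV2 ?posrE ?invr_gt0 ?powR_gt0//.
rewrite -(@powRr1 _ e^-1) ?invr_ge0 ?ltW// -(@mulVf _ (- p)) ?oppr_eq0 ?lt_eqF// powRrM.
apply: gt0_ltr_powR; rewrite ?oppr_gt0 ?nnegrE ?powR_ge0 ?ltW//.
Unshelve. all: by end_near. Qed.

Lemma is_derive_powRdiv (p x : R) : p != 0 -> 0 < x ->
  is_derive x 1 (fun x => p^-1 * x `^ p) (x `^ (p - 1)).
Proof.
move=> p0 x0; have := is_derive1_powR p x0 => dx.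
have -> : x `^ (p - 1) = p^-1 *: (p * x `^ (p - 1)) by rewrite /GRing.scale/=; field.
exact: is_deriveZ.
Qed.

Lemma integral_powR_cc (p a b : R) : p != 0 -> 0 < a -> a < b ->
  (\int[leb]_(x in `[a, b]) (x `^ (p - 1))%:E = ((b `^ p - a `^ p) / p)%:E)%E.
Proof.
move=> p0 a0 ab.
have x0 x : a <= x <= b -> 0 < x by move=> /andP[ax _]; exact: lt_le_trans ax.
rewrite (integral_derivable ab (fun x h => is_derive_powRdiv p0 (x0 x h))).
  by congr EFin; field.
by move=> x /x0 x1; apply: derivable_powR; rewrite in_itv/= x1.
Qed.

Lemma integral_powR_cy (p a : R) : p < 0 -> 0 < a ->
  (\int[leb]_(x in `[a, +oo[) (x `^ (p - 1))%:E = (a `^ p / - p)%:E)%E.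
Proof.
move=> p0 a0; have pn0 : p != 0 by rewrite lt_eqF.
have x0 x : a <= x -> 0 < x by exact: lt_le_trans.
rewrite (@ge0_integral_derivabley _ _ a 0 _ (fun x h => is_derive_powRdiv pn0 (x0 x h))).
- by congr EFin; field.
- by move=> x _; exact: powR_ge0.
- by move=> x /x0 x1; apply: derivable_powR; rewrite in_itv/= x1.
- by rewrite -(mulr0 p^-1); apply: cvgM; [exact: cvg_cst|exact: powR_cvgy0].
Qed.

Lemma integral_powR_oc (p b : R) : 0 < p -> 0 < b ->
  (\int[leb]_(x in `]0%R, b]) (x `^ (p - 1))%:E = (b `^ p / p)%:E)%E.
Proof.
move=> p0 b0.
(* The integrand may blow up at 0, so the interval is exhausted from the right. The shift to [k.+2]
   keeps every left endpoint strictly below b. *)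
have -> : `]0, b]%classic = \bigcup_k `[(b / k.+2%:R), b]%classic.
  apply/seteqP; split => x /=; rewrite !in_itv/=.
    move=> /andP[x0 xb]; exists (Num.truncn (b / x)) => //=; rewrite in_itv/= xb andbT.
    rewrite ler_pdivrMr// mulrC -ler_pdivrMr// ltW//.
    by rewrite (lt_le_trans (truncnS_gt _))// ler_nat.
  move=> [k _] /=; rewrite in_itv/= => /andP[kx ->]; rewrite andbT.
  by rewrite (lt_le_trans _ kx)// divr_gt0.
have -> : (b `^ p / p)%:E = limn (fun k => (\int[leb]_(x in `[(b / k.+2%:R)%R, b]) (x `^ (p - 1))%:E)%E).
  apply/esym/cvg_lim => //.
  rewrite (_ : (fun k => _) = (fun k => ((b `^ p - (b / k.+2%:R) `^ p) / p)%:E)); last first.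
    apply/funext => k; rewrite integral_powR_cc ?gt_eqF ?divr_gt0//.
    by rewrite ltr_pdivrMr// ltr_pMr// ltr1n.
  apply: cvg_EFin; first exact: nearW.
  rewrite -[X in _ --> X](subr0 _) -[X in _ --> _ - X](mul0r p^-1).
  under eq_fun do rewrite /= mulrBl.
  apply: cvgB; first exact: cvg_cst.
  apply: cvgMl.
  have -> : (fun k : nat => (b / k.+2%:R) `^ p) = (fun k => b `^ p * k.+2%:R `^ (- p)).
    by apply/funext => k; rewrite powRM ?ltW ?invr_gt0// powRN -(powR_inv1 (ler0n _ _)) -powRrM mulN1r powRN.
  rewrite -[X in _ --> X](mulr0 (b `^ p)); apply: cvgM; first exact: cvg_cst.
  have np : - p < 0 by rewrite oppr_lt0.
  apply: cvg_comp (powR_cvgy0 np).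
  apply/cvgryPge => A; near=> k; apply: (@le_trans _ _ k%:R); last by rewrite ler_nat -addn2 leq_addr.
  by near: k; exact: nbhs_infty_ger.
apply/esym/cvg_lim => //.
apply: ge0_nondecreasing_set_cvg_integral => //.
- move=> i j ij; apply/subsetPset => x /=; rewrite !in_itv/= => /andP[h ->].
  by rewrite andbT (le_trans _ h)// ler_pM2l// lef_pV2 ?posrE// ler_nat.
- move=> i; apply/measurable_EFinP; apply: measurable_funTS; exact: measurable_powR.
- by move=> i x _; rewrite lee_fin powR_ge0.
Unshelve. all: by end_near. Qed.
End ftc_wrappers.

(** * Polar coordinates without a measure on the sphere *)

Section polar.
Context {R : realType} (n : nat).
Local Open Scope ereal_scope.
Notation mu := (@borel_lebesgue_rV R n).
Notation leb := (@lebesgue_measure R).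

(* The weight |w| 1_{1<|w|<=2}: its averages over dilations are constant,
   [int_0^oo polarw (z / l) dl / l = 1] for [z != 0]. *)
Definition polarw (w : 'rV[R]_n) : R :=
  if (1 < enorm w <= 2)%R then enorm w else 0%R.

Lemma polarw_ge0 w : (0 <= polarw w)%R.
Proof. by rewrite /polarw; case: ifPn. Qed.

Lemma measurable_polarw : measurable_fun setT polarw.
Proof.
rewrite (_ : polarw = fun w => (enorm w * (\1_(`]1%R, 2%R]%classic : set R) (enorm w)))%R).
  apply: measurable_funM; first exact: measurable_enorm.
  apply: (measurableT_comp (f := (\1_(`]1%R, 2%R]%classic) : R -> R))); last exact: measurable_enorm.
  exact: measurable_indic.
apply/funext => w; rewrite /polarw indicE mem_setE in_itv/=.
by case: ifPn => _; rewrite ?mulr1 ?mulr0.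
Qed.

Lemma measurable_scale2 : measurable_fun setT
  (fun p : 'rV[R]_n * measurableTypeR R => p.2 *: p.1)%R.
Proof.
apply: measurable_fun_rV => i.
rewrite (_ : (fun t => _) = (fun p : 'rV[R]_n * measurableTypeR R => p.2 * p.1 ord0 i)%R).
  apply: measurable_funM; first exact: measurable_snd.
  exact: (measurableT_comp (measurable_coord i) measurable_fst).
by apply/funext => t; rewrite !mxE.
Qed.

Lemma measurable_rV_scale (c : R) : measurable_fun setT (fun x : 'rV[R]_n => c *: x)%R.
Proof.
have := measurable_rV_affine c (0%R : 'rV[R]_n).
by under eq_fun do rewrite addr0.
Qed.

Lemma integral_polarw (z : 'rV[R]_n) : z != 0%R ->
  \int[leb]_(l in `]0%R, +oo[) (polarw (l `^ (-1) *: z) * l `^ (-1))%:E = 1.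
Proof.
rewrite -enorm_gt0; set r := enorm z => r0.
(* The condition 1 < r / l <= 2 confines l to [r / 2, r[, where the weight equals r / l. *)
transitivity (\int[leb]_(l in `[(r / 2)%R, r[) (r * l `^ (-1 - 1))%:E).
  rewrite integral_mkcond [RHS]integral_mkcond; apply: eq_integral => l _.
  rewrite !patchE !mem_setE !in_itv/= andbT.
  case: (ltP 0%R l) => l0; last first.
    by case: ifPn => // /andP[h _]; exfalso; lra.
  have -> : (l `^ (-1 - 1) = l^-1 * l^-1)%R.
    by rewrite powRB ?(gt_eqF l0) ?implybT// powR_inv1 ?(ltW l0)// powRr1 ?(ltW l0).
  rewrite powR_inv1 ?(ltW l0)// /polarw enormZ ger0_norm ?invr_ge0 ?(ltW l0)// -/r (mulrC _ r).
  rewrite ltr_pdivlMr// mul1r ler_pdivrMr// ler_pdivrMr// mulrC [in RHS]mulrC andbC.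
  case: ifPn => _; last by rewrite mul0r.
  by congr EFin; ring.
have rr : (r / 2 < r)%R by lra.
rewrite integral_itv_bndo_bndc; last first.
  apply/measurable_EFinP; apply: measurable_funM => //.
  by apply: measurable_funTS; exact: measurable_powR.
under eq_integral do rewrite EFinM.
rewrite ge0_integralZl//; last 3 first.
- apply/measurable_EFinP; apply: measurable_funTS; exact: measurable_powR.
- by move=> x _; rewrite lee_fin powR_ge0.
- by rewrite lee_fin ltW.
rewrite integral_powR_cc//; last by lra.
rewrite -EFinM !powR_inv1; [|lra..].
by congr EFin; field; rewrite gt_eqF.
Qed.

(** Insert the factor 1 supplied by [integral_polarw], exchange the integrals by Tonelli and rescale
    z = l w. The shell 1 < |w| <= 2 thus takes over the role of the sphere. At z = 0 the inserted
    factor is 0 instead of 1, hence the condition on H 0. *)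
Lemma integral_polar (H : 'rV[R]_n -> \bar R) :
  measurable_fun setT H -> (forall z, 0 <= H z) -> H 0%R = 0 ->
  \int[mu]_z H z = \int[mu]_w ((polarw w)%:E *
    \int[leb]_(l in `]0%R, +oo[) (H (l *: w)%R * (l `^ (n%:R - 1))%:E)).
Proof.
move=> mH H0 H00.
pose ind := (\1_(`]0%R, +oo[%classic) : R -> R).
have mind : measurable_fun setT ind by exact: measurable_indic.
pose Phi (p : 'rV[R]_n * measurableTypeR R) :=
  (polarw p.1)%:E * (H (p.2 *: p.1)%R * (p.2 `^ (n%:R - 1))%:E) * (ind p.2)%:E.
pose Psi (p : 'rV[R]_n * measurableTypeR R) :=
  H p.1 * ((polarw (p.2 `^ (-1) *: p.1)%R)%:E * (p.2 `^ (-1))%:E) * (ind p.2)%:E.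
have mpow (a : R) : measurable_fun setT (fun p : 'rV[R]_n * measurableTypeR R => (p.2 `^ a)%R).
  exact: (measurableT_comp (measurable_powR _) measurable_snd).
have mPhi : measurable_fun setT Phi.
  apply: emeasurable_funM; last first.
    by apply/measurable_EFinP; exact: (measurableT_comp mind measurable_snd).
  apply: emeasurable_funM.
    by apply/measurable_EFinP; exact: (measurableT_comp measurable_polarw measurable_fst).
  apply: emeasurable_funM; last exact/measurable_EFinP.
  exact: (measurableT_comp mH measurable_scale2).
have mPsi : measurable_fun setT Psi.
  apply: emeasurable_funM; last first.
    by apply/measurable_EFinP; exact: (measurableT_comp mind measurable_snd).
  apply: emeasurable_funM; first exact: (measurableT_comp mH measurable_fst).
  apply: emeasurable_funM; last exact/measurable_EFinP.
  apply/measurable_EFinP; apply: (measurableT_comp measurable_polarw).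
  apply: (measurableT_comp (g := fun p : 'rV[R]_n * measurableTypeR R => (p.1, p.2 `^ (-1))%R)
    measurable_scale2).
  by apply: measurable_fun_pair => /=; [exact: measurable_fst|].
have ind0 t : (0 <= ind t)%R by rewrite /ind indicE.
have Phi0 p : 0 <= Phi p.
  by rewrite /Phi !mule_ge0// lee_fin ?polarw_ge0 ?powR_ge0.
have Psi0 p : 0 <= Psi p.
  by rewrite /Psi !mule_ge0// lee_fin ?polarw_ge0 ?powR_ge0.
transitivity (\int[mu]_w \int[leb]_l Phi (w, l)); last first.
  apply: eq_integral => w _.
  rewrite [in RHS]integral_mkcond -ge0_integralZl//=; last 3 first.
  - apply/(measurable_restrictT _ _).1 => //; apply: measurable_funTS.
    apply: emeasurable_funM.
      apply: (measurableT_comp mH).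
      exact: (measurableT_comp measurable_scale2 (measurable_pair1 w)).
    by apply/measurable_EFinP; exact: measurable_powR.
  - by move=> l _; rewrite patchE; case: ifPn => // _; rewrite mule_ge0// lee_fin powR_ge0.
  - by rewrite lee_fin polarw_ge0.
  apply: eq_integral => l _; rewrite /Phi /= patchE /ind indicE.
  by case: ifPn => _; rewrite ?mule1 ?mule0.
transitivity (\int[mu]_z \int[leb]_l Psi (z, l)).
  apply: eq_integral => z _.
  have [->|z0] := eqVneq z 0%R.
    by rewrite H00 [RHS]integral0_eq// => l _; rewrite /Psi/= H00 !mul0e.
  rewrite -[LHS]mule1 -(integral_polarw z0) integral_mkcond -ge0_integralZl//=; last 2 first.
  - apply/(measurable_restrictT _ _).1 => //; apply: measurable_funTS.
    apply/measurable_EFinP; apply: measurable_funM; last exact: measurable_powR.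
    apply: (measurableT_comp measurable_polarw).
    apply: (measurableT_comp (measurableT_comp measurable_scale2 (measurable_pair1 z))).
    exact: measurable_powR.
  - by move=> l _; rewrite patchE; case: ifPn => // _; rewrite lee_fin mulr_ge0 ?powR_ge0 ?polarw_ge0.
  apply: eq_integral => l _; rewrite /Psi /= patchE /ind indicE.
  by case: ifPn => _; rewrite ?mule1 ?mule0// EFinM.
rewrite (fubini_tonelli _ mPsi Psi0) (fubini_tonelli _ mPhi Phi0).
apply: eq_integral => l _; rewrite /Psi /Phi/=.
have [l0|l0] := leP l 0%R.
  rewrite !integral0_eq// => w _; rewrite /ind indicE mem_setE in_itv/= ltNge l0/=;
  by rewrite mule0.
have -> : ind l = 1%R by rewrite /ind indicE mem_setE in_itv/= l0.
under eq_integral do rewrite mule1.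
under [RHS]eq_integral do rewrite mule1.
have ln0 : (l `^ (-1) != 0)%R by rewrite gt_eqF// powR_gt0.
pose G z := H z * ((polarw (l `^ (-1) *: z)%R)%:E * (l `^ (-1))%:E).
rewrite -[LHS]/(\int[mu]_z G z).
have mG : measurable_fun setT G.
  apply: emeasurable_funM => //; apply: emeasurable_funM => //.
  apply/measurable_EFinP; apply: (measurableT_comp measurable_polarw).
  exact: measurable_rV_scale.
have G0 z : 0 <= G z by rewrite /G !mule_ge0// lee_fin ?polarw_ge0 ?powR_ge0.
(* With z = l x the Jacobian l^n and the factor l^-1 combine to the radial weight l^(n-1). *)
rewrite -(ge0_integral_affine 0%R (lt0r_neq0 l0) mG G0) -ge0_integralZl//=; last first.
  apply: (measurableT_comp mG); exact: measurable_rV_affine.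
apply: eq_integral => x _.
have -> : (l `^ (n%:R - 1) = `|l| ^+ n * l `^ (-1))%R.
  rewrite powRD ?(gt_eqF l0) ?implybT// powR_mulrn ?(ltW l0)//.
  by rewrite (gtr0_norm l0).
rewrite /G addr0 scalerA (powR_inv1 (ltW l0)) mulVf ?(gt_eqF l0)// scale1r EFinM.
by rewrite muleCA [RHS]muleCA; congr (_ * _); rewrite muleCA.
Qed.

Lemma measurable_enorm_set (B : set R) : measurable B ->
  measurable [set x : 'rV[R]_n | B (enorm x)].
Proof. by move=> mB; rewrite -[X in measurable X]setTI; exact: measurable_enorm. Qed.

Lemma measurable_cball (r : R) : measurable [set x : 'rV[R]_n | (enorm x <= r)%R].
Proof.
have := @measurable_enorm_set `]-oo, r]%classic (measurable_itv _).
by under eq_set do rewrite /= in_itv/=.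
Qed.

Lemma borel_ball_fin (r : R) : mu [set x | (enorm x <= r)%R] < +oo.
Proof.
apply: (@le_lt_trans _ _ (mu [set x | forall i, `[(- r)%R, r]%classic (x ord0 i)])).
  apply: le_measure; rewrite ?inE.
  - exact: measurable_cball.
  - apply: (@measurable_box _ _ (fun _ => `[(- r)%R, r]%classic)) => i; exact: measurable_itv.
  - move=> x /= xr i; rewrite in_itv/= -ler_norml.
    exact: le_trans (le_coord_enorm _ _) xr.
rewrite (@borel_lebesgue_rV_box _ _ (fun _ => `[(- r)%R, r]%classic)); last first.
  by move=> i; exact: measurable_itv.
suff : \prod_(i < n) leb `[(- r)%R, r]%classic \is a fin_num by rewrite fin_numE ltey => /andP[].
elim/big_ind : _ => // [x y|i _]; first exact: fin_numM.
by rewrite lebesgue_measure_itv/=; case: ifPn.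
Qed.

(* kappa n is the surface measure of the unit sphere. *)
Definition kappa : \bar R := \int[mu]_w (polarw w * enorm w `^ (- n%:R))%:E.

Lemma kappa_ge0 : 0 <= kappa.
Proof.
by apply: integral_ge0 => w _; rewrite lee_fin mulr_ge0 ?polarw_ge0 ?powR_ge0.
Qed.

Lemma kappa_lty : kappa < +oo.
Proof.
apply: (@le_lt_trans _ _ (\int[mu]_w (2%:E * (\1_[set x | (enorm x <= 2)%R] w)%:E))).
  apply: ge0_le_integral => //.
  - by move=> w _; rewrite lee_fin mulr_ge0 ?polarw_ge0 ?powR_ge0.
  - apply/measurable_EFinP; apply: measurable_funM; first exact: measurable_polarw.
    exact: (measurableT_comp (measurable_powR _) measurable_enorm).
  - apply/measurable_EFinP; apply: measurable_funM => //; apply: measurable_indic.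
    exact: measurable_cball.
  - move=> w _; rewrite -EFinM lee_fin /polarw indicE.
    case: ifPn => [/andP[w1 w2]|]; last by rewrite mul0r mulr_ge0.
    rewrite mem_set//= mulr1 -[leRHS]mulr1 ler_pM// ?powR_ge0//.
    rewrite powRN invf_le1 ?powR_gt0 ?(lt_trans _ w1)//.
    by rewrite powR_mulrn// exprn_ege1// ltW.
have mB := measurable_cball 2%R.
rewrite ge0_integralZl//=; last by apply/measurable_EFinP; exact: measurable_indic.
rewrite integral_indic// setIT.
by rewrite lte_mul_pinfty// borel_ball_fin.
Qed.

(** On the ray through w the substitution t = l |w| makes the inner integral of [integral_polar]
    equal to |w|^-n times an integral independent of w. Integrating the remaining weight over the
    shell gives [kappa]. *)
Lemma integral_radial (g : R -> \bar R) :
  measurable_fun setT g -> (forall t, 0 <= g t) -> g 0%R = 0 ->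
  \int[mu]_z g (enorm z) =
  kappa * \int[leb]_(t in `]0%R, +oo[) (g t * (t `^ (n%:R - 1))%:E).
Proof.
move=> mg g0 g00; rewrite integral_polar; last 3 first.
- exact: (measurableT_comp mg measurable_enorm).
- by [].
- by rewrite enorm0.
pose I := \int[leb]_(t in `]0%R, +oo[) (g t * (t `^ (n%:R - 1))%:E).
pose h := (fun t => g t * (t `^ (n%:R - 1))%:E) \_ `]0%R, +oo[.
have mgp : measurable_fun setT (fun t : R => g t * (t `^ (n%:R - 1))%:E).
  by apply: emeasurable_funM => //; apply/measurable_EFinP; exact: measurable_powR.
have mh : measurable_fun setT h.
  by apply/(measurable_restrictT _ _).1 => //; exact: measurable_funTS.
have h0 t : 0 <= h t by rewrite /h patchE; case: ifPn => // _; rewrite mule_ge0// lee_fin powR_ge0.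
have I0 : 0 <= I by apply: integral_ge0 => t _; rewrite mule_ge0// lee_fin powR_ge0.
transitivity (\int[mu]_w ((polarw w * enorm w `^ (- n%:R))%:E * I)); last first.
  rewrite ge0_integralZr//.
  - apply/measurable_EFinP; apply: measurable_funM; first exact: measurable_polarw.
    exact: (measurableT_comp (measurable_powR _) measurable_enorm).
  - by move=> w _; rewrite lee_fin mulr_ge0 ?polarw_ge0 ?powR_ge0.
apply: eq_integral => w _; rewrite EFinM -muleA.
have [r0|] := boolP (0 < enorm w)%R; last first.
  by rewrite /polarw -leNgt => r0; rewrite ltNge (le_trans r0)//= !mul0e.
congr (_ * _); set r := enorm w in r0 *.
rewrite /I [X in _ * X]integral_mkcond -/h -(ge0_integral_affine1 0%R (lt0r_neq0 r0) mh h0).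
rewrite (gtr0_norm r0) muleA -EFinM integral_mkcond -ge0_integralZl//=; last first.
- by rewrite lee_fin mulr_ge0 ?powR_ge0 ?(ltW r0).
- by apply: (measurableT_comp mh); apply: measurable_funD => //; exact: mulrl_measurable.
apply: eq_integral => t _; rewrite /h addr0 !patchE !mem_setE !in_itv/= !andbT pmulr_rgt0//.
case: ifPn => [t0|_]; last by rewrite mule0.
rewrite enormZ (gtr0_norm t0) -/r mulrC muleCA -EFinM; congr (_ * _%:E).
have E : (r `^ (- n%:R) * r * r `^ (n%:R - 1) = 1)%R.
  rewrite -{2}(powRr1 (ltW r0)) -!powRD ?(gt_eqF r0) ?implybT//.
  by transitivity (r `^ 0)%R; [congr (_ `^ _)%R; ring|exact: powRr0].
by rewrite powRM ?(ltW r0) ?(ltW t0)// mulrA E mul1r.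
Qed.

Lemma integral_enorm_gt (p r : R) : (0 < p)%R -> (0 < r)%R ->
  \int[mu]_z (if (r < enorm z)%R then enorm z `^ (- (n%:R + p)) else 0)%:E =
  kappa * (r `^ (- p) / p)%:E.
Proof.
move=> p0 r0.
pose g (t : R) := (if (r < t)%R then t `^ (- (n%:R + p)) else 0)%:E.
rewrite (integral_radial (g := g)).
- congr (_ * _); rewrite -[X in (_ / X)%R]opprK -integral_powR_cy ?oppr_lt0//.
  rewrite -[RHS]integral_itv_obnd_cbnd; last first.
    by apply/measurable_EFinP; apply: measurable_funTS; exact: measurable_powR.
  rewrite integral_mkcond [RHS]integral_mkcond; apply: eq_integral => t _.
  rewrite !patchE !mem_setE !in_itv/= !andbT /g.
  have [rt|rt] := ltP r t; last by case: ifPn => //; rewrite mul0e.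
  rewrite (lt_trans r0 rt) -EFinM -powRD ?(gt_eqF (lt_trans r0 rt)) ?implybT//.
  by congr (_ `^ _)%:E; ring.
- apply/measurable_EFinP; apply: measurable_fun_ifT; [exact: measurable_fun_ltr|exact: measurable_powR|by []].
- by move=> t; rewrite /g; case: ifPn => // _; rewrite lee_fin powR_ge0.
- by rewrite /g ltNge (ltW r0).
Qed.

Lemma integral_enorm_le (p r : R) : (0 < p)%R -> (0 < r)%R ->
  \int[mu]_z (if (0 < enorm z <= r)%R then enorm z `^ (p - n%:R) else 0)%:E =
  kappa * (r `^ p / p)%:E.
Proof.
move=> p0 r0.
pose g (t : R) := (if (0 < t <= r)%R then t `^ (p - n%:R) else 0)%:E.
rewrite (integral_radial (g := g)).
- congr (_ * _); rewrite -integral_powR_oc//.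
  rewrite integral_mkcond [RHS]integral_mkcond; apply: eq_integral => t _.
  rewrite !patchE !mem_setE !in_itv/= !andbT /g.
  have [t0|t0]//= := ltP 0%R t; case: ifPn => _; last by rewrite mul0e.
  rewrite -EFinM -powRD ?(gt_eqF t0) ?implybT//.
  by congr (_ `^ _)%:E; ring.
- apply/measurable_EFinP; apply: measurable_fun_ifT; [|exact: measurable_powR|by []].
  by apply: measurable_and; [exact: measurable_fun_ltr|exact: measurable_fun_ler].
- by move=> t; rewrite /g; case: ifPn => // _; rewrite lee_fin powR_ge0.
- by rewrite /g ltxx.
Qed.

Lemma borel_annulus (r1 r2 : R) : (0 < n)%N -> (0 < r1)%R -> (r1 < r2)%R ->
  mu [set x | (r1 <= enorm x <= r2)%R] = kappa * ((r2 ^+ n - r1 ^+ n) / n%:R)%:E.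
Proof.
move=> n0 r10 r12.
pose g (t : R) := (\1_(`[r1, r2]%classic) t : R)%:E.
have mB : measurable [set x : 'rV[R]_n | (r1 <= enorm x <= r2)%R].
  have := @measurable_enorm_set `[r1, r2]%classic (measurable_itv _).
  by under eq_set do rewrite /= in_itv/=.
transitivity (\int[mu]_x g (enorm x)).
  rewrite -[X in mu X]setIT -integral_indic//; exact: eq_integral.
rewrite (integral_radial (g := g)).
- have r20 : (0 < r2)%R by exact: lt_trans r12.
  congr (_ * _); rewrite -!powR_mulrn ?(ltW r10) ?(ltW r20)// -integral_powR_cc ?pnatr_eq0 -?lt0n//.
  rewrite integral_mkcond [RHS]integral_mkcond; apply: eq_integral => t _.
  rewrite !patchE !mem_setE /g indicE mem_setE !in_itv/= andbT.
  case: ifPn => t0; last first.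
    by case: ifPn => // /andP[tr1 _]; move: t0; rewrite (lt_le_trans r10 tr1).
  by case: ifPn => _; rewrite ?mul1e ?mul0e.
- by apply/measurable_EFinP; exact: measurable_indic.
- by move=> t; rewrite /g indicE lee_fin.
- by rewrite /g indicE mem_setE in_itv/= (leNgt r1) r10.
Qed.

End polar.

(** * The half-space function on a line *)

Lemma ge0_integral_ity_le {R : realType} (f : R -> \bar R) (a : R) (M : \bar R) :
  measurable_fun setT f -> (forall x, a <= x -> (0 <= f x)%E) ->
  (forall b, a < b -> (\int[lebesgue_measure]_(x in `[a, b]) f x <= M)%E) ->
  (\int[lebesgue_measure]_(x in `[a, +oo[) f x <= M)%E.
Proof.
move=> mf f0 fM.
have -> : `[a, +oo[%classic = \bigcup_k `[a, a + k.+1%:R]%classic.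
  apply/seteqP; split => x /=; rewrite in_itv/= ?andbT.
    move=> ex; exists (Num.truncn (x - a)) => //=; rewrite in_itv/= ex/= -lerBlDl ltW//.
    exact: truncnS_gt.
  by move=> [k _]/=; rewrite in_itv/= => /andP[].
have h : (fun k : nat => \int[lebesgue_measure]_(x in `[a, (a + k.+1%:R)%R]) f x)%E @ \oo -->
    (\int[lebesgue_measure]_(x in \bigcup_k `[a, (a + k.+1%:R)%R]%classic) f x)%E.
  apply: ge0_nondecreasing_set_cvg_integral => //.
  - move=> i j ij; apply/subsetPset => x /=; rewrite !in_itv/= => /andP[-> h]/=.
    by rewrite (le_trans h)// lerD2l ler_nat.
  - by move=> i; exact: measurable_funTS.
  - by move=> i x /=; rewrite in_itv/= => /andP[ax _]; exact: f0.
rewrite -(cvg_lim _ h)//; apply: lime_le; first by apply/cvg_ex; eexists; exact: h.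
by apply: nearW => k; apply: fM; rewrite ltrDl.
Qed.

Section frac1.
Context {R : realType} (s : R).
Hypotheses (s_gt0 : 0 < s) (s_lt1 : s < 1).
Notation leb := (@lebesgue_measure R).

(** The numbers 1 / (1 + t) and t / (1 + t) lie in [0, 1] and add up to 1; there x <= x^s, and
    multiplying by (1 + t)^s finishes. *)
Lemma powR_subadd1 (t : R) : 0 < t -> (1 + t) `^ s <= 1 + t `^ s.
Proof.
move=> t0; have t1 : 0 < 1 + t by rewrite addr_gt0.
have i0 : 0 < (1 + t)^-1 by rewrite invr_gt0.
rewrite -(ler_pM2r (powR_gt0 s i0)) -powRM ?(ltW t1) ?(ltW i0)// mulfV ?gt_eqF// powR1.
rewrite mulrDl mul1r -powRM ?(ltW t0) ?(ltW i0)//.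
have : (1 + t)^-1 <= (1 + t)^-1 `^ s.
  by apply: ger1_powR; rewrite ?i0 ?(ltW s_lt1)//= invf_le1// lerDl ltW.
have : t * (1 + t)^-1 <= (t * (1 + t)^-1) `^ s.
  apply: ger1_powR; rewrite ?(ltW s_lt1)// mulr_gt0//= ltW//.
  by rewrite -[ltRHS](mulfV (lt0r_neq0 t1)) ltr_pM2r// ltrDr.
suff : (1 + t)^-1 + t * (1 + t)^-1 = 1 by lra.
by field; rewrite gt_eqF.
Qed.

Let is_derive_1Dpow (p t : R) : 0 < 1 + t ->
  is_derive t 1 (fun t : R => (1 + t) `^ p) (p * (1 + t) `^ (p - 1)).
Proof.
move=> t1; have dt : is_derive t 1 (fun t : R => 1 + t) 1.
  by have := is_deriveD (is_derive_cst (1 : R) t 1) (is_derive_id t 1); rewrite add0r; apply.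
rewrite -[X in is_derive _ _ _ X]mulr1.
exact: (@is_derive1_comp R (@powR R ^~ p) (fun t => 1 + t) t _ _ (is_derive1_powR p t1) dt).
Qed.

Let is_derive_1Bpow (p t : R) : 0 < 1 - t ->
  is_derive t 1 (fun t : R => (1 - t) `^ p) (- (p * (1 - t) `^ (p - 1))).
Proof.
move=> t1; have dt : is_derive t 1 (fun t : R => 1 - t) (-1).
  by have := is_deriveB (is_derive_cst (1 : R) t 1) (is_derive_id t 1); rewrite sub0r; apply.
rewrite -[X in is_derive _ _ _ X]mulrN1.
exact: (@is_derive1_comp R (@powR R ^~ p) (fun t => 1 - t) t _ _ (is_derive1_powR p t1) dt).
Qed.

(* Antiderivative found by pairing y with 1 / y in the principal value integral
   of the s-harmonic function y_+^s at y = 1. *)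
Let Phi (t : R) := (2 * s)^-1 * (((1 + t) `^ s - 1) ^+ 2 * t `^ (- (2 * s))).
Let phi (t : R) := t `^ (- (2 * s) - 1) * (((1 + t) `^ s - 1) * (1 - (1 + t) `^ (s - 1))).
Let G (t : R) := t `^ (- (2 * s) - 1) * (1 - (1 - t) `^ s).

Lemma is_derive_Phi (t : R) : 0 < t -> is_derive t 1 Phi (phi t).
Proof.
move=> t0; have t1 : 0 < 1 + t by rewrite addr_gt0.
have d1 := is_derive_1Dpow s t1.
have d2 : is_derive t 1 (fun t => ((1 + t) `^ s - 1) ^+ 2)
    (2 * ((1 + t) `^ s - 1) * (s * (1 + t) `^ (s - 1))).
  have d3 : is_derive t 1 (fun t => (1 + t) `^ s - 1) (s * (1 + t) `^ (s - 1)).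
    by have := is_deriveB d1 (is_derive_cst (1 : R) t 1); rewrite subr0; apply.
  have := is_deriveX 2 d3.
  by rewrite /GRing.scale/= expr1.
have d4 := is_derive1_powR (- (2 * s)) t0.
have := is_deriveZ (2 * s)^-1 (is_deriveM d2 d4).
congr (is_derive _ _ _ _).
rewrite /GRing.scale/= /phi.
have -> : (1 + t) `^ s = (1 + t) * (1 + t) `^ (s - 1).
  by rewrite mulr_powRB1// ltW.
have -> : t `^ (- (2 * s)) = t * t `^ (- (2 * s) - 1).
  rewrite -{2}(powRr1 (ltW t0)) -powRD; first by congr (_ `^ _); ring.
  by rewrite (gt_eqF t0) implybT.
by field; rewrite gt_eqF.
Qed.

Lemma phi_ge0 (t : R) : 0 < t -> 0 <= phi t.
Proof.
move=> t0; rewrite /phi mulr_ge0 ?powR_ge0// mulr_ge0// subr_ge0.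
  by rewrite -[leLHS](powRr0 (1 + t)); apply: ler_powR; rewrite ?lerDl ltW.
by rewrite -[leRHS](powRr0 (1 + t)); apply: ler_powR; rewrite ?lerDl ?subr_le0 ltW.
Qed.

Lemma Phi_ge0 (t : R) : 0 <= Phi t.
Proof. apply: mulr_ge0; first by rewrite invr_ge0 mulr_ge0// ltW.
by apply: mulr_ge0; [exact: sqr_ge0|exact: powR_ge0]. Qed.

(** By subadditivity ((1 + t)^s - 1)^2 <= t^(2s). The bound is also the limit of [Phi] at infinity,
    so nothing is lost; it cancels exactly in [integral_halfline]. *)
Lemma Phi_le (t : R) : 0 < t -> Phi t <= (2 * s)^-1.
Proof.
move=> t0; rewrite /Phi -[leRHS]mulr1 ler_wpM2l ?invr_ge0 ?mulr_ge0 ?(ltW s_gt0)//.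
rewrite powRN ler_pdivrMr ?powR_gt0// mul1r mulrC powRrM powR_mulrn ?powR_ge0//.
rewrite ler_pXn2r ?nnegrE ?powR_ge0 ?lerBlDl ?powR_subadd1//.
by rewrite subr_ge0 -[leLHS](powRr0 (1 + t)); apply: ler_powR; rewrite ?lerDl ltW.
Qed.

Lemma derivable_phi (t : R) : 0 < t -> derivable phi t 1.
Proof.
move=> t0; have t1 : 0 < 1 + t by rewrite addr_gt0.
have d1 (p : R) := @ex_derive _ _ _ _ _ _ _ (is_derive_1Dpow p t1).
apply: derivableM; first by apply: derivable_powR; rewrite in_itv/= t0.
by apply: derivableM; apply: derivableB.
Qed.

Lemma integral_phi (a b : R) : 0 < a -> a < b ->
  (\int[leb]_(t in `[a, b]) (phi t)%:E <= ((2 * s)^-1)%:E)%E.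
Proof.
move=> a0 ab; have x0 x : a <= x <= b -> 0 < x.
  by move=> /andP[ax _]; exact: lt_le_trans ax.
rewrite (integral_derivable ab (fun x h => is_derive_Phi (x0 x h))).
  by rewrite lee_fin lerBlDr (le_trans (Phi_le _))// ?lerDl ?Phi_ge0// x0// lexx ltW.
by move=> x /x0; exact: derivable_phi.
Qed.

Lemma G_ge0 (t : R) : 0 < t <= 1 -> 0 <= G t.
Proof.
move=> /andP[t0 t1]; rewrite /G mulr_ge0 ?powR_ge0// subr_ge0.
apply: (@le_trans _ _ (1 `^ s)); last by rewrite powR1.
by apply: ge0_ler_powR; rewrite ?nnegrE ?subr_ge0 ?gerBl ?(ltW s_gt0) ?(ltW t0).
Qed.

Lemma G_le (t : R) : 0 < t <= 1 -> G t <= t `^ (- (2 * s)).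
Proof.
move=> /andP[t0 t1].
have -> : t `^ (- (2 * s)) = t `^ (- (2 * s) - 1) * t.
  rewrite -{3}(powRr1 (ltW t0)) -powRD; first by congr (_ `^ _); ring.
  by rewrite (gt_eqF t0) implybT.
rewrite /G ler_wpM2l ?powR_ge0// lerBlDr -lerBlDl.
have [t1'|t1'] := ltP t 1.
  by apply: ger1_powR; rewrite ?(ltW s_lt1)// subr_gt0 t1' gerBl ltW.
by rewrite (_ : t = 1) ?subrr ?powR_ge0//; apply/le_anti/andP.
Qed.

Lemma measurable_G : measurable_fun setT G.
Proof.
apply: measurable_funM; first exact: measurable_powR.
apply: measurable_funB => //.
by apply: (measurableT_comp (measurable_powR s)); exact: measurable_funB.
Qed.

(** This is t / (1 + t), so 1 - F t = 1 / (1 + t): the substitution pairs the point 1 + t with its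
    inverse. *)
Let F (t : R) : R := 1 - (1 + t) `^ (-1).

Let is_derive_F (t : R) : 0 < t -> is_derive t 1 F ((1 + t) `^ (- 2)).
Proof.
move=> t0; have t1 : 0 < 1 + t by rewrite addr_gt0.
have := is_deriveB (is_derive_cst (1 : R) t 1) (is_derive_1Dpow (-1) t1).
by rewrite sub0r mulN1r opprK (_ : -1 - 1 = -2)//; ring.
Qed.

Let FE (t : R) : 0 < t -> F t = t * (1 + t)^-1.
Proof.
move=> t0; have t1 : 0 < 1 + t by rewrite addr_gt0.
by rewrite /F powR_inv1 ?(ltW t1)//; field; rewrite gt_eqF.
Qed.

Let F_itv (t : R) : 0 < t -> 0 < F t < 1.
Proof.
move=> t0; have t1 : 0 < 1 + t by rewrite addr_gt0.
by rewrite FE// divr_gt0//= ltr_pdivrMr// mul1r ltrDr.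
Qed.

Let derivable_G (t : R) : 0 < t < 1 -> derivable G t 1.
Proof.
move=> /andP[t0 t1]; apply: derivableM.
  by apply: derivable_powR; rewrite in_itv/= t0.
apply: derivableB => //; apply: ex_derive.
by apply: is_derive_1Bpow; rewrite subr_gt0.
Qed.

Let substF (a b : R) : 0 < a -> a < b ->
  (\int[leb]_(x in `[F a, F b]) (G x)%:E =
   \int[leb]_(x in `[a, b]) (G (F x) * (1 + x) `^ (- 2))%:E)%E.
Proof.
move=> a0 ab.
have x0 x : a <= x -> 0 < x by exact: lt_le_trans.
have dFE x : a <= x -> F^`()%classic x = (1 + x) `^ (- 2).
  by move=> /x0 /is_derive_F[_]; rewrite -derive1E.
have nF (x : R) : 0 < x -> {near nbhs x, F^`()%classic =1 (fun x => (1 + x) `^ (- 2))}.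
  move=> x1; near=> y; have y0 : 0 < y by near: y; exact: lt_nbhsr.
  by have [_ <-] := is_derive_F y0; rewrite derive1E.
have cF (x : R) : 0 < x -> {for x, continuous F^`()%classic}.
  move=> x1; rewrite /prop_for /continuous_at.
  have [_ E] := is_derive_F x1; rewrite derive1E E.
  have c : {for x, continuous (fun x : R => (1 + x) `^ (- 2))}.
    apply: derivable_continuous; apply: ex_derive; apply: is_derive_1Dpow.
    by rewrite addr_gt0.
  apply: cvg_trans c; apply: near_eq_cvg.
  by have := nF _ x1; apply: filterS => y /esym.
rewrite (@integration_by_substitution_increasing _ F)//.
- by apply: eq_integral => x; rewrite inE/= in_itv/= => /andP[ax _]; rewrite /= -dFE.
- exact: ltW.
- move=> x y; rewrite !in_itv/= => /andP[/x0 xa _] /andP[/x0 ya _] xy.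
  rewrite /F ltrD2l ltrN2 !powR_inv1 ?addr_ge0 ?ltW//.
  by rewrite ltf_pV2 ?posrE ?addr_gt0// ltrD2l.
- by move=> x; rewrite in_itv/= => /andP[ax _]; apply: cF; rewrite x0 ?ltW.
- by apply/cvg_ex; eexists; apply: cvg_at_right_filter; exact: cF.
- by apply/cvg_ex; eexists; apply: cvg_at_left_filter; apply: cF; rewrite x0 ?ltW.
- have cF' x : 0 < x -> {for x, continuous F}.
    by move=> /is_derive_F[? _]; exact: derivable_continuous.
  split.
  + by move=> x; rewrite in_itv/= => /andP[ax _]; have [] := is_derive_F (x0 x (ltW ax)).
  + by apply: cvg_at_right_filter; exact: cF'.
  + by apply: cvg_at_left_filter; apply: cF'; rewrite x0// ltW.
- apply: derivable_within_continuous => x; rewrite in_itv/= => /andP[ax xb].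
  apply: derivable_G.
  have /andP[F0 _] := F_itv a0; have /andP[_ F1] := F_itv (x0 _ (ltW ab)).
  by rewrite (lt_le_trans F0)//= (le_lt_trans _ F1).
Unshelve. all: by end_near. Qed.

Let p (t : R) := t `^ (- (2 * s) - 1).
Let pB (t : R) := p t * ((1 + t) `^ s - 1).

(** The gain of y^s to the right of 1 is the exact derivative [phi] plus the pullback under [F] of
    the loss [G] to the left of 1, the factor (1 + t)^-2 being the derivative of [F]. Gain and loss
    can then be compared without evaluating either integral. *)
Let pBE (t : R) : 0 < t -> pB t = phi t + G (F t) * (1 + t) `^ (- 2).
Proof.
move=> t0; have t1 : 0 < 1 + t by rewrite addr_gt0.
have q0 : (1 + t == 0) = false by exact: gt_eqF.
rewrite /pB /phi /p /G.
have -> : 1 - F t = (1 + t)^-1.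
  by rewrite FE//; field; rewrite q0.
rewrite FE// powRM ?(ltW t0) ?invr_ge0 ?(ltW t1)// -!mulrA -mulrDr; congr (_ * _).
rewrite -powR_inv1 ?(ltW t1)// -!powRrM.
set q := 1 + t.
have E1 : q `^ (-1 * (- (2 * s) - 1)) * q `^ (-2) = q `^ (s - 1) * q `^ s.
  by rewrite -!powRD ?q0 ?implybT//; congr (_ `^ _); ring.
have E2 : q `^ (s - 1) * (q `^ s * q `^ (-1 * s)) = q `^ (s - 1).
  by rewrite -!powRD ?q0 ?implybT//; congr (_ `^ _); ring.
transitivity ((q `^ s - 1) * (1 - q `^ (s - 1)) +
  q `^ (-1 * (- (2 * s) - 1)) * q `^ (-2) * (1 - q `^ (-1 * s))); last by ring.
rewrite E1 (_ : q `^ (s - 1) * q `^ s * (1 - q `^ (-1 * s)) =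
  q `^ (s - 1) * q `^ s - q `^ (s - 1) * (q `^ s * q `^ (-1 * s))); last by ring.
by rewrite E2; ring.
Qed.

Let Fle (t : R) : 0 < t -> t <= 1 -> [/\ t / 2 <= F t, F t <= t & t - F t <= t ^+ 2].
Proof.
move=> t0 tle; have t1 : 0 < 1 + t by rewrite addr_gt0.
have t1' : 1 <= 1 + t by rewrite lerDl ltW.
rewrite FE//; split.
- by rewrite ler_pM2l// lef_pV2 ?posrE//; lra.
- by rewrite ler_pdivrMr// ler_peMr// ltW.
- rewrite (_ : _ - _ = t ^+ 2 / (1 + t)); last by field; rewrite gt_eqF.
  by rewrite ler_pdivrMr// ler_peMr// sqr_ge0.
Qed.

Let integral_pB_itv (a b : R) : 0 < a -> a < b ->
  (\int[leb]_(t in `[a, b]) (pB t)%:E <=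
   ((2 * s)^-1)%:E + \int[leb]_(t in `[F a, 1%R]) (G t)%:E)%E.
Proof.
move=> a0 ab.
have x0 x : a <= x -> 0 < x by exact: lt_le_trans.
have b0 := x0 _ (ltW ab).
have mF : measurable_fun setT F.
  apply: measurable_funB => //; apply: (measurableT_comp (measurable_powR (-1))).
  exact: measurable_funD.
under eq_integral.
  move=> x; rewrite inE/= in_itv/= => /andP[/x0 ax _].
  rewrite (pBE ax) EFinD; over.
rewrite ge0_integralD//=.
- rewrite leeD ?integral_phi// -substF//.
  apply: ge0_subset_integral => //.
  + by apply/measurable_EFinP; apply: measurable_funTS; exact: measurable_G.
  + move=> x /=; rewrite in_itv/= => /andP[xa x1]; rewrite lee_fin G_ge0// x1 andbT.
    by rewrite (lt_le_trans _ xa)//; have /andP[] := F_itv a0.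
  + move=> x /=; rewrite !in_itv/= => /andP[-> xb]/=.
    by rewrite (le_trans xb)//; have /andP[_ /ltW] := F_itv b0.
- by move=> x; rewrite in_itv/= => /andP[ax _]; rewrite lee_fin phi_ge0// x0.
- apply/measurable_EFinP; apply: measurable_funTS; apply: measurable_funM.
    exact: measurable_powR.
  apply: measurable_funM; apply: measurable_funB => //;
    by apply: (measurableT_comp (measurable_powR _)); exact: measurable_funD.
- move=> x; rewrite in_itv/= => /andP[/x0 ax _]; rewrite lee_fin mulr_ge0 ?powR_ge0// G_ge0//.
  by have /andP[-> /ltW] := F_itv ax.
- apply/measurable_EFinP; apply: measurable_funTS; apply: measurable_funM.
    exact: (measurableT_comp measurable_G).
  by apply: (measurableT_comp (measurable_powR _)); exact: measurable_funD.
Qed.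


(** The value e^(-2s) / s is what the constant 1 on both sides would give, so this says that y_+^s
    is superharmonic at y = 1 for the operator truncated at e, up to an error of order e^(2-2s). *)
Lemma integral_halfline (e : R) : 0 < e < 1 ->
  (\int[leb]_(t in `[e, +oo[)
      (t `^ (- (2 * s) - 1) * ((Num.max 0 (1 - t)) `^ s + (1 + t) `^ s))%:E <=
   (e `^ (- (2 * s)) / s + 4 * e `^ (2 - 2 * s))%:E)%E.
Proof.
move=> /andP[e0 e1].
have x0 x : e <= x -> 0 < x by exact: lt_le_trans.
have mp : measurable_fun setT p by exact: measurable_powR.
have mpp : measurable_fun setT (fun t : R => p t * (Num.max 0 (1 - t)) `^ s).
  apply: measurable_funM => //; apply: (measurableT_comp (measurable_powR s)).
  by apply: measurable_maxr => //; exact: measurable_funB.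
have mpB : measurable_fun setT pB.
  apply: measurable_funM => //; apply: measurable_funB => //.
  by apply: (measurableT_comp (measurable_powR _)); exact: measurable_funD.
have pB0 x : 0 < x -> 0 <= pB x.
  move=> x1; rewrite mulr_ge0 ?powR_ge0// subr_ge0 -[leLHS](powRr0 (1 + x)).
  by apply: ler_powR; rewrite ?lerDl ltW.
have HB : (\int[leb]_(t in `[e, +oo[) (pB t)%:E <=
   ((2 * s)^-1)%:E + \int[leb]_(t in `[F e, 1%R]) (G t)%:E)%E.
  apply: ge0_integral_ity_le; first exact/measurable_EFinP.
    by move=> x /x0 x1; rewrite lee_fin pB0.
  by move=> b eb; exact: integral_pB_itv.
have [F1 F2 F3] := Fle e0 (ltW e1).
have F0 : 0 < F e by have /andP[] := F_itv e0.
(* The substitution moves the lower end from e to F e >= e / 2, adding an interval of length at most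
   e^2. There G t <= t^(-2s) <= 4 e^(-2s), since 2^(2s) <= 4; this is the whole error. *)
have HG : (\int[leb]_(t in `[F e, 1%R]) (G t)%:E <=
    (4 * e `^ (2 - 2 * s))%:E + \int[leb]_(t in `[e, 1%R]) (G t)%:E)%E.
  have -> : `[F e, 1]%classic = `[F e, e[%classic `|` `[e, 1]%classic.
    by rewrite -itv_bndbnd_setU// bnd_simp// ltW.
  rewrite ge0_integral_setU//=; last 3 first.
  - by apply/measurable_EFinP; apply: measurable_funTS; exact: measurable_G.
  - move=> x []/=; rewrite in_itv/= => /andP[x1 x2]; rewrite lee_fin G_ge0//.
      by rewrite (lt_le_trans F0 x1)/= (le_trans (ltW x2))// ltW.
    by rewrite x0.
  - apply/disj_setPS => x /= []; rewrite !in_itv/= => /andP[_ h1] /andP[h2 _].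
    by move: h1; rewrite ltNge h2.
  rewrite leeD2r//.
  apply: (@le_trans _ _ (\int[leb]_(t in `[F e, e[) (4 * e `^ (- (2 * s)))%:E)%E).
    apply: ge0_le_integral => //.
    - move=> x /=; rewrite in_itv/= => /andP[x1 x2]; rewrite lee_fin G_ge0//.
      by rewrite (lt_le_trans F0 x1)/= (le_trans (ltW x2))// ltW.
    - by apply/measurable_EFinP; apply: measurable_funTS; exact: measurable_G.
    - move=> x /=; rewrite in_itv/= => /andP[x1 x2].
      have xp := lt_le_trans F0 x1.
      rewrite lee_fin (le_trans (G_le _))//; first by rewrite xp (le_trans (ltW x2))// ltW.
      have xe : e / 2 <= x by exact: le_trans x1.
      rewrite !powRN.
      apply: (@le_trans _ _ ((e / 2) `^ (2 * s))^-1).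
        rewrite lef_pV2 ?posrE ?powR_gt0 ?divr_gt0//.
        by apply: ge0_ler_powR; rewrite ?nnegrE ?mulr_ge0 ?invr_ge0 ?(ltW s_gt0) ?(ltW e0) ?(ltW xp).
      rewrite powRM ?(ltW e0)// invfM mulrC ler_wpM2r ?invr_ge0 ?powR_ge0//.
      rewrite (_ : 2^-1 `^ (2 * s) = (2 `^ (2 * s))^-1); last first.
        by rewrite -powR_inv1// -powRrM mulN1r powRN.
      rewrite invrK; apply: (@le_trans _ _ (2 `^ 2%:R)).
        by apply: ler_powR; [rewrite ler1n|have := s_lt1; lra].
      by rewrite powR_mulrn// -natrX.
  rewrite integral_cst//= lebesgue_measure_itv/= lte_fin.
  have [Fe|Fe] := ltP (F e) e; last first.
    by rewrite mule0 lee_fin mulr_ge0// powR_ge0.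
  rewrite -?EFinN -?EFinD -EFinM lee_fin -mulrA ler_wpM2l//.
  rewrite powRD ?(gt_eqF e0) ?implybT// powR_mulrn ?(ltW e0)//.
  by rewrite [leRHS]mulrC ler_wpM2l ?powR_ge0.
have E1 : (\int[leb]_(t in `[e, +oo[) (p t)%:E = (e `^ (- (2 * s)) / (2 * s))%:E)%E.
  by rewrite integral_powR_cy ?opprK// oppr_lt0 mulr_gt0.
(* On [e, 1] the integrands add up to p; beyond 1 the first one vanishes because 0^s = 0. *)
have E2 : (\int[leb]_(t in `[e, +oo[) (p t * (Num.max 0 (1 - t)) `^ s)%:E +
   \int[leb]_(t in `[e, 1%R]) (G t)%:E = ((1 - e `^ (- (2 * s))) / (- (2 * s)))%:E)%E.
  rewrite -[X in (X - _) / _](_ : 1 `^ (- (2 * s)) = 1); last by rewrite powR1.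
  rewrite -integral_powR_cc ?oppr_eq0 ?gt_eqF ?mulr_gt0//.
  have -> : (\int[leb]_(t in `[e, +oo[) (p t * (Num.max 0 (1 - t)) `^ s)%:E =
       \int[leb]_(t in `[e, 1%R]) (p t * (Num.max 0 (1 - t)) `^ s)%:E)%E.
    rewrite integral_mkcond [RHS]integral_mkcond; apply: eq_integral => t _.
    rewrite !patchE !mem_setE !in_itv/= andbT; case: (leP e t) => //= et.
    have [t1|t1]// := leP t 1.
    by rewrite max_l ?powR0 ?mulr0 ?gt_eqF// subr_le0 ltW.
  rewrite -ge0_integralD//=.
  - apply: eq_integral => t; rewrite inE/= in_itv/= => /andP[et t1].
    by rewrite -EFinD max_r ?subr_ge0// /G -mulrDr addrC subrK mulr1.
  - by move=> t _; rewrite lee_fin mulr_ge0 ?powR_ge0.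
  - by apply/measurable_EFinP; exact: measurable_funTS.
  - by move=> t; rewrite in_itv/= => /andP[et t1]; rewrite lee_fin G_ge0// x0.
  - by apply/measurable_EFinP; apply: measurable_funTS; exact: measurable_G.
have split3 t : e <= t -> (p t * ((Num.max 0 (1 - t)) `^ s + (1 + t) `^ s))%:E =
   ((p t * (Num.max 0 (1 - t)) `^ s)%:E + (p t)%:E + (pB t)%:E)%E.
  by move=> _; rewrite -!EFinD /pB; congr EFin; ring.
under eq_integral.
  move=> t; rewrite inE/= in_itv/= andbT => et.
  rewrite split3//; over.
rewrite ge0_integralD//=; last 4 first.
- by move=> t _; rewrite -EFinD lee_fin addr_ge0 ?mulr_ge0 ?powR_ge0.
- by apply/measurable_EFinP; apply: measurable_funTS; exact: measurable_funD.
- by move=> t; rewrite in_itv/= andbT => /x0 t0; rewrite lee_fin pB0.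
- by apply/measurable_EFinP; apply: measurable_funTS.
rewrite ge0_integralD//=; last 4 first.
- by move=> t _; rewrite lee_fin mulr_ge0 ?powR_ge0.
- by apply/measurable_EFinP; apply: measurable_funTS.
- by move=> t _; rewrite lee_fin powR_ge0.
- by apply/measurable_EFinP; apply: measurable_funTS.
rewrite E1.
(* The term -1 / (2s) in [E2] cancels the bound 1 / (2s) coming from [Phi], and [E1] supplies the
   second half of e^(-2s) / s. *)
apply: (le_trans (leeD2l _ (le_trans HB (leeD2l _ HG)))).
move: E2; set I1 := (\int[leb]_(t in `[e, +oo[) (p t * (Num.max 0 (1 - t)) `^ s)%:E)%E.
set I2 := (\int[leb]_(t in `[e, 1%R]) (G t)%:E)%E => E2.
have AC (a b c d i : \bar R) : (a + b + (c + (d + i)) = a + i + (b + c + d))%E.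
  by rewrite -!addeA; congr (_ + _)%E; rewrite [RHS]addeC !addeA.
rewrite (AC I1) E2 -!EFinD lee_fin le_eqVlt; apply/orP; left; apply/eqP.
by field; rewrite gt_eqF.
Qed.

End frac1.

(** * The barrier *)

Lemma measurable_polar_inner {R : realType} (n : nat) (H : 'rV[R]_n -> \bar R) :
  measurable_fun setT H -> (forall z, (0 <= H z)%E) ->
  measurable_fun setT (fun w : 'rV[R]_n =>
    (\int[lebesgue_measure]_(l in `]0%R, +oo[) (H (l *: w)%R * (l `^ (n%:R - 1))%:E))%E).
Proof.
move=> mH H0.
pose ind := (\1_(`]0, +oo[%classic) : R -> R).
have mind : measurable_fun setT ind by exact: measurable_indic.
pose Phi (p : 'rV[R]_n * measurableTypeR R) :=
  ((H (p.2 *: p.1)%R * (p.2 `^ (n%:R - 1))%:E) * (ind p.2)%:E)%E.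
have mPhi : measurable_fun setT Phi.
  apply: emeasurable_funM; last first.
    by apply/measurable_EFinP; exact: (measurableT_comp mind measurable_snd).
  apply: emeasurable_funM; first exact: (measurableT_comp mH (@measurable_scale2 R n)).
  by apply/measurable_EFinP; exact: (measurableT_comp (measurable_powR _) measurable_snd).
have Phi0 p : (0 <= Phi p)%E.
  by rewrite /Phi !mule_ge0// lee_fin ?powR_ge0 // /ind indicE.
rewrite (_ : (fun w => _) = fubini_F lebesgue_measure Phi); first exact: measurable_fun_fubini_tonelli_F.
apply/funext => w; rewrite /fubini_F [LHS]integral_mkcond; apply: eq_integral => l _.
by rewrite /Phi /ind patchE indicE/=; case: ifPn => _; rewrite ?mule1 ?mule0.
Qed.

Lemma kappaE {R : realType} (n : nat) : kappa n = (fine (@kappa R n))%:E.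
Proof.
apply/esym/fineK; rewrite ge0_fin_numE; [exact: kappa_lty|exact: kappa_ge0].
Qed.

Lemma ereal_half_le {R : realType} (y : \bar R) (r : R) :
  (0 <= y -> y + y <= (r + r)%:E -> y <= r%:E)%E.
Proof. by case: y => [y| |]//; rewrite -EFinD !lee_fin => _; lra. Qed.

Section barrier.
Context {R : realType} (n : nat) (s : R).
Hypotheses (n_gt0 : (0 < n)%N) (s_gt0 : 0 < s) (s_lt1 : s < 1).
Notation mu := (@borel_lebesgue_rV R n).
Notation leb := (@lebesgue_measure R).

(** The inequality is strict, so d = 0 gives the full singular kernel with value 0 at the origin;
    both uses share this definition. *)
Definition truncated_kernel (d : R) (z : 'rV[R]_n) : R :=
  if d < enorm z then enorm z `^ (- (n%:R + 2 * s)) else 0.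

Definition pospow (t : R) : R := Num.max 0 t `^ s.

Definition barrier (x : 'rV[R]_n) : R := pospow (1 - enorm x).

Lemma truncated_kernel_ge0 d z : 0 <= truncated_kernel d z.
Proof. by rewrite /truncated_kernel; case: ifPn => // _; exact: powR_ge0. Qed.

Lemma truncated_kernelN d z : truncated_kernel d (- z) = truncated_kernel d z.
Proof. by rewrite /truncated_kernel enormN. Qed.

Lemma measurable_truncated_kernel d : measurable_fun setT (truncated_kernel d).
Proof.
apply: measurable_fun_ifT; [|exact: (measurableT_comp (measurable_powR _) measurable_enorm)|by []].
by apply: measurable_fun_ltr => //; exact: measurable_enorm.
Qed.

Lemma integral_truncated_kernel d : 0 < d ->
  (\int[mu]_z (truncated_kernel d z)%:E = kappa n * (d `^ (- (2 * s)) / (2 * s))%:E)%E.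
Proof. by move=> d0; rewrite -integral_enorm_gt// mulr_gt0. Qed.

Lemma pospow_ge0 t : 0 <= pospow t.
Proof. exact: powR_ge0. Qed.

Lemma measurable_pospow : measurable_fun setT pospow.
Proof.
by apply: (measurableT_comp (measurable_powR s)); exact: measurable_maxr.
Qed.

Lemma le_pospow : {homo pospow : t u / t <= u}.
Proof.
move=> t u tu; apply: ge0_ler_powR; [exact: ltW|by rewrite nnegrE le_max lexx..|].
by rewrite ge_max !le_max lexx tu orbT.
Qed.

Lemma pospowZ c t : 0 <= c -> pospow (c * t) = c `^ s * pospow t.
Proof.
move=> c0; rewrite /pospow -powRM ?le_max ?lexx//.
by rewrite -{1}(mulr0 c) maxr_pMr.
Qed.

Lemma pospowE t : 0 <= t -> pospow t = t `^ s.
Proof. by move=> t0; rewrite /pospow max_r. Qed.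

(** Scaling t = (q / a) l reduces to [integral_halfline]; the hypothesis d |q| < a says that the
    rescaled cutoff is below 1. *)
Lemma integral_pospow_line (a q d : R) : 0 < a -> 0 < d -> d * `|q| < a ->
  (\int[leb]_(l in `[d, +oo[)
     (l `^ (- (2 * s) - 1) * (pospow (a - l * q) + pospow (a + l * q)))%:E <=
   (a `^ s * d `^ (- (2 * s)) / s + 4 * a `^ s * (q / a) ^+ 2 * d `^ (2 - 2 * s))%:E)%E.
Proof.
move=> a0 d0.
(* Changing the sign of q only swaps the two summands. The case q = 0, in which the scaling
   degenerates, is computed directly below. *)
wlog q0 : q / 0 <= q => [wlg qa|].
  have [q0|/ltW q0] := leP 0 q; first exact: wlg.
  have := wlg (- q); rewrite oppr_ge0 normrN mulNr sqrrN => /(_ q0 qa).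
  by under eq_integral do rewrite (addrC (pospow _)) mulrN opprK.
rewrite ger0_norm//.
have [->|qn0] := eqVneq q 0.
  move=> _; under eq_integral => l _.
    rewrite mulr0 subr0 addr0 pospowE ?(ltW a0)// (mulrC (l `^ _)) EFinM; over.
  rewrite ge0_integralZl//=; last 3 first.
  - by apply/measurable_EFinP; apply: measurable_funTS; exact: measurable_powR.
  - by move=> l _; rewrite lee_fin powR_ge0.
  - by rewrite lee_fin addr_ge0 ?powR_ge0.
  rewrite integral_powR_cy ?oppr_lt0 ?mulr_gt0// opprK -EFinM lee_fin.
  rewrite mul0r expr0n mulr0 mul0r addr0 le_eqVlt; apply/orP; left; apply/eqP.
  by field; rewrite gt_eqF.
have {qn0 q0}q0 : 0 < q by rewrite lt_neqAle eq_sym qn0.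
move=> dqa; set c := q / a; have c0 : 0 < c by rewrite divr_gt0.
pose f (t : R) := (t `^ (- (2 * s) - 1) * (Num.max 0 (1 - t) `^ s + (1 + t) `^ s))%:E.
pose g := f \_ `[c * d, +oo[.
have mf : measurable_fun setT f.
  apply/measurable_EFinP; apply: measurable_funM; first exact: measurable_powR.
  apply: measurable_funD; apply: (measurableT_comp (measurable_powR s)).
    by apply: measurable_maxr => //; exact: measurable_funB.
  exact: measurable_funD.
have mg : measurable_fun setT g.
  by apply/(measurable_restrictT _ _).1 => //; exact: measurable_funTS.
have f0 t : (0 <= f t)%E by rewrite lee_fin mulr_ge0 ?addr_ge0 ?powR_ge0.
have g0 t : (0 <= g t)%E by rewrite /g patchE; case: ifPn.
have E : (\int[leb]_(l in `[d, +oo[)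
     (l `^ (- (2 * s) - 1) * (pospow (a - l * q) + pospow (a + l * q)))%:E =
   (a `^ s * c `^ (2 * s))%:E * \int[leb]_(t in `[(c * d)%R, +oo[) f t)%E.
  rewrite [in RHS]integral_mkcond -/g -(ge0_integral_affine1 0 (lt0r_neq0 c0) mg g0).
  rewrite (gtr0_norm c0) muleA -EFinM -ge0_integralZl//=; last 2 first.
  - by apply: (measurableT_comp mg); apply: measurable_funD => //; exact: mulrl_measurable.
  - by rewrite lee_fin mulr_ge0 ?(ltW c0)// mulr_ge0 ?powR_ge0.
  rewrite integral_mkcond; apply: eq_integral => l _.
  rewrite /g addr0 !patchE !mem_setE !in_itv/= !andbT ler_pM2l//.
  case: ifPn => [dl|_]; last by rewrite mule0.
  have l0 : 0 < l by exact: lt_le_trans dl.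
  have cl0 : 0 < c * l by rewrite mulr_gt0.
  rewrite /f -EFinM.
  rewrite (_ : a - l * q = a * (1 - c * l)); last by rewrite /c; field; rewrite gt_eqF.
  rewrite (_ : a + l * q = a * (1 + c * l)); last by rewrite /c; field; rewrite gt_eqF.
  rewrite !pospowZ ?(ltW a0)// (@pospowE (1 + c * l)) ?addr_ge0 ?(ltW cl0)//.
  rewrite powRM ?(ltW c0) ?(ltW l0)// /pospow.
  have -> : c `^ (2 * s) = c `^ (2 * s + 1) * c^-1.
    rewrite powRD ?(gt_eqF c0) ?implybT// powRr1 ?(ltW c0)//.
    by field; rewrite gt_eqF.
  have -> : c `^ (- (2 * s) - 1) = (c `^ (2 * s + 1))^-1.
    by rewrite -powRN; congr (_ `^ _); ring.
  by congr EFin; field; rewrite !gt_eqF// powR_gt0.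
rewrite E.
have H : (\int[leb]_(t in `[(c * d)%R, +oo[) f t <=
   ((c * d) `^ (- (2 * s)) / s + 4 * (c * d) `^ (2 - 2 * s))%:E)%E.
  apply: integral_halfline => //.
  by rewrite mulr_gt0//= /c mulrAC ltr_pdivrMr// mul1r mulrC.
apply: (le_trans (lee_wpmul2l _ H)); first by rewrite lee_fin mulr_ge0 ?powR_ge0.
rewrite -EFinM lee_fin le_eqVlt; apply/orP; left; apply/eqP.
rewrite !(powRM _ (ltW c0) (ltW d0)).
have -> : c `^ (2 - 2 * s) = c ^+ 2 * (c `^ (2 * s))^-1.
  by rewrite powRD ?(gt_eqF c0) ?implybT// powRN powR_mulrn ?(ltW c0).
rewrite (powRN c); field; rewrite !gt_eqF// powR_gt0//.
Qed.

(** In polar form the half-space function restricted to the ray through w is a one-dimensional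
    profile of slope q = e . w, and the cutoff |z| > d becomes l > d / |w|. Since |q| <= |w|, the
    error is bounded uniformly in the direction. *)
Lemma integral_pospow_halfspace (a d : R) (e : 'rV[R]_n) :
  enorm e = 1 -> 0 < d -> d < a ->
  (\int[mu]_z (truncated_kernel d z * (pospow (a - dotp e z) + pospow (a + dotp e z)))%:E <=
   kappa n * (a `^ s * d `^ (- (2 * s)) / s + 4 * a `^ s * a ^- 2 * d `^ (2 - 2 * s))%:E)%E.
Proof.
move=> e1 d0 da; have a0 := lt_trans d0 da.
have mpp (c : R) : measurable_fun setT (fun z => pospow (a + c * dotp e z)).
  apply: (measurableT_comp measurable_pospow); apply: measurable_funD => //.
  by apply: measurable_funM => //; exact: measurable_dotp.
rewrite integral_polar; last 3 first.
- apply/measurable_EFinP; apply: measurable_funM; first exact: measurable_truncated_kernel.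
  apply: measurable_funD.
    by have := mpp (-1); under eq_fun do rewrite mulN1r.
  by have := mpp 1; under eq_fun do rewrite mul1r.
- by move=> z; rewrite lee_fin mulr_ge0 ?truncated_kernel_ge0 ?addr_ge0 ?pospow_ge0.
- by rewrite /truncated_kernel enorm0 ltNge ltW//= mul0r.
set c := (X in (_ * X%:E)%E).
have c0 : 0 <= c.
  rewrite /c addr_ge0// ?divr_ge0 ?mulr_ge0 ?powR_ge0 ?(ltW s_gt0)//.
  by rewrite invr_ge0 exprn_ge0// ltW.
have mpw : measurable_fun setT (fun w : 'rV[R]_n => (polarw w * enorm w `^ (- n%:R))%:E).
  apply/measurable_EFinP; apply: measurable_funM; first exact: measurable_polarw.
  exact: (measurableT_comp (measurable_powR _) measurable_enorm).
rewrite -ge0_integralZr//; last first.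
  by move=> w _; rewrite lee_fin mulr_ge0 ?polarw_ge0 ?powR_ge0.
apply: ge0_le_integral => //.
- move=> w _; apply: mule_ge0; first by rewrite lee_fin polarw_ge0.
  apply: integral_ge0 => l _; rewrite mule_ge0 ?lee_fin ?powR_ge0//.
  by rewrite mulr_ge0 ?truncated_kernel_ge0 ?addr_ge0 ?pospow_ge0.
- apply: emeasurable_funM; first by apply/measurable_EFinP; exact: measurable_polarw.
  apply: (@measurable_polar_inner _ _ (fun z => (truncated_kernel d z * (pospow (a - dotp e z) + pospow (a + dotp e z)))%:E)).
  + apply/measurable_EFinP; apply: measurable_funM; first exact: measurable_truncated_kernel.
    apply: measurable_funD.
      by have := mpp (-1); under eq_fun do rewrite mulN1r.
    by have := mpp 1; under eq_fun do rewrite mul1r.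
  + by move=> z; rewrite lee_fin mulr_ge0 ?truncated_kernel_ge0 ?addr_ge0 ?pospow_ge0.
- by apply: emeasurable_funM.
move=> w _; rewrite EFinM -muleA.
have [/andP[w1 w2]|] := boolP (1 < enorm w <= 2); last first.
  by rewrite /polarw => /negbTE ->; rewrite !mul0e.
apply: lee_wpmul2l; first by rewrite lee_fin polarw_ge0.
have w0 : 0 < enorm w by exact: lt_trans w1.
set q := dotp e w; set r := enorm w in w0 w1 w2 *.
have qr : `|q| <= r by rewrite (le_trans (normr_dotp _ _))// e1 mul1r.
have dr0 : 0 < d / r by rewrite divr_gt0.
have drq : d / r * `|q| < a.
  by rewrite (le_lt_trans _ da)// mulrAC ler_pdivrMr// ler_wpM2l// ltW.
have -> : (\int[leb]_(l in `]0%R, +oo[)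
   ((truncated_kernel d (l *: w) * (pospow (a - dotp e (l *: w)) + pospow (a + dotp e (l *: w))))%:E *
    (l `^ (n%:R - 1))%:E) = (r `^ (- (n%:R + 2 * s)))%:E *
   \int[leb]_(l in `[(d / r)%R, +oo[)
     (l `^ (- (2 * s) - 1) * (pospow (a - l * q) + pospow (a + l * q)))%:E)%E.
  have mline (c' : R) : measurable_fun setT (fun l : R => pospow (a + c' * (l * q))).
    apply: (measurableT_comp measurable_pospow); apply: measurable_funD => //.
    by apply: measurable_funM => //; exact: measurable_funM.
  have mint : measurable_fun setT (fun l : R => (l `^ (- (2 * s) - 1) * (pospow (a - l * q) + pospow (a + l * q)))%:E).
    apply/measurable_EFinP; apply: measurable_funM; first exact: measurable_powR.
    apply: measurable_funD.
      by have := mline (-1); under eq_fun do rewrite mulN1r.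
    by have := mline 1; under eq_fun do rewrite mul1r.
  rewrite -[in RHS]integral_itv_obnd_cbnd; last exact: measurable_funTS.
  rewrite -ge0_integralZl//=; last 3 first.
  - exact: measurable_funTS.
  - by move=> l _; rewrite lee_fin mulr_ge0 ?addr_ge0 ?pospow_ge0 ?powR_ge0.
  - by rewrite lee_fin powR_ge0.
  rewrite integral_mkcond [RHS]integral_mkcond; apply: eq_integral => l _.
  rewrite !patchE !mem_setE !in_itv/= !andbT !dotpZ -/q.
  case: (ltP 0 l) => l0; last by rewrite ltNge (le_trans l0 (ltW dr0)).
  rewrite /truncated_kernel enormZ (gtr0_norm l0) -/r ltr_pdivrMr//.
  case: ifPn => _; last by rewrite mul0r mul0e.
  rewrite powRM ?(ltW l0) ?(ltW w0)// -!EFinM.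
  have -> : l `^ (- (2 * s) - 1) = l `^ (- (n%:R + 2 * s)) * l `^ (n%:R - 1).
    by rewrite -powRD ?(gt_eqF l0) ?implybT//; congr (_ `^ _); ring.
  by congr EFin; ring.
apply: (le_trans (lee_wpmul2l _ (integral_pospow_line a0 dr0 drq))).
  by rewrite lee_fin powR_ge0.
rewrite -!EFinM lee_fin.
have -> : r `^ (- (n%:R + 2 * s)) = r `^ (- n%:R) * (r `^ (2 * s))^-1.
  by rewrite -powRN -powRD ?(gt_eqF w0) ?implybT//; congr (_ `^ _); ring.
rewrite -[leLHS]mulrA ler_wpM2l ?powR_ge0// /c.
have ri0 : 0 <= r^-1 by rewrite invr_ge0 ltW.
rewrite !(powRM _ (ltW d0) ri0).
have rn0 : r != 0 by rewrite gt_eqF.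
have -> : r^-1 `^ (- (2 * s)) = r `^ (2 * s).
  by rewrite -powR_inv1 ?(ltW w0)// -powRrM mulN1r opprK.
have -> : r^-1 `^ (2 - 2 * s) = r `^ (2 * s) * r ^- 2.
  rewrite -powR_inv1 ?(ltW w0)// -powRrM -powR_mulrn ?(ltW w0)// -powRN -powRD ?(gt_eqF w0) ?implybT//.
  by congr (_ `^ _); ring.
have rs0 : r `^ (2 * s) != 0 by rewrite gt_eqF// powR_gt0.
rewrite mulrDr lerD//.
  rewrite le_eqVlt; apply/orP; left; apply/eqP.
  by field; rewrite rs0 gt_eqF.
rewrite [leLHS](_ : _ = 4 * a `^ s * a ^- 2 * d `^ (2 - 2 * s) * (q / r) ^+ 2); last first.
  by field; rewrite rs0 rn0 gt_eqF.
rewrite ler_piMr ?mulr_ge0 ?powR_ge0 ?invr_ge0 ?exprn_ge0 ?(ltW a0)//.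
rewrite -real_normK ?num_real// expr_le1// normrM normfV (gtr0_norm w0) ler_pdivrMr// mul1r//.
Qed.

Lemma borel_ball_gt0 (r : R) : 0 < r ->
  (0 < mu [set x : 'rV[R]_n | (enorm x <= r)%R])%E.
Proof.
move=> r0; pose A (i : 'I_n) : set (measurableTypeR R) := `[(- (r / n%:R)), r / n%:R]%classic.
have mA i : measurable (A i) by exact: measurable_itv.
have rn : 0 < r / n%:R by rewrite divr_gt0// ltr0n.
apply: (@lt_le_trans _ _ (mu [set x | forall i, A i (x ord0 i)])).
  rewrite borel_lebesgue_rV_box//.
  elim/big_ind : _ => // [x y x0 y0|i _]; first exact: mule_gt0.
  rewrite /A lebesgue_measure_itv/= lte_fin gtrN// -?EFinN -?EFinD lte_fin; lra.
apply: le_measure; rewrite ?inE.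
- exact: measurable_box.
- exact: measurable_cball.
move=> x /= xA; apply: (@le_trans _ _ (n%:R * (r / n%:R))).
  by apply: enorm_le_coord => i; rewrite ler_norml; have := xA i; rewrite /A/= in_itv.
by rewrite mulrC divfK// pnatr_eq0 -lt0n.
Qed.

Lemma measurable_barrier : measurable_fun setT barrier.
Proof.
apply: (measurableT_comp measurable_pospow); apply: measurable_funB => //.
exact: measurable_enorm.
Qed.

(** At the origin any unit vector serves, and [n_gt0] provides one. *)
Lemma exists_unit_direction (x : 'rV[R]_n) :
  exists2 e : 'rV[R]_n, enorm e = 1 & dotp e x = enorm x.
Proof.
have [->|x0] := eqVneq x 0.
  exists (delta_mx ord0 (Ordinal n_gt0)).
    rewrite /enorm (bigD1 (Ordinal n_gt0))//= big1 ?addr0.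
      by rewrite mxE !eqxx expr1n sqrtr1.
    by move=> i i0; rewrite mxE (negbTE i0) andbF expr0n.
  by rewrite enorm0 /dotp big1// => i _; rewrite [X in _ * X]mxE mulr0.
have x1 : 0 < enorm x by rewrite enorm_gt0.
exists ((enorm x)^-1 *: x).
  by rewrite enormZ ger0_norm ?invr_ge0// mulVf// gt_eqF.
rewrite /dotp; under eq_bigr do rewrite mxE -mulrA.
rewrite -mulr_sumr -/(dotp x x) dotpp expr2 mulrA mulVf ?mul1r// gt_eqF//.
Qed.

Lemma measurable_pospow_dotp (a c : R) (e : 'rV[R]_n) :
  measurable_fun setT (fun z => pospow (a + c * dotp e z)).
Proof.
apply: (measurableT_comp measurable_pospow); apply: measurable_funD => //.
by apply: measurable_funM => //; exact: measurable_dotp.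
Qed.

(** Reflection z -> -z shows that both halves of the symmetric integral are equal, so each is half
    of the bound. *)
Lemma integral_pospow_halfspace1 (a d : R) (e : 'rV[R]_n) :
  enorm e = 1 -> 0 < d -> d < a ->
  (\int[mu]_z (truncated_kernel d z * pospow (a - dotp e z))%:E <=
   (fine (@kappa R n) * (a `^ s * (d `^ (- (2 * s)) / (2 * s)) +
      2 * a `^ s * a ^- 2 * d `^ (2 - 2 * s)))%:E)%E.
Proof.
move=> e1 d0 da; have a0 : 0 < a by exact: lt_trans da.
pose g z := (truncated_kernel d z * pospow (a - dotp e z))%:E.
pose g2 z := (truncated_kernel d z * pospow (a + dotp e z))%:E.
have mg : measurable_fun setT g.
  apply/measurable_EFinP; apply: measurable_funM; first exact: measurable_truncated_kernel.
  by have := measurable_pospow_dotp a (-1) e; under eq_fun do rewrite mulN1r.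
have mg2 : measurable_fun setT g2.
  apply/measurable_EFinP; apply: measurable_funM; first exact: measurable_truncated_kernel.
  by have := measurable_pospow_dotp a 1 e; under eq_fun do rewrite mul1r.
have g0 z : (0 <= g z)%E by rewrite lee_fin mulr_ge0 ?truncated_kernel_ge0 ?pospow_ge0.
have g20 z : (0 <= g2 z)%E by rewrite lee_fin mulr_ge0 ?truncated_kernel_ge0 ?pospow_ge0.
have Eg : (\int[mu]_z g2 z = \int[mu]_z g z)%E.
  rewrite -(ge0_integral_reflect 0 mg g0); apply: eq_integral => z _.
  by rewrite /g sub0r truncated_kernelN dotpN opprK.
apply: ereal_half_le; first by apply: integral_ge0 => z _; exact: g0.
rewrite -[in X in (_ + X)%E]Eg -(ge0_integralD mu measurableT (fun z _ => g0 z) mg (fun z _ => g20 z) mg2).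
under eq_integral do rewrite -EFinD -mulrDr.
apply: (le_trans (integral_pospow_halfspace e1 d0 da)).
have := @kappaE R n; set kp := fine _ => ->.
rewrite -EFinM lee_fin -mulrDr le_eqVlt; apply/orP; left; apply/eqP.
by field; rewrite !gt_eqF.
Qed.

Lemma integral_truncated_kernel_conv (d : R) (x : 'rV[R]_n) (f : 'rV[R]_n -> R) :
  measurable_fun setT f -> (forall y, 0 <= f y) ->
  (\int[mu]_y (truncated_kernel d (x - y) * f y)%:E =
   \int[mu]_z (truncated_kernel d z * f (x + z))%:E)%E.
Proof.
move=> mf f0.
have mg : measurable_fun setT (fun y : 'rV[R]_n => (truncated_kernel d (x - y) * f y)%:E).
  apply/measurable_EFinP; apply: measurable_funM; last exact: mf.
  apply: (measurableT_comp (measurable_truncated_kernel d)).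
  have := measurable_rV_affine (-1) x.
  by under eq_fun do rewrite scaleN1r addrC.
rewrite -(ge0_integral_shift x mg).
  apply: eq_integral => z _.
  by rewrite -(truncated_kernelN _ z) opprD addrCA subrr addr0 [x + z]addrC.
by move=> y; rewrite lee_fin mulr_ge0 ?truncated_kernel_ge0.
Qed.

Lemma ge0_borel_shift (a : 'rV[R]_n) (A : set 'rV[R]_n) : measurable A ->
  measurable [set z | A (z + a)] /\ mu [set z | A (z + a)] = mu A.
Proof.
move=> mA; have mZ : measurable [set z | A (z + a)].
  rewrite -[X in measurable X]setTI.
  have := measurable_rV_affine 1 a.
  by under eq_fun do rewrite scale1r; apply.
split => //.
rewrite -[X in mu X]setIT -[X in _ = mu X]setIT -!integral_indic//.
rewrite -[RHS](ge0_integral_shift a)//.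
by apply/measurable_EFinP; exact: measurable_indic.
Qed.

Let Z0 : set 'rV[R]_n := [set z | enorm z <= 2^-1].

(** Everywhere e . (x + z) <= |x + z| puts the barrier below the half-space function. For z within
    1/2 of -3 e the point x + z lies outside the unit ball, where the barrier is 0, while 1 - |x| -
    e . z >= 1. There 2 <= |z| <= 4, so the kernel is not cut off and is at least 4^-(n+2s). *)
Lemma barrier_gap (x e z : 'rV[R]_n) (d : R) :
  enorm e = 1 -> dotp e x = enorm x -> 0 < d -> d < 1 - enorm x ->
  truncated_kernel d z * barrier (x + z) +
    4 `^ (- (n%:R + 2 * s)) * \1_[set z | Z0 (z + 3 *: e)] z <=
  truncated_kernel d z * pospow (1 - enorm x - dotp e z).
Proof.
move=> e1 ex d0 dx; have k0 : 0 < 4 `^ (- (n%:R + 2 * s)) :> R by rewrite powR_gt0.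
have bh : barrier (x + z) <= pospow (1 - enorm x - dotp e z).
  apply: le_pospow; rewrite -ex -addrA lerD2l -opprD lerN2 -dotpD.
  by rewrite (le_trans (dotp_le _ _))// e1 mul1r.
rewrite indicE; have [|zZ] := boolP (z \in [set z | Z0 (z + 3 *: e)]); last first.
  by rewrite mulr0 addr0 ler_wpM2l ?truncated_kernel_ge0.
rewrite inE/= => zZ.
have n3e : enorm (3 *: e) = 3 by rewrite enormZ e1 mulr1 ger0_norm.
have zZ' : enorm (z + 3 *: e) <= 2^-1 := zZ.
have z1 : 2 <= enorm z.
  have := enormD (z + 3 *: e) (- z); rewrite enormN addrAC subrr add0r n3e; lra.
have z2 : enorm z <= 4.
  have := enormD (z + 3 *: e) (- (3 *: e)); rewrite enormN addrK n3e; lra.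
have -> : barrier (x + z) = 0.
  rewrite /barrier /pospow max_l ?powR0 ?gt_eqF//.
  have := enormD (x + z) (- x); rewrite enormN addrAC subrr add0r; lra.
have h1 : 1 <= pospow (1 - enorm x - dotp e z).
  apply: (@le_trans _ _ (pospow 1)); first by rewrite pospowE// powR1.
  apply: le_pospow.
  have := dotp_le e (z + 3 *: e); rewrite e1 mul1r dotpD dotpZ dotpp e1 expr1n mulr1; lra.
rewrite mulr0 add0r mulr1.
have dz : d < enorm z by have := enorm_ge0 x; lra.
apply: (@le_trans _ _ (truncated_kernel d z)); last by rewrite ler_peMr ?truncated_kernel_ge0.
rewrite /truncated_kernel dz !powRN lef_pV2 ?posrE ?powR_gt0//; last by rewrite (lt_trans d0).
by apply: ge0_ler_powR; rewrite ?nnegrE// addr_ge0// mulr_ge0// ltW.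
Qed.

(* The barrier is touched from above at x by the half-space function
   y |-> (1 - e . y)_+^s with e = x / |x|, which is s-harmonic; the gap between
   the two near x - 3 e makes the barrier strictly superharmonic. *)
Lemma barrier_supersolution : exists2 c : R, 0 < c &
  forall (x : 'rV[R]_n) (d : R), 0 < d -> d < 1 - enorm x ->
  ((\int[mu]_y (truncated_kernel d (x - y) * barrier y)%:E) + c%:E <=
   (fine (@kappa R n) * ((d `^ (- (2 * s)) / (2 * s)) * barrier x +
      2 * (1 - enorm x) `^ s * (1 - enorm x) ^- 2 * d `^ (2 - 2 * s)))%:E)%E.
Proof.
have mZ0 : measurable Z0 by exact: measurable_cball.
have Z0fin : mu Z0 \is a fin_num by rewrite ge0_fin_numE// borel_ball_fin.
have Z0gt : (0 < mu Z0)%E by apply: borel_ball_gt0; rewrite invr_gt0.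
pose k : R := 4 `^ (- (n%:R + 2 * s)).
have k0 : 0 < k by rewrite powR_gt0.
(* The pointwise gap times the volume of the ball of radius 1/2; by translation invariance it
   depends on neither x nor d. *)
exists (k * fine (mu Z0)).
  by rewrite mulr_gt0// fine_gt0// Z0gt/= ltey_eq Z0fin.
move=> x d d0 dx; have [e e1 ex] := exists_unit_direction x.
rewrite {2}/barrier pospowE; last by rewrite ltW// (lt_trans d0).
rewrite (mulrC (_ / _) (_ `^ s)); apply: le_trans (integral_pospow_halfspace1 e1 d0 dx).
rewrite (integral_truncated_kernel_conv d x measurable_barrier (fun y => pospow_ge0 _)).
have [mZ muZ] := ge0_borel_shift (3 *: e) mZ0.
rewrite EFinM fineK// -muZ; set Z := [set z | _] in mZ *.
have mI : measurable_fun setT (fun z : 'rV[R]_n => (k * \1_Z z)%:E).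
  by apply/measurable_EFinP; apply: measurable_funM; [exact: measurable_cst|exact: measurable_indic].
have -> : (k%:E * mu Z = \int[mu]_z (k * \1_Z z)%:E)%E.
  rewrite -[X in mu X]setIT -integral_indic// -ge0_integralZl//=.
  - by apply/measurable_EFinP; exact: measurable_indic.
  - by rewrite lee_fin ltW.
have mJb : measurable_fun setT (fun z : 'rV[R]_n => (truncated_kernel d z * barrier (x + z))%:E).
  apply/measurable_EFinP; apply: measurable_funM; first exact: measurable_truncated_kernel.
  apply: (measurableT_comp measurable_barrier).
  have := measurable_rV_affine 1 x.
  by under eq_fun do rewrite scale1r addrC.
have Jb0 (z : 'rV[R]_n) : setT z -> (0 <= (truncated_kernel d z * barrier (x + z))%:E)%E.
  by move=> _; rewrite lee_fin mulr_ge0 ?truncated_kernel_ge0 ?pospow_ge0.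
have I0 (z : 'rV[R]_n) : setT z -> (0 <= (k * \1_Z z)%:E)%E.
  by move=> _; rewrite lee_fin mulr_ge0 ?(ltW k0)// indicE.
rewrite -(ge0_integralD mu measurableT Jb0 mJb I0 mI).
apply: ge0_le_integral.
- exact: measurableT.
- by move=> z zT; rewrite adde_ge0 ?Jb0 ?I0.
- exact: emeasurable_funD.
- apply/measurable_EFinP; apply: measurable_funM; first exact: measurable_truncated_kernel.
  by have := measurable_pospow_dotp (1 - enorm x) (-1) e; under eq_fun do rewrite mulN1r.
- by move=> z _; rewrite -EFinD lee_fin; exact: barrier_gap.
Qed.

End barrier.

(** * The truncated Dirichlet problem *)

Section minimal_solution.
Local Open Scope ereal_scope.
Context d (T : measurableType d) (R : realType).
Variables (mu : {sigma_finite_measure set T -> \bar R}) (k : T -> T -> R) (M : R).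
Variables (D : set T) (f B : T -> R).
Hypotheses (mk : measurable_fun setT (fun p : T * T => k p.1 p.2)).
Hypotheses (k0 : forall x y, (0 <= k x y)%R) (M0 : (0 < M)%R) (mD : measurable D).
Hypotheses (mf : measurable_fun setT f) (f0 : forall x, (0 <= f x)%R).
Hypotheses (mB : measurable_fun setT B) (B0 : forall x, (0 <= B x)%R).
Hypothesis superB : forall x, D x ->
  (f x)%:E + \int[mu]_y (k x y * B y)%:E <= (M * B x)%:E.

(** Its fixed points are the solutions of M phi = f + int k phi on D that vanish off D. Since k >= 0
    it is order preserving, and [superB] says that it maps B below itself. *)
Let step (g : T -> \bar R) (x : T) : \bar R :=
  (\1_D x / M)%:E * ((f x)%:E + \int[mu]_y ((k x y)%:E * g y)).

Let u_ (i : nat) : T -> \bar R := iter i step (fun=> 0).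

Let step_ge0 g : (forall x, 0 <= g x) -> forall x, 0 <= step g x.
Proof.
move=> g0 x; rewrite /step mule_ge0//.
  by rewrite lee_fin divr_ge0 ?(ltW M0)// indicE.
by rewrite adde_ge0 ?lee_fin ?f0//; apply: integral_ge0 => y _; rewrite mule_ge0 ?lee_fin ?k0.
Qed.

Let measurable_kg x g : measurable_fun setT g ->
  measurable_fun setT (fun y => (k x y)%:E * g y).
Proof.
move=> mg; apply: emeasurable_funM => //; apply/measurable_EFinP.
exact: (measurableT_comp mk (measurable_pair1 x)).
Qed.

Let le_step g h : measurable_fun setT g -> measurable_fun setT h ->
  (forall x, 0 <= g x) -> (forall x, g x <= h x) -> forall x, step g x <= step h x.
Proof.
move=> mg mh g0 gh x; rewrite /step lee_wpmul2l//.
  by rewrite lee_fin divr_ge0 ?(ltW M0)// indicE.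
rewrite leeD2l//; apply: ge0_le_integral.
- exact: measurableT.
- by move=> y _; rewrite mule_ge0 ?lee_fin ?k0.
- exact: measurable_kg.
- exact: measurable_kg.
- by move=> y _; rewrite lee_wpmul2l ?lee_fin ?k0.
Qed.

Let measurable_step g : measurable_fun setT g -> (forall x, 0 <= g x) ->
  measurable_fun setT (step g).
Proof.
move=> mg g0; apply: emeasurable_funM.
  by apply/measurable_EFinP; apply: measurable_funM => //; exact: measurable_indic.
apply: emeasurable_funD; first exact/measurable_EFinP.
apply: (measurable_fun_fubini_tonelli_F (fun p : T * T => (k p.1 p.2)%:E * g p.2)).
  apply: emeasurable_funM; first exact/measurable_EFinP.
  exact: (measurableT_comp mg measurable_snd).
by move=> p; rewrite mule_ge0 ?lee_fin ?k0.
Qed.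

Let step_le_B x : step (EFin \o B) x <= (B x)%:E.
Proof.
rewrite /step indicE; have [Dx|Dx] := boolP (x \in D); last first.
  by rewrite mul0r mul0e lee_fin B0.
rewrite inE in Dx; rewrite mul1r muleC lee_pdivrMr//.
rewrite -EFinM mulrC; apply: le_trans (superB Dx).
by rewrite leeD2l//; under eq_integral do rewrite /= -EFinM.
Qed.

Let u_P i : [/\ measurable_fun setT (u_ i), forall x, 0 <= u_ i x,
  forall x, u_ i x <= (B x)%:E & forall x, u_ i x <= u_ i.+1 x].
Proof.
elim: i => [|i [mu0 u0 uB uS]].
  by split => //=; exact: step_ge0.
have mS : measurable_fun setT (u_ i.+1) by exact: measurable_step.
split => //.
- exact: step_ge0.
- move=> x; apply: le_trans (step_le_B x); apply: le_step => //.
  exact/measurable_EFinP.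
- by move=> x; exact: le_step.
Qed.

(** The iterates from 0 increase and stay below the finite function B, so they converge pointwise.
    Monotone convergence carries the recursion to the limit, with no compactness or regularity. *)
Lemma minimal_solution : exists phi : T -> R,
  [/\ measurable_fun setT phi, forall x, (0 <= phi x <= B x)%R,
      forall x, ~ D x -> phi x = 0%R &
      forall x, D x -> (M * phi x)%:E = (f x)%:E + \int[mu]_y (k x y * phi y)%:E].
Proof.
pose u x := limn (u_ ^~ x).
have ndu x : {homo u_ ^~ x : i j / (i <= j)%N >-> i <= j}.
  by apply/nondecreasing_seqP => i; have [_ _ _] := u_P i.
have cu x : u_ ^~ x @ \oo --> u x by apply: ereal_nondecreasing_is_cvgn.
have mu_ : measurable_fun setT u.
  apply: (emeasurable_fun_cvg u_) => [i|x _]; first by have [] := u_P i.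
  exact: cu.
have u0 x : 0 <= u x.
  by apply: lime_ge; [exact: cu|apply: nearW => i; have [_ + _ _] := u_P i].
have uB x : u x <= (B x)%:E.
  by apply: lime_le; [exact: cu|apply: nearW => i; have [_ _ + _] := u_P i].
have ufin x : u x \is a fin_num.
  by rewrite ge0_fin_numE//; apply: le_lt_trans (uB x) _; exact: ltry.
have stepu x : u x = step u x.
  apply: (@cvg_unique _ (@ereal_hausdorff R) (fmap (fun i => u_ i.+1 x) \oo)).
    by have := cu x; rewrite -(cvg_shiftS (u_ ^~ x)).
  apply: cvgeZl => //; apply: cvgeD; [by []|exact: cvg_cst|].
  have -> : (fun y => (k x y)%:E * u y) = (fun y => limn (fun i => (k x y)%:E * u_ i y)).
    by apply/funext => y; apply/esym/cvg_lim => //; exact: cvgeZl.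
  apply: cvg_monotone_convergence => //.
  - by move=> i; apply: measurable_kg; have [] := u_P i.
  - by move=> i y _; rewrite mule_ge0 ?lee_fin ?k0//; have [_ + _ _] := u_P i.
  - by move=> y _ i j ij; rewrite lee_wpmul2l ?lee_fin ?k0//; exact: ndu.
exists (fun x => fine (u x)); split.
- exact: (measurableT_comp (fine_measurable measurableT)).
- by move=> x; rewrite fine_ge0//= -lee_fin fineK.
- by move=> x Dx; rewrite stepu /step indicE memNset// mul0r mul0e.
- move=> x Dx; rewrite EFinM fineK// stepu /step indicE mem_set// mul1r muleA -EFinM.
  rewrite mulfV ?gt_eqF// mul1e; congr (_ + _); apply: eq_integral => y _.
  by rewrite EFinM fineK.
Qed.

End minimal_solution.

(** * Mollifiers *)

Section quadratic_remainder.
Context {R : realType} {V : normedModType R}.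

(** A quadratic remainder bound survives integration against phi, so this criterion replaces
    differentiation under the integral sign. It also handles the bump at the ends of its support. *)
Lemma is_derive_quadratic (f : V -> R) (x v : V) (a M : R) :
  (forall h : R, `|h| <= 1 -> `|f (x + h *: v) - f x - h * a| <= M * h ^+ 2) ->
  is_derive x v f a.
Proof.
move=> fM.
have M0 : 0 <= `|M| + 1 by rewrite addr_ge0.
have h : (h^-1 *: ((f \o shift x) (h *: v) - f x)) @[h --> 0^'] --> a.
  apply/cvgrPdist_le => e e0.
  have e1 : 0 < Num.min 1 (e / (`|M| + 1)) by rewrite lt_min ltr01/= divr_gt0// ltr_wpDl.
  near=> h.
  have h0 : h != 0 by near: h; exact: nbhs_dnbhs_neq.
  have he : `|h| < Num.min 1 (e / (`|M| + 1)).
    by near: h; apply: dnbhs0_lt.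
  move: he; rewrite lt_min => /andP[/ltW h1 he].
  rewrite /= /GRing.scale/= (addrC _ x).
  have -> : a - h^-1 * (f (x + h *: v) - f x) = - (h^-1 * (f (x + h *: v) - f x - h * a)).
    by field.
  rewrite normrN normrM normfV mulrC ler_pdivrMr ?normr_gt0//.
  apply: (le_trans (fM h h1)).
  apply: (@le_trans _ _ ((`|M| + 1) * h ^+ 2)).
    by rewrite ler_wpM2r ?sqr_ge0// (le_trans (ler_norm M))// lerDl.
  rewrite -(real_normK (num_real h)) expr2 mulrA ler_wpM2r//.
  by rewrite mulrC -ler_pdivlMr ?ltW// ltr_wpDl.
split; first by apply/cvg_ex; exists a.
exact: cvg_lim h.
Unshelve. all: by end_near. Qed.

End quadratic_remainder.

Section bump.
Context {R : realType}.
Implicit Types (p : {poly R}) (t w : R).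

(** All derivatives of exp(-1 / (1 - t^2)) have this form: one derivative replaces p by
    [bump_deriv p m] and m by m + 2. *)
Definition bump p (m : nat) t : R :=
  if `|t| < 1 then p.[t] * (1 - t ^+ 2) ^- m * expR (- (1 - t ^+ 2)^-1) else 0.

Definition bump_deriv p (m : nat) : {poly R} :=
  p^`() * (1 - 'X^2) ^+ 2 + (2 * m%:R)%:P * 'X * p * (1 - 'X^2) - 2%:P * 'X * p.

(** With x = 1 / w, raising e^(x/(m+2)) >= x / (m+2) to the power m + 2 beats x^(m+2). The two
    powers beyond m leave the factor w^2. *)
Lemma expR_inv_decay (m : nat) : exists2 C : R, 0 <= C &
  forall w, 0 < w -> w ^- m * expR (- w^-1) <= C * w ^+ 2.
Proof.
exists (m.+2%:R ^+ m.+2); first by rewrite exprn_ge0.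
move=> w w0; set x := w^-1; have x0 : 0 < x by rewrite invr_gt0.
have H : x ^+ m.+2 <= m.+2%:R ^+ m.+2 * expR x.
  have -> : expR x = expR (x / m.+2%:R) ^+ m.+2.
    by rewrite -expRM_natl mulrC divfK// pnatr_eq0.
  rewrite -exprMn; apply: lerXn2r; rewrite ?nnegrE ?mulr_ge0 ?expR_ge0 ?(ltW x0)//.
  rewrite mulrC -ler_pdivrMr ?ltr0n// (le_trans _ (expR_ge1Dx _))//.
  by rewrite lerDr.
rewrite expRN ler_pdivrMr ?expR_gt0// -exprVn -/x.
rewrite (_ : x ^+ m = x ^+ m.+2 * w ^+ 2); last first.
  by rewrite -[m.+2]addn2 exprD -mulrA -exprMn /x mulVf ?gt_eqF// expr1n mulr1.
by rewrite [leRHS]mulrAC ler_wpM2r// sqr_ge0.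
Qed.

(** The decay leaves (1 - t^2)^2 = (t0 - t)^2 (t0 + t)^2, and the last factor is at most 4. Through
    [is_derive_quadratic] this gives derivative 0 at t = 1 and t = -1. *)
Lemma bump_quadratic p m : exists2 C : R, 0 <= C &
  forall t0 t, `|t0| = 1 -> `|bump p m t| <= C * (t - t0) ^+ 2.
Proof.
have [C C0 HC] := expR_inv_decay m.
have [P P0 HP] : exists2 P : R, 0 <= P & forall t, `|t| <= 1 -> `|p.[t]| <= P.
  have cp : {within `[-1, 1], continuous (fun t : R => `|p.[t]|)}.
    apply: continuous_subspaceT => t.
    by apply: continuous_comp; [exact: continuous_horner|exact: norm_continuous].
  have N11 : -1 <= 1 :> R by lra.
  have [c _ hc] := EVT_max N11 cp.
  exists `|p.[c]| => // t; rewrite ler_norml => t1; apply: hc.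
  by rewrite in_itv.
exists (P * C * 4); first by rewrite !mulr_ge0.
move=> t0 t t01; rewrite /bump.
case: ifPn => [t1|_]; last by rewrite normr0 mulr_ge0 ?sqr_ge0 ?mulr_ge0.
have w0 : 0 < 1 - t ^+ 2 by rewrite subr_gt0 -real_normK ?num_real// expr_lt1.
rewrite !normrM -!mulrA ler_pM// ?HP ?(ltW t1)//.
rewrite ger0_norm ?invr_ge0 ?exprn_ge0 ?(ltW w0)// ger0_norm ?expR_ge0//.
apply: (le_trans (HC _ w0)); rewrite ler_wpM2l//.
have -> : 1 - t ^+ 2 = (t0 - t) * (t0 + t).
  by rewrite -subr_sqr -(real_normK (num_real t0)) t01 expr1n.
rewrite exprMn mulrC -[(t0 - t) ^+ 2]sqrrN opprB ler_wpM2r ?sqr_ge0//.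
rewrite -(real_normK (num_real (t0 + t))) (_ : 4 = 2 ^+ 2); last by rewrite -natrX.
apply: lerXn2r; rewrite ?nnegrE// (le_trans (ler_normD _ _))// t01.
by move: t1; lra.
Qed.

Lemma is_derive_bump p m t : is_derive t 1 (bump p m) (bump (bump_deriv p m) m.+2 t).
Proof.
have [t1|t1|t1] := ltgtP `|t| 1.
- have w0 : 1 - t ^+ 2 != 0.
    by rewrite gt_eqF// subr_gt0 -real_normK ?num_real// expr_lt1.
  pose g (t : R) := p.[t] * ((1 - t ^+ 2) ^-1) ^+ m * expR (- (1 - t ^+ 2)^-1).
  apply: (@near_eq_is_derive _ _ _ g).
    have : \forall t' \near t, `|t'| < 1.
      by have := @norm_continuous R R t; move=> /cvgr_lt; apply.
    by apply: filterS => t' t'1; rewrite /g /bump t'1 exprVn.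
  have d1 : is_derive t 1 (fun t : R => 1 - t ^+ 2) (- (2 * t)).
    have := is_deriveB (is_derive_cst (1 : R) t 1) (is_deriveX 2 (is_derive_id t 1)).
    by rewrite sub0r /GRing.scale/= mulr1 expr1; apply.
  have d2 := @is_deriveV R (fun t => 1 - t ^+ 2) t _ 1 w0 d1.
  have d3 := is_deriveX m d2.
  have d4 := @is_derive1_comp _ _ _ _ _ _ (is_derive_expR _) (is_deriveN d2).
  have := is_deriveM (is_deriveM (is_derive_poly p t) d3) d4.
  congr (is_derive _ _ _ _); first by apply/funext => y; rewrite !fctE.
  rewrite !fctE /bump t1 /bump_deriv !hornerE/= /GRing.scale/=.
  set w := 1 - t ^+ 2 in w0 *.
  (* For m = 0 the truncated predecessor is harmless, since both sides carry the factor 0. *)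
  have E0 : m%:R * w^-1 ^+ m.-1 = m%:R * (w^-1 ^+ m * w).
    by case: (m) => [|k]; rewrite ?mul0r// exprSr -mulrA mulVf// mulr1.
  rewrite E0 -exprVn -[m.+2]addn2 exprD; set E := expR _; set q := w^-1 ^+ m.
  by rewrite invfM -[(w ^+ m)^-1]exprVn -/q; field.
- have : \forall t' \near t, 1 < `|t'|.
    by have := @norm_continuous R R t; move=> /cvgr_gt; apply.
  move=> t1n; rewrite {2}/bump ltNge (ltW t1)/=.
  apply: near_eq_is_derive (is_derive_cst (0 : R) t (1 : R)).
  by apply: filterS t1n => t' t'1; rewrite /bump ltNge (ltW t'1).
- have [C C0 HC] := bump_quadratic p m.
  rewrite {2}/bump t1 ltxx.
  apply: (is_derive_quadratic (M := C)) => h _.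
  rewrite {2}/bump t1 ltxx mulr0 !subr0.
  by have := HC t (t + h *: 1) t1; rewrite addrAC subrr add0r /GRing.scale/= mulr1.
Qed.

(** E j is the j-th derivative of one bump; these four properties are all that is used of it
    afterwards. *)
Lemma exists_bump : exists E : nat -> R -> R,
  [/\ forall j t, is_derive t 1 (E j) (E j.+1 t),
      forall j t, 1 <= `|t| -> E j t = 0, forall t, 0 <= E 0%N t &
      forall t, `|t| < 1 -> 0 < E 0%N t].
Proof.
pose next (pm : {poly R} * nat) := (bump_deriv pm.1 pm.2, pm.2.+2).
pose pm j := iter j next (1, 0%N).
have E0 t : `|t| < 1 -> 0 < bump (pm 0%N).1 (pm 0%N).2 t.
  by move=> t1; rewrite /bump t1/= hornerC expr0 invr1 !mul1r expR_gt0.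
exists (fun j => bump (pm j).1 (pm j).2); split => //.
- by move=> j t; exact: is_derive_bump.
- by move=> j t t1; rewrite /bump ltNge t1.
- move=> t; have [/E0/ltW//|t1] := ltP `|t| 1.
  by rewrite /bump ltNge t1.
Qed.

End bump.

Section bump_bounds.
Context {R : realType} (E : nat -> R -> R).
Hypotheses (dE : forall j (t : R), is_derive t 1 (E j) (E j.+1 t))
  (E0 : forall j (t : R), 1 <= `|t| -> E j t = 0).

Lemma bump_bounded j : exists2 M : R, 0 <= M & forall t, `|E j t| <= M.
Proof.
have cE : {within `[-1, 1], continuous (fun t : R => `|E j t|)}.
  apply: continuous_subspaceT => t.
  apply: continuous_comp; last exact: norm_continuous.
  by apply: derivable_continuous; apply: ex_derive.
have N11 : -1 <= 1 :> R by lra.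
have [c _ hc] := EVT_max N11 cE.
exists `|E j c| => // t; have [t1|t1] := leP `|t| 1.
  by apply: hc; rewrite in_itv/= -ler_norml.
by rewrite E0 ?normr0// ltW.
Qed.

Lemma bump_lipschitz j : exists2 M : R, 0 <= M &
  forall t h, `|E j (t + h) - E j t| <= M * `|h|.
Proof.
have [M M0 HM] := bump_bounded j.+1; exists M => //.
have key a b : a <= b -> `|E j b - E j a| <= M * `|b - a|.
  move=> ab; have cE : continuous (E j).
    by move=> t; apply: derivable_continuous; apply: ex_derive.
  have [c _ ->] := MVT_segment ab (fun x _ => dE j x) (continuous_subspaceT cE).
  by rewrite normrM ler_wpM2r.
move=> t h; have [h0|/ltW h0] := leP 0 h.
  by have := key t (t + h); rewrite lerDl addrAC subrr add0r; apply.
have := key (t + h) t; rewrite gerDl opprD addrA subrr add0r normrN distrC.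
by apply.
Qed.

(** Mean value theorem for u -> E j (t + u) - u E j.+1 t: its derivative is at most M |h|, with M a
    Lipschitz constant of E j.+1. *)
Lemma bump_taylor j : exists2 M : R, 0 <= M &
  forall t h, `|E j (t + h) - E j t - h * E j.+1 t| <= M * h ^+ 2.
Proof.
have [M M0 HM] := bump_lipschitz j.+1; exists M => //.
move=> t h.
pose f (u : R) := E j (t + u) - u * E j.+1 t.
pose df (u : R) := E j.+1 (t + u) - E j.+1 t.
have ddf (u : R) : is_derive u 1 f (df u).
  have du : is_derive u 1 (fun u : R => t + u) 1.
    by have := is_deriveD (is_derive_cst (t : R) u 1) (is_derive_id u 1); rewrite add0r; apply.
  have d1 := @is_derive1_comp R (E j) (fun u => t + u) u _ _ (dE j (t + u)) du.
  have d2 : is_derive u 1 (fun u : R => u * E j.+1 t) (E j.+1 t).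
    have := is_deriveM (is_derive_id u (1 : R)) (is_derive_cst (E j.+1 t : R) u (1 : R)).
    by rewrite scaler0 add0r /GRing.scale/= mulr1; apply.
  by have := is_deriveB d1 d2; rewrite mulr1; apply.
have cf : continuous f.
  by move=> u; apply: derivable_continuous; apply: ex_derive.
have key a b : a <= b -> `|a| <= `|h| -> `|b| <= `|h| -> `|f b - f a| <= M * `|h| * `|b - a|.
  move=> ab ah bh; have [c cab ->] := MVT_segment ab (fun x _ => ddf x) (continuous_subspaceT cf).
  rewrite normrM ler_wpM2r// (le_trans (HM _ _))// ler_wpM2l//.
  by move: cab ah bh; rewrite in_itv/= !ler_norml; lra.
have -> : E j (t + h) - E j t - h * E j.+1 t = f h - f 0.
  by rewrite /f addr0; ring.
rewrite -(real_normK (num_real h)) expr2 mulrA.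
have [h0|/ltW h0] := leP 0 h.
  by have := key 0 h; rewrite subr0 normr0; apply.
by have := key h 0; rewrite sub0r normrN distrC normr0; apply.
Qed.

End bump_bounds.

Section bounded_times_integrable.
Context d (T : measurableType d) (R : realType) (mu : {measure set T -> \bar R}).
Variable phi : T -> R.
Hypotheses (phi0 : forall y, 0 <= phi y) (iphi : mu.-integrable setT (EFin \o phi)).

Lemma integrable_bounded_mul (w : T -> R) (W : R) :
  measurable_fun setT w -> (forall y, `|w y| <= W) ->
  mu.-integrable setT (fun y => (w y * phi y)%:E).
Proof.
move=> mw wW; have mphi : measurable_fun setT phi.
  by apply/measurable_EFinP; exact: measurable_int iphi.
apply: (@le_integrable _ _ _ mu setT measurableT _ (fun y => W%:E * (EFin \o phi) y)%E).
- by apply/measurable_EFinP; exact: measurable_funM.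
- move=> y _; rewrite -EFinM !abse_EFin lee_fin !normrM ler_wpM2r//.
  by rewrite (le_trans (wW y))// ler_norm.
- exact: integrableZl.
Qed.

Lemma le_normr_Rintegral_mul (w : T -> R) (W : R) :
  measurable_fun setT w -> (forall y, `|w y| <= W) ->
  `|\int[mu]_y (w y * phi y)| <= W * \int[mu]_y phi y.
Proof.
move=> mw wW; have iw := integrable_bounded_mul mw wW.
apply: (le_trans (le_normr_Rintegral measurableT iw)).
rewrite -RintegralZl//; apply: le_Rintegral => //.
- exact: integrable_norm.
- by apply: (@integrable_bounded_mul (cst W) `|W|).
- by move=> y _; rewrite normrM (ger0_norm (phi0 y)) ler_wpM2r.
Qed.

End bounded_times_integrable.

Section tame.
Context {R : realType} (n : nat).
Implicit Types (f g : 'rV[R]_n -> R).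

(** The second-difference bound is the one wanted for the mollifier. The other two are included
    because they make the class stable under products. *)
Definition tame (M : R) f :=
  [/\ forall x, `|f x| <= M, forall x z, `|f (x + z) - f x| <= M * enorm z &
      forall x z, `|f (x + z) + f (x - z) - 2 * f x| <= M * enorm z ^+ 2].

Lemma tame_ge0 M f : tame M f -> 0 <= M.
Proof. by move=> [h _ _]; apply: le_trans (h 0). Qed.

Lemma tame_cst (c : R) : exists M, tame M (cst c : 'rV[R]_n -> R).
Proof.
exists `|c|; split => [//|x z|x z].
- by rewrite subrr normr0 mulr_ge0.
- by rewrite (_ : _ - _ = 0) ?normr0 ?mulr_ge0 ?exprn_ge0//; rewrite /cst; ring.
Qed.

(** In the second difference of f g the cross terms are products of two first differences, each
    Lipschitz, hence again quadratic in z. Four quadratic terms give the constant 4 M N. *)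
Lemma tameM M N f g : tame M f -> tame N g ->
  exists L, tame L (fun x => f x * g x).
Proof.
move=> tf tg; have M0 := tame_ge0 tf; have N0 := tame_ge0 tg.
move: tf tg => [f0 f1 f2] [g0 g1 g2].
exists (4 * M * N); split => [x|x z|x z].
- rewrite normrM (le_trans (ler_pM _ _ (f0 x) (g0 x)))//.
  by rewrite -mulrA ler_peMl ?mulr_ge0//; lra.
- rewrite (_ : _ - _ = (f (x + z) - f x) * g (x + z) + f x * (g (x + z) - g x)); last by ring.
  rewrite (le_trans (ler_normD _ _))// !normrM.
  apply: (@le_trans _ _ (M * enorm z * N + M * (N * enorm z))).
    by rewrite lerD// ler_pM.
  have : 0 <= M * N * enorm z by rewrite !mulr_ge0.
  lra.
- rewrite (_ : _ - _ = (f (x + z) + f (x - z) - 2 * f x) * g x +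
    (f x * (g (x + z) + g (x - z) - 2 * g x) +
    ((f (x + z) - f x) * (g (x + z) - g x) + (f (x - z) - f x) * (g (x - z) - g x)))); last by ring.
  have := f1 x (- z); have := g1 x (- z); rewrite enormN => g1' f1'.
  apply: (@le_trans _ _ (M * enorm z ^+ 2 * N + (M * (N * enorm z ^+ 2) +
     (M * enorm z * (N * enorm z) + M * enorm z * (N * enorm z))))).
    do 3! (apply: (le_trans (ler_normD _ _)); apply: lerD; first by rewrite normrM ler_pM).
    by rewrite normrM ler_pM.
  by rewrite le_eqVlt; apply/orP; left; apply/eqP; ring.
Qed.

End tame.

Section prodbump.
Context {R : realType} (n : nat) (E : nat -> R -> R).
Hypotheses (dE : forall j (t : R), is_derive t 1 (E j) (E j.+1 t))
  (E0 : forall j (t : R), 1 <= `|t| -> E j t = 0).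
Implicit Types (k : 'I_n -> nat) (t : R) (x z : 'rV[R]_n).

(** The partial derivative of multi-index k of x -> prod_i E 0 (t x_i); the powers of t come from
    the chain rule. *)
Definition prodbump k t x : R := \prod_(i < n) (t ^+ k i * E (k i) (t * x ord0 i)).

Definition incr k (i : 'I_n) : 'I_n -> nat := fun j => (k j + (j == i))%N.

Let continuous_E j : continuous (E j).
Proof. by move=> t; apply: derivable_continuous; apply: ex_derive. Qed.

Lemma measurable_prodbump k t : measurable_fun setT (prodbump k t).
Proof.
apply: measurable_prod => i _; apply: measurable_funM => //.
apply: (measurableT_comp (continuous_measurable_fun (@continuous_E (k i)))).
by apply: measurable_funM => //; exact: measurable_coord.
Qed.

Lemma prodbump_support k t x : 0 < t -> n%:R < t * enorm x -> prodbump k t x = 0.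
Proof.
move=> t0 nx; apply/eqP; apply: contraT => px.
suff : enorm x <= n%:R * t^-1 by rewrite ler_pdivlMr// mulrC leNgt nx.
apply: enorm_le_coord => i.
rewrite leNgt; apply: contra px => ti; apply/prodf_eq0; exists i => //.
rewrite E0 ?mulr0// normrM (gtr0_norm t0) -ler_pdivrMl// mulr1 ltW//.
Qed.

Lemma tame_coord j (t : R) (i : 'I_n) : exists M,
  tame M (fun x : 'rV[R]_n => t ^+ j * E j (t * x ord0 i)).
Proof.
have [M0 M00 H0] := bump_bounded dE E0 j.
have [M1 M10 H1] := bump_lipschitz dE E0 j.
have [M2 M20 H2] := bump_taylor dE E0 j.
pose T := `|t| ^+ j.
have T0 : 0 <= T by rewrite exprn_ge0.
have Tt : `|t ^+ j| = T by rewrite normrX.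
exists (T * (M0 + M1 * `|t| + 2 * M2 * t ^+ 2)).
have L0 : 0 <= M1 * `|t| by rewrite mulr_ge0.
have L1 : 0 <= 2 * M2 * t ^+ 2 by rewrite mulr_ge0 ?sqr_ge0 ?mulr_ge0.
split => [x|x z|x z].
- rewrite normrM Tt ler_wpM2l//; have := H0 (t * x ord0 i); lra.
- rewrite -mulrBr normrM Tt -[leRHS]mulrA ler_wpM2l// mxE mulrDr (le_trans (H1 _ _))//.
  rewrite normrM mulrA ler_pM ?le_coord_enorm// ?mulr_ge0//; lra.
- rewrite (_ : _ - _ = t ^+ j * ((E j (t * x ord0 i + t * z ord0 i) - E j (t * x ord0 i) - (t * z ord0 i) * E j.+1 (t * x ord0 i))
     + (E j (t * x ord0 i + - (t * z ord0 i)) - E j (t * x ord0 i) - (- (t * z ord0 i)) * E j.+1 (t * x ord0 i)))); last first.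
    by rewrite !mxE !mulrDr mulrN; ring.
  rewrite normrM Tt -[leRHS]mulrA ler_wpM2l// (le_trans (ler_normD _ _))//.
  apply: (@le_trans _ _ (M2 * (t * z ord0 i) ^+ 2 + M2 * (- (t * z ord0 i)) ^+ 2)).
    by rewrite lerD.
  have hz : z ord0 i ^+ 2 <= enorm z ^+ 2.
    by rewrite -(real_normK (num_real (z ord0 i))) lerXn2r ?nnegrE ?le_coord_enorm.
  rewrite (_ : _ + _ = 2 * M2 * t ^+ 2 * z ord0 i ^+ 2); last by ring.
  apply: (le_trans (ler_wpM2l L1 hz)); rewrite ler_wpM2r ?sqr_ge0//; lra.
Qed.

Lemma tame_prodbump k t : exists M, tame M (prodbump k t).
Proof.
pose F i x := t ^+ k i * E (k i) (t * x ord0 i).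
suff [M tM] : exists M, tame M (fun x => \prod_(i <- index_enum 'I_n) F i x) by exists M.
elim: (index_enum _) => [|i r [M IH]].
  have [M tM] := tame_cst n (1 : R); exists M.
  have -> : (fun x => \prod_(i <- [::]) F i x) = cst 1 by apply/funext => x; rewrite big_nil.
  exact: tM.
have [N tN] := tame_coord (k i) t i.
have [L tL] := tameM tN IH; exists L.
have -> : (fun x => \prod_(j <- i :: r) F j x) = (fun x => F i x * \prod_(j <- r) F j x).
  by apply/funext => x; rewrite big_cons.
exact: tL.
Qed.

Lemma taylor_prodbump k t (i : 'I_n) : exists2 M, 0 <= M & forall x (h : R),
  `|prodbump k t (x + h *: delta_mx ord0 i) - prodbump k t x -
    h * prodbump (incr k i) t x| <= M * h ^+ 2.
Proof.
have [M1 M10 H1] := bump_taylor dE E0 (k i).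
(* A shift along coordinate i leaves these factors unchanged, so the one-dimensional Taylor bound
   applies to the remaining one. *)
pose P x := \prod_(j < n | j != i) (t ^+ k j * E (k j) (t * x ord0 j)).
have [N N0 HP] : exists2 N, 0 <= N & forall x, `|P x| <= N.
  rewrite /P; elim: (index_enum _) => [|j r [N N0 IH]].
    by exists 1 => // x; rewrite big_nil normr1.
  have [M tM] := tame_coord (k j) t j; have M0 := tame_ge0 tM.
  case: tM => HM _ _.
  case: (boolP (j != i)) => ji.
    exists (M * N); first exact: mulr_ge0.
    by move=> x; rewrite big_cons ji normrM ler_pM.
  by exists N => // x; rewrite big_cons (negbTE ji).
pose T := `|t| ^+ k i.
have T0 : 0 <= T by rewrite exprn_ge0.
exists (T * (M1 * t ^+ 2) * N); first by do 3! (apply: mulr_ge0 => //); exact: sqr_ge0.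
move=> x h.
have E1 : prodbump k t (x + h *: delta_mx ord0 i) =
    t ^+ k i * E (k i) (t * x ord0 i + t * h) * P x.
  rewrite /prodbump (bigD1 i)//=; congr (_ * _).
    by rewrite !mxE !eqxx mulr1 mulrDr.
  by apply: eq_bigr => j ji; rewrite !mxE (negbTE ji) andbF mulr0 addr0.
have E2 : prodbump k t x = t ^+ k i * E (k i) (t * x ord0 i) * P x.
  by rewrite /prodbump (bigD1 i).
have E3 : prodbump (incr k i) t x = t ^+ (k i).+1 * E (k i).+1 (t * x ord0 i) * P x.
  rewrite /prodbump (bigD1 i)//= /incr eqxx addn1; congr (_ * _).
  by apply: eq_bigr => j ji; rewrite (negbTE ji) addn0.
rewrite E1 E2 E3 exprSr.
rewrite (_ : _ - _ - _ = t ^+ k i * (E (k i) (t * x ord0 i + t * h) - E (k i) (t * x ord0 i) -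
   (t * h) * E (k i).+1 (t * x ord0 i)) * P x); last by ring.
rewrite !normrM normrX -/T.
rewrite [leRHS](_ : _ = T * (M1 * (t * h) ^+ 2) * N); last by ring.
by rewrite ler_pM// ?mulr_ge0// ler_wpM2l.
Qed.

End prodbump.

Lemma borel_ball_scale {R : realType} (n : nat) (r : R) : 0 < r ->
  @borel_lebesgue_rV R n [set x | enorm x <= r] =
  ((r ^+ n)%:E * @borel_lebesgue_rV R n [set x | (enorm x <= 1)%R])%E.
Proof.
move=> r0; have m1 := @measurable_cball R n r; have m2 := @measurable_cball R n 1.
rewrite -[X in _ X = _]setIT -[X in (_ * _ X)%E]setIT -!integral_indic//.
rewrite -(@ge0_integral_affine _ n r 0 (fun x => (\1_[set x | enorm x <= r] x)%:E)) ?gt_eqF//; last first.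
  by apply/measurable_EFinP; exact: measurable_indic.
rewrite gtr0_norm//; congr (_ * _)%E; apply: eq_integral => x _.
have Er : (enorm (r *: x) <= r) = (enorm x <= 1).
  by rewrite enormZ gtr0_norm// -{2}(mulr1 r) ler_pM2l.
rewrite addr0 !indicE; have [h|h] := boolP (enorm x <= 1).
  by rewrite !mem_set//= Er.
by rewrite !memNset//=; [exact/negP|rewrite Er; exact/negP].
Qed.

(** * Smoothness of convolutions *)

Section convolution.
Context {R : realType} (n : nat) (E : nat -> R -> R).
Hypotheses (dE : forall j (t : R), is_derive t 1 (E j) (E j.+1 t))
  (E0 : forall j (t : R), 1 <= `|t| -> E j t = 0).
Notation mu := (@borel_lebesgue_rV R n).
Variables (phi : 'rV[R]_n -> R) (c t : R).
Hypotheses (phi0 : forall y, 0 <= phi y) (iphi : mu.-integrable setT (EFin \o phi)).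

Let conv (k : 'I_n -> nat) (x : 'rV[R]_n) : R :=
  \int[mu]_y (c * prodbump E k t (x - y) * phi y).

Let measurable_c k x : measurable_fun setT (fun y : 'rV[R]_n => c * prodbump E k t (x - y)).
Proof.
apply: measurable_funM => //; apply: (measurableT_comp (measurable_prodbump dE k t)).
have := measurable_rV_affine (-1) x.
by under eq_fun do rewrite scaleN1r addrC.
Qed.

Let bounded_c k : exists C, forall x y : 'rV[R]_n, `|c * prodbump E k t (x - y)| <= C.
Proof.
have [M [HM _ _]] := tame_prodbump dE E0 k t.
by exists (`|c| * M) => x y; rewrite normrM ler_wpM2l.
Qed.

Let integrable_c k x : mu.-integrable setT (fun y => (c * prodbump E k t (x - y) * phi y)%:E).
Proof.
have [C HC] := bounded_c k.
exact: (integrable_bounded_mul iphi (measurable_c k x) (HC x)).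
Qed.

Let continuous_conv k : continuous (conv k).
Proof.
have [M tM] := tame_prodbump dE E0 k t; have M0 := tame_ge0 tM; case: tM => _ HM _.
apply: (@lipschitz_continuous_rV _ _ (`|c| * M * \int[mu]_y phi y)) => x x'.
rewrite /conv -(RintegralB measurableT (integrable_c k x) (integrable_c k x')).
under eq_Rintegral do rewrite -mulrBl -mulrBr.
rewrite mulrAC; apply: le_normr_Rintegral_mul => //.
  under eq_fun do rewrite mulrBr.
  by apply: measurable_funB; exact: measurable_c.
move=> y; rewrite normrM -mulrA ler_wpM2l//.
have -> : x - y = x' - y + (x - x') by rewrite [RHS]addrC addrA subrK.
exact: HM.
Qed.

Let is_derive_conv k i x : is_derive x (delta_mx ord0 i) (conv k) (conv (incr k i) x).
Proof.
have [M M0 HM] := taylor_prodbump dE E0 k t i.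
apply: (is_derive_quadratic (M := `|c| * M * \int[mu]_y phi y)) => h _.
have -> : conv k (x + h *: delta_mx ord0 i) - conv k x - h * conv (incr k i) x =
  \int[mu]_y (c * (prodbump E k t (x - y + h *: delta_mx ord0 i) - prodbump E k t (x - y) -
     h * prodbump E (incr k i) t (x - y)) * phi y).
  rewrite /conv -(RintegralZl h measurableT (integrable_c (incr k i) x)).
  rewrite -(RintegralB measurableT (integrable_c k _) (integrable_c k x)) -RintegralB//.
  - by apply: eq_Rintegral => y _; rewrite (addrAC x); ring.
  - exact: (integrableB measurableT (integrable_c k _) (integrable_c k x)).
  - exact: (integrableZl measurableT h (integrable_c (incr k i) x)).
rewrite mulrAC; apply: le_normr_Rintegral_mul => //.
  rewrite (_ : (fun y => _) = (fun y => c * prodbump E k t (x + h *: delta_mx ord0 i - y) -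
    c * prodbump E k t (x - y) - h * (c * prodbump E (incr k i) t (x - y)))); last first.
    by apply/funext => y; rewrite (addrAC x); ring.
  apply: measurable_funB; first by apply: measurable_funB; exact: measurable_c.
  by apply: measurable_funM => //; exact: measurable_c.
by move=> y; rewrite normrM -mulrA ler_wpM2l.
Qed.

(** A partial derivative of [conv k] only raises k in one coordinate, so every iterated partial is
    again some [conv k], which is Lipschitz. *)
Lemma smooth_conv : smooth (conv (fun=> 0%N)).
Proof.
move=> l; have [k ->] : exists k, foldr partial (conv (fun=> 0%N)) l = conv k.
  elim: l => [|i l [k IH]] /=; first by exists (fun=> 0%N).
  exists (incr k i); rewrite IH; apply/funext => x; rewrite /partial.
  by have [_] := is_derive_conv k i x.
split; first exact: continuous_conv.
by move=> i x; have [] := is_derive_conv k i x.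
Qed.

End convolution.

(** One constant A serves all scales, and the second difference carries the explicit power e^-(n+2):
    the annulus estimate needs exactly this dependence on e. *)
Lemma exists_mollifier {R : realType} (n : nat) : (0 < n)%N ->
  exists (A : R) (rho : R -> 'rV[R]_n -> R), 0 <= A /\ forall e, 0 < e ->
  [/\ measurable_fun setT (rho e), forall x, 0 <= rho e x <= A * e ^- n,
      (\int[borel_lebesgue_rV n]_x (rho e x)%:E = 1)%E,
      forall x, e < enorm x -> rho e x = 0 &
      forall x z, `|rho e (x + z) + rho e (x - z) - 2 * rho e x| <= A * e ^- n.+2 * enorm z ^+ 2] /\
  forall phi : 'rV[R]_n -> R, (forall y, 0 <= phi y) ->
    (borel_lebesgue_rV n).-integrable setT (EFin \o phi) ->
    smooth (fun x => \int[borel_lebesgue_rV n]_y (rho e (x - y) * phi y)).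
Proof.
move=> n0; have [E [dE E0 Ege0 Egt0]] := @exists_bump R.
have n0' : 0 < n%:R :> R by rewrite ltr0n.
pose mu := @borel_lebesgue_rV R n.
pose k0 := (fun=> 0%N) : 'I_n -> nat.
pose P := prodbump E k0.
have Pge0 t x : 0 <= P t x.
  by apply: prodr_ge0 => i _; rewrite mulr_ge0// expr0.
have Pscale t x : P t x = P 1 (t *: x).
  by apply: eq_bigr => i _; rewrite !expr0 !mxE !mul1r.
have mP t : measurable_fun setT (P t) by exact: measurable_prodbump.
have [M tM] := tame_prodbump dE E0 k0 1; have M0 := tame_ge0 tM.
case: tM => HM0 _ HM2.
pose I0 := (\int[mu]_x (P 1 x)%:E)%E.
have I0fin : (I0 < +oo)%E.
  have mB := @measurable_cball R n n%:R.
  apply: (@le_lt_trans _ _ (\int[mu]_x (M * \1_[set x | enorm x <= n%:R] x)%:E)%E).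
    apply: ge0_le_integral => //.
    - by move=> x _; rewrite lee_fin.
    - exact/measurable_EFinP.
    - by apply/measurable_EFinP; apply: measurable_funM => //; exact: measurable_indic.
    - move=> x _; rewrite lee_fin indicE.
      have [xn|xn] := leP (enorm x) n%:R.
        by rewrite mem_set// mulr1 (le_trans (ler_norm _)).
      by rewrite /P prodbump_support ?mul1r// mulr_ge0.
  under eq_integral do rewrite EFinM.
  rewrite ge0_integralZl//=; last first.
    by apply/measurable_EFinP; exact: measurable_indic.
  by rewrite integral_indic// setIT lte_mul_pinfty// borel_ball_fin.
(* On the ball of radius 1/2 all coordinates lie in [-1/2, 1/2], where every factor is at least the
   positive minimum of E 0. *)
have I0gt : (0 < I0)%E.
  have cE : {within `[- 2^-1, 2^-1], continuous (E 0%N)}.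
    apply: continuous_subspaceT => t.
    by apply: derivable_continuous; apply: ex_derive.
  have N11 : - 2^-1 <= 2^-1 :> R by lra.
  have [c ci hc] := EVT_min N11 cE.
  have c0 : 0 < E 0%N c.
    by apply: Egt0; move: ci; rewrite in_itv/= -ler_norml; lra.
  have mB := @measurable_cball R n 2^-1.
  apply: (@lt_le_trans _ _ (\int[mu]_x (E 0%N c ^+ n * \1_[set x | enorm x <= 2^-1] x)%:E)%E).
    under eq_integral do rewrite EFinM.
    rewrite ge0_integralZl//=; last 2 first.
    - by apply/measurable_EFinP; exact: measurable_indic.
    - by rewrite lee_fin exprn_ge0// ltW.
    rewrite integral_indic// setIT mule_gt0//; first by rewrite lte_fin exprn_gt0.
    by apply: borel_ball_gt0 => //; rewrite invr_gt0.
  apply: ge0_le_integral => //.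
  - by move=> x _; rewrite lee_fin mulr_ge0 ?exprn_ge0 ?(ltW c0)// indicE.
  - by apply/measurable_EFinP; apply: measurable_funM => //; exact: measurable_indic.
  - exact/measurable_EFinP.
  - move=> x _; rewrite lee_fin indicE.
    have [xn|xn] := leP (enorm x) 2^-1; last first.
      by rewrite memNset ?mulr0//=; apply/negP; rewrite -ltNge.
    rewrite mem_set// mulr1 /P /prodbump.
    rewrite (_ : _ ^+ n = \prod_(i < n) E 0%N c); last by rewrite prodr_const card_ord.
    apply: ler_prod => i _; rewrite (ltW c0)/= expr0 !mul1r; apply: hc.
    by rewrite in_itv/= -ler_norml (le_trans (le_coord_enorm _ _)).
pose I := fine I0.
have I0E : I0 = I%:E by rewrite /I fineK// ge0_fin_numE// ltW.
have Igt0 : 0 < I by rewrite -lte_fin -I0E.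
(* The product bump lives in the unit cube, hence in the ball of radius n. The dilation n / e brings
   its support into the ball of radius e, and this factor restores mass 1. *)
pose c e : R := (n%:R / e) ^+ n / I.
have c0 e : 0 < e -> 0 < c e by move=> e0; rewrite divr_gt0// exprn_gt0// divr_gt0.
(* The normalisation contributes n^n and the second difference of the dilated bump contributes
   n^2. *)
pose A := M * n%:R ^+ n.+2 / I.
have A0 : 0 <= A by rewrite divr_ge0 ?(ltW Igt0)// mulr_ge0// exprn_ge0.
exists A, (fun e x => c e * P (n%:R / e) x).
split=> // e e0.
have ne0 : 0 < n%:R / e by rewrite divr_gt0.
have cE : c e = n%:R ^+ n / I * e ^- n.
  by rewrite /c exprMn exprVn; ring.
split; last first.
  by move=> phi phi0 iphi; exact: (@smooth_conv _ _ _ dE E0 phi (c e) (n%:R / e)).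
split.
- exact: measurable_funM.
- move=> x; rewrite mulr_ge0 ?(ltW (c0 _ e0))//=.
  apply: (@le_trans _ _ (c e * M)).
    by rewrite ler_wpM2l ?(ltW (c0 _ e0))// Pscale (le_trans (ler_norm _)).
  rewrite cE mulrAC ler_wpM2r ?invr_ge0 ?exprn_ge0 ?(ltW e0)//.
  rewrite /A [leLHS]mulrAC ler_wpM2r ?invr_ge0 ?(ltW Igt0)// mulrC ler_wpM2l//.
  by rewrite ler_weXn2l ?ler1n// -addn2 leq_addr.
- under eq_integral do rewrite EFinM.
  rewrite ge0_integralZl//=; last 3 first.
  - exact/measurable_EFinP.
  - by move=> x _; rewrite lee_fin.
  - by rewrite lee_fin (ltW (c0 _ e0)).
  rewrite /c EFinM muleAC.
  have -> : (((n%:R / e) ^+ n)%:E * \int[mu]_x (P (n%:R / e) x)%:E = I0)%E.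
    rewrite /I0 -(@ge0_integral_affine _ n (n%:R / e) 0 (fun x => (P 1 x)%:E)) ?gt_eqF//; last 2 first.
    - exact/measurable_EFinP.
    - by move=> x; rewrite lee_fin.
    rewrite gtr0_norm//; congr (_ * _)%E; apply: eq_integral => x _.
    by rewrite addr0 -Pscale.
  by rewrite I0E -EFinM mulfV// gt_eqF.
- move=> x ex; rewrite /P prodbump_support ?mulr0//.
  by rewrite mulrAC ltr_pdivlMr// ltr_pM2l.
- move=> x z.
  rewrite (_ : _ - _ = c e * (P (n%:R / e) (x + z) + P (n%:R / e) (x - z) - 2 * P (n%:R / e) x)); last by ring.
  rewrite normrM (gtr0_norm (c0 _ e0)) !(Pscale (n%:R / e)) scalerDr scalerBr.
  apply: (@le_trans _ _ (c e * (M * enorm ((n%:R / e) *: z) ^+ 2))).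
    by rewrite ler_wpM2l ?(ltW (c0 _ e0))//; exact: HM2.
  rewrite enormZ (gtr0_norm ne0) /c /A le_eqVlt; apply/orP; left; apply/eqP.
  rewrite -[n.+2]addn2 !exprD !exprMn !exprVn !invfM; ring.
Qed.

(** * The fractional Laplacian as a singular integral *)

Lemma integral_reflect {R : realType} n (a : 'rV[R]_n) (f : 'rV[R]_n -> \bar R) :
  measurable_fun setT f ->
  (\int[borel_lebesgue_rV n]_x f (a - x)%R = \int[borel_lebesgue_rV n]_x f x)%E.
Proof.
move=> mf; rewrite [LHS]integralE [RHS]integralE; congr (_ - _)%E.
- have := @ge0_integral_reflect R n a (f^\+)%E (measurable_funepos mf) (funepos_ge0 f).
  by rewrite unlock.
- have := @ge0_integral_reflect R n a (f^\-)%E (measurable_funeneg mf) (funeneg_ge0 f).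
  by rewrite unlock.
Qed.

Section singular_integral.
Context {R : realType} (n : nat) (s : R).
Hypotheses (n_gt0 : (0 < n)%N) (s_gt0 : 0 < s) (s_lt1 : s < 1).
Notation mu := (@borel_lebesgue_rV R n).
Notation k := (fine (@kappa R n)).
Notation J := (truncated_kernel s).

(** The quadratic bound makes the singularity integrable as 2 - 2s > 0, and the growth q < 2s makes
    the tail integrable. The case q = 0 covers bounded g; q = s is the growth of the barrier in the
    annulus estimate. *)
Lemma le_integral_singular (g : 'rV[R]_n -> R) (a b q r : R) :
  measurable_fun setT g -> 0 <= a -> 0 <= b -> q < 2 * s -> 0 < r ->
  (forall z, enorm z <= r -> `|g z| <= a * enorm z ^+ 2) ->
  (forall z, r < enorm z -> `|g z| <= b * enorm z `^ q) ->
  mu.-integrable setT (fun z => (g z * J 0 z)%:E) /\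
  `|\int[mu]_z (g z * J 0 z)| <=
    k * (a * (r `^ (2 - 2 * s) / (2 - 2 * s)) + b * (r `^ (- (2 * s - q)) / (2 * s - q))).
Proof.
move=> mg a0 b0 qs r0 ga gb.
have s2 : 0 < 2 - 2 * s by rewrite -{1}(mulr1 2) -mulrBr mulr_gt0 ?subr_gt0.
have sq : 0 < 2 * s - q by rewrite subr_gt0.
pose H1 (z : 'rV[R]_n) : R := if 0 < enorm z <= r then enorm z `^ ((2 - 2 * s) - n%:R) else 0.
pose H2 (z : 'rV[R]_n) : R := if r < enorm z then enorm z `^ (- (n%:R + (2 * s - q))) else 0.
have H10 z : 0 <= H1 z by rewrite /H1; case: ifP => // _; exact: powR_ge0.
have H20 z : 0 <= H2 z by rewrite /H2; case: ifP => // _; exact: powR_ge0.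
have mH1 : measurable_fun setT H1.
  apply: measurable_fun_ifT => //; last exact: (measurableT_comp (measurable_powR _) measurable_enorm).
  apply: measurable_and.
    by apply: measurable_fun_ltr => //; exact: measurable_enorm.
  by apply: measurable_fun_ler => //; exact: measurable_enorm.
have mH2 : measurable_fun setT H2.
  apply: measurable_fun_ifT => //; last exact: (measurableT_comp (measurable_powR _) measurable_enorm).
  by apply: measurable_fun_ltr => //; exact: measurable_enorm.
have IH1 : (\int[mu]_z (H1 z)%:E = (k * (r `^ (2 - 2 * s) / (2 - 2 * s)))%:E)%E.
  by rewrite integral_enorm_le// kappaE.
have IH2 : (\int[mu]_z (H2 z)%:E = (k * (r `^ (- (2 * s - q)) / (2 * s - q)))%:E)%E.
  by rewrite integral_enorm_gt// kappaE.
pose H z := a * H1 z + b * H2 z.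
have mH : measurable_fun setT H.
  by apply: measurable_funD; apply: measurable_funM.
have H0 z : 0 <= H z by rewrite addr_ge0// mulr_ge0.
have IH : (\int[mu]_z (H z)%:E = (k * (a * (r `^ (2 - 2 * s) / (2 - 2 * s)) + b * (r `^ (- (2 * s - q)) / (2 * s - q))))%:E)%E.
  under eq_integral do rewrite EFinD.
  rewrite ge0_integralD//; last 4 first.
  - by move=> z _; rewrite lee_fin mulr_ge0.
  - by apply/measurable_EFinP; apply: measurable_funM.
  - by move=> z _; rewrite lee_fin mulr_ge0.
  - by apply/measurable_EFinP; apply: measurable_funM.
  under eq_integral do rewrite EFinM.
  rewrite ge0_integralZl//; last 2 first.
  - exact/measurable_EFinP.
  - by move=> z _; rewrite lee_fin.
  under [X in (_ + X)%E]eq_integral do rewrite EFinM.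
  rewrite ge0_integralZl//; last 2 first.
  - exact/measurable_EFinP.
  - by move=> z _; rewrite lee_fin.
  by rewrite IH1 IH2 -!EFinM -EFinD; congr EFin; ring.
have gJ z : `|g z * J 0 z| <= H z.
  rewrite normrM (ger0_norm (truncated_kernel_ge0 _ _ _)) /truncated_kernel.
  have [z0|z0] := ltP 0 (enorm z); last by rewrite mulr0.
  rewrite /H /H1 /H2 z0/=; have [zr|zr] := leP (enorm z) r.
    rewrite mulr0 addr0; apply: (le_trans (ler_wpM2r (powR_ge0 _ _) (ga z zr))).
    rewrite -mulrA -powR_mulrn// -powRD; last by rewrite (gt_eqF z0) implybT.
    by rewrite (_ : 2 - _ - _ = 2 - (n%:R + 2 * s))//; ring.
  rewrite mulr0 add0r; apply: (le_trans (ler_wpM2r (powR_ge0 _ _) (gb z zr))).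
  rewrite -mulrA -powRD; last by rewrite (gt_eqF z0) implybT.
  by rewrite (_ : q + _ = - (n%:R + (2 * s - q)))//; ring.
have mgJ : measurable_fun setT (fun z : 'rV[R]_n => g z * J 0 z).
  by apply: measurable_funM => //; exact: measurable_truncated_kernel.
have iH : mu.-integrable setT (EFin \o H).
  apply/integrableP; split; first exact/measurable_EFinP.
  under eq_integral => z _ do rewrite /= ger0_norm//.
  by rewrite IH ltry.
have igJ : mu.-integrable setT (fun z => (g z * J 0 z)%:E).
  apply: (@le_integrable _ _ _ mu setT measurableT _ (EFin \o H)) => //.
    exact/measurable_EFinP.
  by move=> z _; rewrite /= lee_fin (ger0_norm (H0 z)).
split=> //; apply: (le_trans (le_normr_Rintegral measurableT igJ)).
rewrite [leRHS](_ : _ = \int[mu]_z H z); last by rewrite /Rintegral IH.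
apply: le_Rintegral => //; exact: integrable_norm.
Qed.

(** The difference is the integral of g cut off to |z| <= d, to which the previous bound applies
    with tail constant 0. *)
Lemma integral_singular_truncated (g : 'rV[R]_n -> R) (a b d : R) :
  measurable_fun setT g -> 0 <= a -> 0 < d ->
  (forall z, `|g z| <= a * enorm z ^+ 2) -> (forall z, `|g z| <= b) ->
  `|\int[mu]_z (g z * J 0 z) - \int[mu]_z (g z * J d z)| <=
    k * a * (d `^ (2 - 2 * s) / (2 - 2 * s)).
Proof.
move=> mg a0 d0 ga gb; have b0 : 0 <= b by apply: le_trans (gb 0).
have s20 : 0 < 2 * s by rewrite mulr_gt0.
have gb' z : d < enorm z -> `|g z| <= b * enorm z `^ 0 by move=> _; rewrite powRr0 mulr1.
have [i0 _] := le_integral_singular mg a0 b0 s20 d0 (fun z _ => ga z) gb'.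
pose h (z : 'rV[R]_n) : R := if enorm z <= d then g z else 0.
have mh : measurable_fun setT h.
  apply: measurable_fun_ifT => //.
  by apply: measurable_fun_ler => //; exact: measurable_enorm.
have ha z : enorm z <= d -> `|h z| <= a * enorm z ^+ 2 by rewrite /h => ->.
have hb z : d < enorm z -> `|h z| <= 0 * enorm z `^ 0.
  by rewrite /h ltNge => /negbTE ->; rewrite normr0 mul0r.
have [ih hle] := le_integral_singular mh a0 (lexx 0) s20 d0 ha hb.
have id : mu.-integrable setT (fun z => (g z * J d z)%:E).
  rewrite (_ : (fun z => _) = (fun z => (g z * J 0 z)%:E - (h z * J 0 z)%:E)%E).
    exact: integrableB.
  apply/funext => z; rewrite -EFinB -mulrBl /h /truncated_kernel.
  have [zd|zd] := leP (enorm z) d; first by rewrite subrr mulr0 mul0r.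
  by rewrite (lt_trans d0 zd) subr0.
rewrite -RintegralB// (_ : \int[mu]_z _ = \int[mu]_z (h z * J 0 z)); last first.
  apply: eq_Rintegral => z _; rewrite -mulrBr /h /truncated_kernel.
  have [zd|zd] := leP (enorm z) d; first by rewrite subr0.
  by rewrite (lt_trans d0 zd) subrr mulr0 mul0r.
by rewrite (le_trans hle)// mul0r addr0 mulrA.
Qed.
End singular_integral.

Lemma Rintegral_reflect {R : realType} n (a : 'rV[R]_n) (f : 'rV[R]_n -> R) :
  measurable_fun setT f ->
  \int[borel_lebesgue_rV n]_x f (a - x) = \int[borel_lebesgue_rV n]_x f x.
Proof.
move=> mf; have mf' : measurable_fun setT (EFin \o f) by exact/measurable_EFinP.
exact: (f_equal fine (integral_reflect a mf')).
Qed.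

Section fracLaplacian_singular.
Context {R : realType} (n : nat) (s : R).
Hypotheses (n_gt0 : (0 < n)%N) (s_gt0 : 0 < s) (s_lt1 : s < 1).
Notation mu := (@borel_lebesgue_rV R n).
Notation k := (fine (@kappa R n)).
Notation J := (truncated_kernel s).

Definition diff2 (psi : 'rV[R]_n -> R) (x z : 'rV[R]_n) : R :=
  2 * psi x - psi (x + z) - psi (x - z).

(** The principal value after averaging over z and -z: the second difference makes the integral
    absolutely convergent. The normalising constant C is left out. *)
Definition singular_laplacian (psi : 'rV[R]_n -> R) (x : 'rV[R]_n) : R :=
  2^-1 * \int[mu]_z (diff2 psi x z * J 0 z).

Lemma integrable_truncated_kernel (d : R) : 0 < d ->
  mu.-integrable setT (EFin \o (J d : 'rV[R]_n -> R)).
Proof.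
move=> d0; apply/integrableP; split.
  by apply/measurable_EFinP; exact: measurable_truncated_kernel.
under eq_integral => z _ do rewrite /= ger0_norm ?truncated_kernel_ge0//.
by rewrite integral_truncated_kernel// kappaE ltry.
Qed.

Lemma measurable_rV_sub (x : 'rV[R]_n) : measurable_fun setT (fun y : 'rV[R]_n => x - y).
Proof.
have := measurable_rV_affine (-1) x.
by under eq_fun do rewrite scaleN1r addrC.
Qed.

Lemma measurable_rV_add (x : 'rV[R]_n) : measurable_fun setT (fun y : 'rV[R]_n => x + y).
Proof.
have := measurable_rV_affine 1 x.
by under eq_fun do rewrite scale1r addrC.
Qed.

Lemma measurable_truncated_kernel_sub d (x : 'rV[R]_n) :
  measurable_fun setT (fun y : 'rV[R]_n => J d (x - y)).
Proof. exact: (measurableT_comp (@measurable_truncated_kernel R n s d) (measurable_rV_sub x)). Qed.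

Variable psi : 'rV[R]_n -> R.
Hypothesis mpsi : measurable_fun setT psi.

Lemma measurable_diff2 x : measurable_fun setT (diff2 psi x).
Proof.
apply: measurable_funB; last exact: (measurableT_comp mpsi (measurable_rV_sub x)).
apply: measurable_funB => //; exact: (measurableT_comp mpsi (measurable_rV_add x)).
Qed.

Variable N : R.
Hypothesis psiN : forall x, `|psi x| <= N.

(** Away from the origin the kernel is integrable, so the integral may be split, and evenness of the
    kernel makes the contributions of x + z and x - z equal. *)
Lemma truncated_laplacianE (d : R) (x : 'rV[R]_n) : 0 < d ->
  \int[mu]_y ((psi x - psi y) * J d (x - y)) = 2^-1 * \int[mu]_z (diff2 psi x z * J d z).
Proof.
move=> d0; have iJ := integrable_truncated_kernel d0.
have m1 : measurable_fun setT (fun z : 'rV[R]_n => psi x - psi (x + z)).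
  by apply: measurable_funB => //; exact: (measurableT_comp mpsi (measurable_rV_add x)).
have m2 : measurable_fun setT (fun z : 'rV[R]_n => psi x - psi (x - z)).
  by apply: measurable_funB => //; exact: (measurableT_comp mpsi (measurable_rV_sub x)).
have b1 y : `|psi x - psi (x + y)| <= N + N by rewrite (le_trans (ler_normB _ _))// lerD.
have b2 y : `|psi x - psi (x - y)| <= N + N by rewrite (le_trans (ler_normB _ _))// lerD.
have i1 := integrable_bounded_mul iJ m1 b1.
have i2 := integrable_bounded_mul iJ m2 b2.
have e1 : \int[mu]_y ((psi x - psi y) * J d (x - y)) = \int[mu]_z ((psi x - psi (x - z)) * J d z).
  rewrite -(Rintegral_reflect x); last first.
    apply: measurable_funM; first exact: measurable_funB.
    exact: measurable_truncated_kernel_sub.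
  by apply: eq_Rintegral => z _; rewrite (_ : x - (x - z) = z)// opprB addrC subrK.
have e2 : \int[mu]_z ((psi x - psi (x - z)) * J d z) = \int[mu]_z ((psi x - psi (x + z)) * J d z).
  rewrite -(Rintegral_reflect 0); last first.
    exact: (measurable_funM m2 (@measurable_truncated_kernel R n s d)).
  by apply: eq_Rintegral => z _; rewrite sub0r truncated_kernelN opprK.
have -> : \int[mu]_z (diff2 psi x z * J d z) =
    \int[mu]_z ((psi x - psi (x + z)) * J d z) + \int[mu]_z ((psi x - psi (x - z)) * J d z).
  rewrite -(RintegralD measurableT i1 i2); apply: eq_Rintegral => z _.
  by rewrite /diff2 -mulrDl; congr (_ * _); clear; ring.
rewrite e1 e2; move: (\int[mu]_z _) => I; by field.
Qed.

Variable a : R.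
Hypothesis a0 : 0 <= a.
Hypothesis psi2 : forall x z, `|diff2 psi x z| <= a * enorm z ^+ 2.

Lemma diff2_bounded x z : `|diff2 psi x z| <= 4 * N.
Proof.
rewrite /diff2 (le_trans (ler_normB _ _))//.
have := ler_normB (2 * psi x) (psi (x + z)).
have := psiN x; have := psiN (x + z); have := psiN (x - z).
by rewrite normrM ger0_norm//; lra.
Qed.

Lemma truncated_laplacian_dist (d : R) (x : 'rV[R]_n) : 0 < d ->
  `|singular_laplacian psi x - \int[mu]_y ((psi x - psi y) * J d (x - y))| <=
    k * a * (d `^ (2 - 2 * s) / (2 - 2 * s)).
Proof.
move=> d0; rewrite truncated_laplacianE// -mulrBr normrM ger0_norm//.
have h := @integral_singular_truncated R n s s_gt0 s_lt1 _ a (4 * N) d (measurable_diff2 x) a0 d0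
  (psi2 x) (diff2_bounded x).
by apply: le_trans h; rewrite ler_piMl// invf_le1// ler1n.
Qed.

Lemma lebesgue_truncated_laplacian (d : R) (x : 'rV[R]_n) : 0 < d ->
  \int[lebesgue_rV R n]_(y in [set y : 'rV[R]_n | d < enorm (x - y)])
    ((psi x - psi y) / enorm (x - y) `^ (n%:R + 2 * s)) =
  \int[mu]_y ((psi x - psi y) * J d (x - y)).
Proof.
move=> d0; rewrite /Rintegral integral_mkcond; congr fine.
rewrite -integral_lebesgue_rVE; last first.
  apply/measurable_EFinP; apply: measurable_funM; first exact: measurable_funB.
  exact: measurable_truncated_kernel_sub.
apply: eq_integral => y _; rewrite patchE /truncated_kernel.
have [h|h] := boolP (d < enorm (x - y)).
  by rewrite mem_set// powRN.
by rewrite memNset ?mulr0//=; exact/negP.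
Qed.

Lemma fracLaplacianE (C : R) x : fracLaplacian C s psi x = C * singular_laplacian psi x.
Proof.
rewrite /fracLaplacian; congr (C * _); apply: cvg_lim => //.
have s2 : 0 < 2 - 2 * s by rewrite -{1}(mulr1 2) -mulrBr mulr_gt0 ?subr_gt0.
apply/cvgrPdist_le => e e0.
pose c := k * a / (2 - 2 * s).
have k0 : 0 <= k by rewrite fine_ge0// kappa_ge0.
have c0 : 0 <= c by rewrite divr_ge0 ?(ltW s2)// mulr_ge0.
(* Chosen so that c d^(2-2s) <= e for d <= d0; c + 1 avoids a division by 0. *)
pose d0 := (e / (c + 1)) `^ (2 - 2 * s)^-1.
have ec : 0 < e / (c + 1) by rewrite divr_gt0// ltr_wpDl.
have d00 : 0 < d0 by rewrite powR_gt0.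
near=> d.
have d_gt0 : 0 < d by near: d; exact: nbhs_right_gt.
have dd0 : d <= d0 by near: d; exact: nbhs_right_le.
rewrite lebesgue_truncated_laplacian//; apply: (le_trans (truncated_laplacian_dist x d_gt0)).
have : d `^ (2 - 2 * s) <= e / (c + 1).
  have := ge0_ler_powR (ltW s2) _ _ dd0; rewrite !nnegrE => h.
  apply: (le_trans (h (ltW d_gt0) (ltW d00))).
  by rewrite /d0 -powRrM mulVf ?powRr1 ?(ltW ec)// (gt_eqF s2).
rewrite ler_pdivlMr ?ltr_wpDl// => h.
rewrite (_ : k * a * _ = d `^ (2 - 2 * s) * c); last by rewrite /c; ring.
by apply: le_trans h; rewrite ler_wpM2l ?powR_ge0// lerDl.
Unshelve. all: by end_near.
Qed.
End fracLaplacian_singular.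

Section singular_laplacian_theory.
Context {R : realType} (n : nat) (s : R).
Hypotheses (n_gt0 : (0 < n)%N) (s_gt0 : 0 < s) (s_lt1 : s < 1).
Notation mu := (@borel_lebesgue_rV R n).
Notation k := (fine (@kappa R n)).
Notation J := (truncated_kernel s).

Lemma measurable_rV_affine2 (c : R) :
  measurable_fun setT (fun p : 'rV[R]_n * 'rV[R]_n => p.1 + c *: p.2).
Proof.
apply: measurable_fun_rV => i.
rewrite (_ : (fun t => _) = (fun t : 'rV[R]_n * 'rV[R]_n => t.1 ord0 i + c * t.2 ord0 i)); last first.
  by apply/funext => t; rewrite !mxE.
apply: measurable_funD; first exact: (measurableT_comp (measurable_coord i) measurable_fst).
apply: measurable_funM => //; exact: (measurableT_comp (measurable_coord i) measurable_snd).
Qed.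

Variable psi : 'rV[R]_n -> R.
Hypothesis mpsi : measurable_fun setT psi.

Lemma measurable_singular_laplacian : measurable_fun setT (singular_laplacian s psi).
Proof.
pose F (p : 'rV[R]_n * 'rV[R]_n) : \bar R := (diff2 psi p.1 p.2 * J 0 p.2)%:E.
have mF : measurable_fun setT F.
  apply/measurable_EFinP; apply: measurable_funM; last first.
    exact: (measurableT_comp (@measurable_truncated_kernel R n s 0) measurable_snd).
  have m c := measurableT_comp mpsi (measurable_rV_affine2 c).
  have m0 : measurable_fun setT (fun p : 'rV[R]_n * 'rV[R]_n => psi p.1).
    exact: (measurableT_comp mpsi measurable_fst).
  have m1 : measurable_fun setT (fun p : 'rV[R]_n * 'rV[R]_n => psi (p.1 + p.2)).
    by have := m 1; rewrite (_ : _ \o _ = fun p => psi (p.1 + p.2))//; apply/funext => p /=; rewrite scale1r.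
  have m2 : measurable_fun setT (fun p : 'rV[R]_n * 'rV[R]_n => psi (p.1 - p.2)).
    by have := m (-1); rewrite (_ : _ \o _ = fun p => psi (p.1 - p.2))//; apply/funext => p /=; rewrite scaleN1r.
  by apply: measurable_funB => //; apply: measurable_funB => //; exact: measurable_funM.
apply: measurable_funM => //.
apply: (measurableT_comp (fine_measurable measurableT)).
(* Measurability of partial integrals is available for nonnegative integrands, hence the split into
   positive and negative parts. *)
rewrite (_ : (fun x => _) = fun x => (fubini_F mu (F^\+)%E x - fubini_F mu (F^\-)%E x)%E); last first.
  by apply/funext => x; rewrite integralE /fubini_F !unlock.
apply: emeasurable_funB.
- exact: (measurable_fun_fubini_tonelli_F _ (measurable_funepos mF) (funepos_ge0 F)).
- exact: (measurable_fun_fubini_tonelli_F _ (measurable_funeneg mF) (funeneg_ge0 F)).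
Qed.

Hypothesis psi0 : forall x, 0 <= psi x.

Lemma singular_laplacian_zeroE x : psi x = 0 ->
  singular_laplacian s psi x =
  - (2^-1 * \int[mu]_z ((psi (x + z) + psi (x - z)) * J 0 z)).
Proof.
move=> px; rewrite /singular_laplacian -mulrN /Rintegral -fineN -integral_ge0N//; last first.
  by move=> z _; rewrite lee_fin mulr_ge0 ?addr_ge0// truncated_kernel_ge0.
congr (_ * fine _); apply: eq_integral => z _.
by rewrite -EFinN -mulNr /diff2 px; congr (_ * _)%:E; ring.
Qed.

Lemma singular_laplacian_le0 x : psi x = 0 -> singular_laplacian s psi x <= 0.
Proof.
move=> px; rewrite singular_laplacian_zeroE// oppr_le0 mulr_ge0//.
by apply: Rintegral_ge0 => // z _; rewrite mulr_ge0 ?addr_ge0// truncated_kernel_ge0.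
Qed.

Hypothesis supp : forall x, 1 <= enorm x -> psi x = 0.

(** Where psi does not vanish the distance to x is at least |x| - 1 >= |x| / 2, so the kernel can be
    pulled out of the integral. *)
Lemma singular_laplacian_far (I : R) x : (\int[mu]_z (psi z)%:E = I%:E)%E -> 2 <= enorm x ->
  `|singular_laplacian s psi x| <= (enorm x / 2) `^ (- (n%:R + 2 * s)) * I.
Proof.
move=> hI x2; have x1 : 1 <= enorm x by apply: le_trans x2; rewrite ler1n.
have xp : 0 < enorm x by apply: lt_le_trans x1.
set c := (_ `^ _); have c0 : 0 <= c by exact: powR_ge0.
have J0 z : 0 <= J 0 (z : 'rV[R]_n) by exact: truncated_kernel_ge0.
have h z : enorm x / 2 <= enorm z -> J 0 (z : 'rV[R]_n) <= c.
  move=> xz; rewrite /truncated_kernel (lt_le_trans _ xz) ?divr_gt0// /c !powRN.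
  rewrite lef_pV2 ?posrE ?powR_gt0 ?divr_gt0 ?(lt_le_trans _ xz) ?divr_gt0//.
  apply: ge0_ler_powR => //; rewrite ?nnegrE ?divr_ge0//.
  by rewrite addr_ge0// mulr_ge0// ltW.
have hp y z : `|enorm x - enorm y| <= enorm z -> psi y * J 0 (z : 'rV[R]_n) <= c * psi y.
  move=> xyz; have [y1|y1] := leP 1 (enorm y); first by rewrite supp// mul0r mulr0.
  rewrite mulrC ler_wpM2r//; apply: h; apply: le_trans xyz; apply: le_trans (ler_norm _).
  by lra.
rewrite singular_laplacian_zeroE; last exact: supp.
rewrite normrN ger0_norm; last first.
  by rewrite mulr_ge0//; apply: Rintegral_ge0 => // z _; rewrite mulr_ge0 ?addr_ge0.
have m1 := measurableT_comp mpsi (measurable_rV_add x).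
have m2 := measurableT_comp mpsi (measurable_rV_sub x).
have mJ := @measurable_truncated_kernel R n s 0.
rewrite -ler_pdivlMl ?invr_gt0// invrK mulrCA.
rewrite -lee_fin /Rintegral.
have i1 : (\int[mu]_z (psi (x + z))%:E = I%:E)%E.
  rewrite -hI -(@ge0_integral_shift R n x (EFin \o psi)).
  - by apply: eq_integral => z _; rewrite /= addrC.
  - exact/measurable_EFinP.
  - by move=> z; rewrite lee_fin.
have i2 : (\int[mu]_z (psi (x - z))%:E = I%:E)%E.
  rewrite -hI -(@ge0_integral_reflect R n x (EFin \o psi))//.
  exact/measurable_EFinP.
have le : (\int[mu]_z ((psi (x + z) + psi (x - z)) * J 0 z)%:E <= (c * (2 * I))%:E)%E.
  apply: (@le_trans _ _ (\int[mu]_z (c%:E * ((psi (x + z))%:E + (psi (x - z))%:E)))%E).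
    apply: ge0_le_integral => //.
    - by move=> z _; rewrite lee_fin mulr_ge0 ?addr_ge0.
    - by apply/measurable_EFinP; apply: measurable_funM => //; exact: measurable_funD.
    - apply: emeasurable_funM => //; apply: emeasurable_funD; exact/measurable_EFinP.
    - move=> z _; rewrite -EFinD -EFinM lee_fin mulrDl mulrDr lerD//; apply: hp.
        by rewrite (le_trans (ler_dist_enorm _ _))// opprD addrA subrr add0r enormN.
      by rewrite (le_trans (ler_dist_enorm _ _))// opprB addrC subrK.
  rewrite ge0_integralZl//; last 2 first.
  - apply: emeasurable_funD; exact/measurable_EFinP.
  - by move=> z _; rewrite -EFinD lee_fin addr_ge0.
  rewrite ge0_integralD//; last 4 first.
  - by move=> z _; rewrite lee_fin.
  - exact/measurable_EFinP.
  - by move=> z _; rewrite lee_fin.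
  - exact/measurable_EFinP.
  by rewrite i1 i2 -EFinD -EFinM mulr2n mulrDl mul1r.
have ge : (0 <= \int[mu]_z ((psi (x + z) + psi (x - z)) * J 0 z)%:E)%E.
  by apply: integral_ge0 => z _; rewrite lee_fin mulr_ge0 ?addr_ge0.
rewrite fineK; first by rewrite [X in (_ <= X)%E](_ : _ = (c * (2 * I))%:E).
by rewrite ge0_fin_numE// (le_lt_trans le)// ltry.
Qed.

Variables (a N : R).
Hypotheses (a0 : 0 <= a) (psiN : forall x, psi x <= N).
Hypothesis psi2 : forall x z, `|diff2 psi x z| <= a * enorm z ^+ 2.

(** The decay matches the weight of [calL], which is what makes u times this function integrable. *)
Lemma singular_laplacian_decay : mu.-integrable setT (EFin \o psi) ->
  exists Q : R, forall x, `|singular_laplacian s psi x| <= Q / (1 + enorm x `^ (n%:R + 2 * s)).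
Proof.
move=> ipsi; have hI : (\int[mu]_z (psi z)%:E = (\int[mu]_z psi z)%:E)%E.
  by rewrite /Rintegral fineK//; apply: integrable_fin_num.
set I := \int[mu]_z psi z in hI.
have I0 : 0 <= I by exact: Rintegral_ge0.
pose q := n%:R + 2 * s; have q0 : 0 <= q by rewrite addr_ge0// mulr_ge0// ltW.
have psiNn x : `|psi x| <= N by rewrite ger0_norm.
have s20 : 0 < 2 * s by rewrite mulr_gt0.
have N0 : 0 <= N by apply: le_trans (psiN 0).
have N40 : 0 <= 4 * N by rewrite mulr_ge0.
have far x z : 1 < enorm z -> `|diff2 psi x z| <= 4 * N * enorm z `^ 0.
  by move=> _; rewrite powRr0 mulr1; exact: diff2_bounded.
have near x := (le_integral_singular s_lt1 (measurable_diff2 mpsi x) a0 N40 s20 ltr01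
  (fun z _ => psi2 x z) (far x)).2.
set Q1 := (k * _) in near.
have Q10 : 0 <= Q1 by apply: le_trans (near 0).
(* The first term serves |x| < 2, where the weight is at most 1 + 2^q. The second serves |x| >= 2,
   with 2 bounding |x|^-q + 1. *)
exists (Q1 * (1 + 2 `^ q) + 2 * (2 `^ q * I)) => x.
have E0 : 0 <= enorm x `^ q by exact: powR_ge0.
have tq : 0 <= 2 `^ q :> R by exact: powR_ge0.
rewrite ler_pdivlMr ?ltr_pwDl//.
have [x2|x2] := leP 2 (enorm x).
  have xp : 0 < enorm x by apply: lt_le_trans x2.
  have h := singular_laplacian_far hI x2.
  have Ex1 : 1 <= enorm x `^ q.
    by rewrite -(powRr0 (enorm x)) ler_powR// (le_trans _ x2)// ler1n.
  have Ep : 0 < enorm x `^ q by apply: lt_le_trans Ex1.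
  apply: (le_trans (ler_wpM2r _ h)); first by rewrite addr_ge0.
  rewrite powRM ?invr_ge0// -/q.
  rewrite (_ : 2^-1 `^ (- q) = 2 `^ q); last by rewrite -powR_inv1// -powRrM mulN1r opprK.
  rewrite powRN; apply: (@le_trans _ _ (2 * (2 `^ q * I))); last by rewrite lerDr mulr_ge0// addr_ge0.
  rewrite (_ : _ * (1 + _) = ((enorm x `^ q)^-1 + 1) * (2 `^ q * I)); last first.
    by field; rewrite (gt_eqF Ep).
  rewrite ler_wpM2r ?mulr_ge0// -[leRHS]/(1 + 1) lerD2r invf_le1//.
apply: (@le_trans _ _ (Q1 * (1 + 2 `^ q))); last by rewrite lerDl !mulr_ge0.
apply: ler_pM => //; first by rewrite addr_ge0.
  rewrite /singular_laplacian normrM ger0_norm//; apply: le_trans (near x).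
  by rewrite ler_piMl// invf_le1// ler1n.
by rewrite lerD2l; apply: ge0_ler_powR => //; rewrite ?nnegrE// ltW.
Qed.

End singular_laplacian_theory.

(** * Mollification of the truncated equation *)

Section mollification.
Context {R : realType} (n : nat).
Notation mu := (@borel_lebesgue_rV R n).
Variables (rho : 'rV[R]_n -> R) (e A2 : R).
Hypotheses (mrho : measurable_fun setT rho) (rho0 : forall x, 0 <= rho x)
  (int_rho : (\int[mu]_x (rho x)%:E = 1)%E)
  (rho_supp : forall x, e < enorm x -> rho x = 0) (e_gt0 : 0 < e) (A20 : 0 <= A2)
  (rho2 : forall x z, `|rho (x + z) + rho (x - z) - 2 * rho x| <= A2 * enorm z ^+ 2).

Definition mollify (phi : 'rV[R]_n -> R) (x : 'rV[R]_n) : R := \int[mu]_y (rho (x - y) * phi y).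

Lemma measurable_rho_sub x : measurable_fun setT (fun y : 'rV[R]_n => rho (x - y)).
Proof. exact: (measurableT_comp mrho (measurable_rV_sub x)). Qed.

Lemma integral_rho_sub x : (\int[mu]_y (rho (x - y))%:E = 1)%E.
Proof.
rewrite -int_rho; apply: (@ge0_integral_reflect R n x (EFin \o rho)); first exact/measurable_EFinP.
by move=> z; rewrite lee_fin.
Qed.

Lemma integrable_rho_sub x : mu.-integrable setT (fun y => (rho (x - y))%:E).
Proof.
apply/integrableP; split; first by apply/measurable_EFinP; exact: measurable_rho_sub.
under eq_integral => z _ do rewrite /= ger0_norm//.
by rewrite integral_rho_sub ltry.
Qed.

Section bounded.
Variables (phi : 'rV[R]_n -> R) (N : R).
Hypotheses (mphi : measurable_fun setT phi) (phi0 : forall x, 0 <= phi x)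
  (phiN : forall x, phi x <= N).

Lemma integrable_mollify x : mu.-integrable setT (fun y => (rho (x - y) * phi y)%:E).
Proof.
have := integrable_bounded_mul (integrable_rho_sub x) mphi (W := N).
under eq_fun do rewrite mulrC; apply=> y; by rewrite ger0_norm.
Qed.

Lemma mollifyE x : (mollify phi x)%:E = (\int[mu]_y (rho (x - y) * phi y)%:E)%E.
Proof.
by rewrite /mollify /Rintegral fineK//; apply: integrable_fin_num => //; exact: integrable_mollify.
Qed.

Lemma measurable_mollify : measurable_fun setT (mollify phi).
Proof.
pose F (p : 'rV[R]_n * 'rV[R]_n) : \bar R := (rho (p.1 - p.2) * phi p.2)%:E.
have mF : measurable_fun setT F.
  apply/measurable_EFinP; apply: measurable_funM; last exact: (measurableT_comp mphi measurable_snd).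
  have := measurableT_comp mrho (@measurable_rV_affine2 R n (-1)).
  by rewrite (_ : _ \o _ = fun p => rho (p.1 - p.2))//; apply/funext => p /=; rewrite scaleN1r.
apply: (measurableT_comp (fine_measurable measurableT)).
apply: (measurable_fun_fubini_tonelli_F F mF) => p.
by rewrite lee_fin mulr_ge0.
Qed.

Lemma mollify_ge0 x : 0 <= mollify phi x.
Proof. by apply: Rintegral_ge0 => // y _; rewrite mulr_ge0. Qed.

Lemma mollify_le x c : (forall y, enorm (x - y) <= e -> phi y <= c) -> mollify phi x <= c.
Proof.
move=> hc; rewrite -lee_fin mollifyE -[leRHS]mule1 -(integral_rho_sub x).
have c0 : 0 <= c by apply: le_trans (phi0 x) (hc x _); rewrite subrr enorm0 ltW.
rewrite -ge0_integralZl//; last 2 first.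
- by apply/measurable_EFinP; exact: measurable_rho_sub.
- by move=> y _; rewrite lee_fin.
apply: ge0_le_integral => //.
- by move=> y _; rewrite lee_fin mulr_ge0.
- by apply/measurable_EFinP; apply: measurable_funM => //; exact: measurable_rho_sub.
- by apply/measurable_EFinP; apply: measurable_funM => //; exact: measurable_rho_sub.
- move=> y _; rewrite -EFinM lee_fin mulrC.
  have [h|h] := leP (enorm (x - y)) e; first by rewrite ler_wpM2r// hc.
  by rewrite rho_supp// !mulr0.
Qed.

Lemma mollify_dist (L : R) x : 0 <= L -> (forall y, `|phi x - phi y| <= L * enorm (x - y)) ->
  `|mollify phi x - phi x| <= L * e.
Proof.
move=> L0 hL; have ix := integrable_mollify x.
have ic : mu.-integrable setT (fun y => (rho (x - y) * phi x)%:E).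
  have := integrableZl measurableT (phi x) (integrable_rho_sub x).
  by under eq_fun do rewrite -EFinM mulrC.
have -> : phi x = \int[mu]_y (rho (x - y) * phi x).
  under eq_Rintegral do rewrite mulrC.
  rewrite RintegralZl//; last exact: integrable_rho_sub.
  by rewrite /Rintegral integral_rho_sub mulr1.
rewrite /mollify -RintegralB//.
have ib := integrableB measurableT ix ic.
apply: (le_trans (le_normr_Rintegral measurableT _)); first exact: ib.
apply: (@le_trans _ _ (\int[mu]_y (L * e * rho (x - y)))).
  apply: le_Rintegral => //.
  - exact: (integrable_norm ib).
  - exact: (integrableZl measurableT (L * e) (integrable_rho_sub x)).
  - move=> y _; rewrite -mulrBr normrM ger0_norm// [leRHS]mulrC.
    have [h|h] := leP (enorm (x - y)) e; last by rewrite rho_supp// !mul0r.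
    by rewrite ler_wpM2l// distrC (le_trans (hL y))// ler_wpM2l.
rewrite RintegralZl//; last exact: integrable_rho_sub.
by rewrite /Rintegral integral_rho_sub mulr1.
Qed.

Hypothesis iphi : mu.-integrable setT (EFin \o phi).

Lemma diff2_mollifyE x z : diff2 (mollify phi) x z =
  \int[mu]_y (- (rho (x - y + z) + rho (x - y - z) - 2 * rho (x - y)) * phi y).
Proof.
have i0 := integrable_mollify x; have i1 := integrable_mollify (x + z).
have i2 := integrable_mollify (x - z).
rewrite /diff2 /mollify -(RintegralZl 2 measurableT i0).
have i0' := integrableZl measurableT 2 i0.
rewrite -(RintegralB measurableT i0' i1).
have i01 := integrableB measurableT i0' i1.
rewrite -(RintegralB measurableT i01 i2); apply: eq_Rintegral => y _.
by rewrite (addrAC x z) (addrAC x (- z)); ring.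
Qed.

Let w x z (y : 'rV[R]_n) := - (rho (x - y + z) + rho (x - y - z) - 2 * rho (x - y)).

Let mw x z : measurable_fun setT (w x z).
Proof.
rewrite (_ : w x z = fun y => - (rho (x + z - y) + rho (x - z - y) - 2 * rho (x - y))).
  apply: measurableT_comp => //; apply: measurable_funB.
    by apply: measurable_funD; exact: measurable_rho_sub.
  by apply: measurable_funM => //; exact: measurable_rho_sub.
by apply/funext => y; rewrite /w (addrAC x z) (addrAC x (- z)).
Qed.

Let wle x z y : `|w x z y| <= A2 * enorm z ^+ 2.
Proof. by rewrite normrN. Qed.

Lemma diff2_mollify_le x z :
  `|diff2 (mollify phi) x z| <= A2 * enorm z ^+ 2 * \int[mu]_y phi y.
Proof. by rewrite diff2_mollifyE; exact: (le_normr_Rintegral_mul phi0 iphi (mw x z) (wle x z)). Qed.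

(** The second difference falls on rho, and for |z| <= e only values of phi within 2 e of x are
    seen. Near the sphere c is of order e^s, which the global bound [diff2_mollify_le] would not
    exploit. *)
Lemma diff2_mollify_local x z c : enorm z <= e ->
  (forall y, enorm (x - y) <= 2 * e -> phi y <= c) ->
  `|diff2 (mollify phi) x z| <=
    A2 * enorm z ^+ 2 * (c * fine (mu [set x | enorm x <= 2 * e])).
Proof.
move=> ze hc; rewrite diff2_mollifyE.
have c0 : 0 <= c by apply: le_trans (phi0 x) (hc x _); rewrite subrr enorm0 mulr_ge0// ltW.
have mB := @measurable_cball R n (2 * e).
pose ind (y : 'rV[R]_n) : R := \1_[set x | enorm x <= 2 * e] (x - y).
have mind : measurable_fun setT ind.
  exact: (measurableT_comp (measurable_indic mB) (measurable_rV_sub x)).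
have ind0 y : 0 <= ind y by rewrite /ind indicE.
pose phi' y := ind y * phi y.
have phi'0 y : 0 <= phi' y by rewrite mulr_ge0.
have iphi' : mu.-integrable setT (EFin \o phi').
  apply: (integrable_bounded_mul (W := 1) iphi mind) => y.
  by rewrite ger0_norm// /ind indicE; case: (_ \in _).
have -> : \int[mu]_y (w x z y * phi y) = \int[mu]_y (w x z y * phi' y).
  apply: eq_Rintegral => y _; rewrite /phi' /ind indicE.
  have [h|h] := leP (enorm (x - y)) (2 * e); first by rewrite mem_set//= mul1r.
  rewrite memNset/= ?mul0r ?mulr0; last by apply/negP; rewrite -ltNge.
  have hz v : enorm v <= e -> e < enorm (x - y + v).
    by move=> ve; have := enormD (x - y + v) (- v); rewrite addrK enormN; lra.
  rewrite /w !rho_supp ?mulr0 ?addr0 ?subr0 ?oppr0 ?mul0r//.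
  - by move: h e_gt0; lra.
  - by apply: hz; rewrite enormN.
  - exact: hz.
apply: (le_trans (le_normr_Rintegral_mul phi'0 iphi' (mw x z) (wle x z))).
rewrite ler_wpM2l ?mulr_ge0 ?sqr_ge0//.
have fB : mu [set x | enorm x <= 2 * e] \is a fin_num.
  by rewrite ge0_fin_numE ?borel_ball_fin.
have hB : (\int[mu]_y (c * ind y)%:E = (c * fine (mu [set x | enorm x <= 2 * e])%R)%:E)%E.
  under eq_integral do rewrite EFinM.
  rewrite ge0_integralZl//; last 2 first.
  - exact/measurable_EFinP.
  - by move=> y _; rewrite lee_fin.
  rewrite (@ge0_integral_reflect R n x (fun y => (\1_[set x | enorm x <= 2 * e] y)%:E)).
  - by rewrite integral_indic// setIT EFinM fineK.
  - by apply/measurable_EFinP; exact: measurable_indic.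
  - by move=> y; rewrite lee_fin indicE.
rewrite -lee_fin -hB /Rintegral fineK; last by apply: integrable_fin_num.
apply: ge0_le_integral => //.
- by move=> y _; rewrite lee_fin.
- by apply/measurable_EFinP; exact: measurable_funM.
- by apply/measurable_EFinP; exact: measurable_funM.
- move=> y _; rewrite lee_fin /phi' /ind indicE.
  have [h|h] := leP (enorm (x - y)) (2 * e); first by rewrite mem_set//= mul1r mulr1 hc.
  by rewrite memNset/= ?mul0r ?mulr0//; apply/negP; rewrite -ltNge.
Qed.

End bounded.
End mollification.

Lemma measurable_comp_sub2 {R : realType} n (g : 'rV[R]_n -> R) : measurable_fun setT g ->
  measurable_fun setT (fun p : 'rV[R]_n * 'rV[R]_n => g (p.1 - p.2)).
Proof.
move=> mg; have := measurableT_comp mg (@measurable_rV_affine2 R n (-1)).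
rewrite (_ : _ \o _ = fun p => g (p.1 - p.2))//.
by apply/funext => p /=; rewrite scaleN1r.
Qed.

Section truncated_equation.
Context {R : realType} (n : nat) (s : R).
Hypotheses (n_gt0 : (0 < n)%N) (s_gt0 : 0 < s) (s_lt1 : s < 1).
Notation mu := (@borel_lebesgue_rV R n).
Notation k := (fine (@kappa R n)).
Notation J := (truncated_kernel s).
Variables (rho : 'rV[R]_n -> R) (e : R).
Hypotheses (mrho : measurable_fun setT rho) (rho0 : forall x, 0 <= rho x)
  (int_rho : (\int[mu]_x (rho x)%:E = 1)%E)
  (rho_supp : forall x, e < enorm x -> rho x = 0).
Variables (phi : 'rV[R]_n -> R) (N : R).
Hypotheses (mphi : measurable_fun setT phi) (phi0 : forall x, 0 <= phi x)
  (phiN : forall x, phi x <= N).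
Variables (f : 'rV[R]_n -> R) (Nf : R).
Hypotheses (mf : measurable_fun setT f) (f0 : forall x, 0 <= f x)
  (fN : forall x, f x <= Nf).
Notation psi := (mollify rho phi).
Let psiE := mollifyE mrho rho0 int_rho mphi phi0 phiN.
Let mpsi := measurable_mollify mrho rho0 mphi phi0.

Lemma ge0_integral_truncated_mollify d x :
  (\int[mu]_y (J d (x - y) * psi y)%:E =
   \int[mu]_w ((rho (x - w))%:E * \int[mu]_y (J d (w - y) * phi y)%:E))%E.
Proof.
have J0 z : 0 <= J d (z : 'rV[R]_n) by exact: truncated_kernel_ge0.
have mJ := @measurable_truncated_kernel R n s d.
rewrite integral_truncated_kernel_conv//; last exact: mollify_ge0.
pose F (p : 'rV[R]_n * 'rV[R]_n) : \bar R := (J d p.1 * (rho (x - p.2) * phi (p.2 + p.1)))%:E.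
have mF : measurable_fun setT F.
  apply/measurable_EFinP; apply: measurable_funM.
    exact: (measurableT_comp mJ measurable_fst).
  apply: measurable_funM.
    exact: (measurableT_comp (measurable_rho_sub mrho x) measurable_snd).
  have := measurableT_comp mphi (measurable_rV_affine2 1).
  by rewrite (_ : _ \o _ = fun p => phi (p.2 + p.1))//; apply/funext => p /=; rewrite scale1r addrC.
have F0 p : (0 <= F p)%E by rewrite lee_fin !mulr_ge0.
transitivity (\int[mu]_z \int[mu]_w F (z, w))%E.
  apply: eq_integral => z _; rewrite EFinM psiE.
  rewrite -ge0_integralZl//; last 3 first.
  - by apply/measurable_EFinP; apply: measurable_funM => //; exact: measurable_rho_sub.
  - by move=> y _; rewrite lee_fin mulr_ge0.
  - by rewrite lee_fin.
  rewrite -[LHS](@ge0_integral_shift R n z).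
  - by apply: eq_integral => w _; rewrite /F -EFinM (_ : x + z - (w + z) = x - w)//= (addrC w) addrKA.
  - apply: emeasurable_funM => //; apply/measurable_EFinP; apply: measurable_funM => //.
    exact: measurable_rho_sub.
  - by move=> w; rewrite -EFinM lee_fin !mulr_ge0.
rewrite (fubini_tonelli _ mF F0); apply: eq_integral => w _.
rewrite integral_truncated_kernel_conv// -ge0_integralZl//; last 3 first.
- apply/measurable_EFinP; apply: measurable_funM => //.
  exact: (measurableT_comp mphi (measurable_rV_add w)).
- by move=> z _; rewrite lee_fin mulr_ge0.
- by rewrite lee_fin.
by apply: eq_integral => z _; rewrite /F/= -EFinM mulrCA.
Qed.

(** M is the total mass of the kernel, so M psi - J * psi is the mollification of M phi - J * phi =
    f. The equation for phi is required only within e of x, where rho lives. *)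
Lemma truncated_laplacian_mollify (d : R) x : 0 < d ->
  (forall w, enorm (x - w) <= e ->
    ((k * (d `^ (- (2 * s)) / (2 * s)) * phi w)%:E = (f w)%:E + \int[mu]_y (J d (w - y) * phi y)%:E)%E) ->
  \int[mu]_y ((psi x - psi y) * J d (x - y)) = mollify rho f x.
Proof.
move=> d0 eqn; set M := k * _ in eqn.
have J0 z : 0 <= J d (z : 'rV[R]_n) by exact: truncated_kernel_ge0.
have mJx := @measurable_truncated_kernel_sub R n s d x.
have psi0 := mollify_ge0 rho0 phi0.
have IJ : (\int[mu]_y (J d (x - y))%:E = M%:E)%E.
  rewrite (@ge0_integral_reflect R n x (fun y => (J d y)%:E)).
  - by rewrite integral_truncated_kernel// kappaE -EFinM.
  - by apply/measurable_EFinP; exact: measurable_truncated_kernel.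
  - by move=> z; rewrite lee_fin.
have k0 : 0 <= k by rewrite fine_ge0// kappa_ge0.
have M0 : 0 <= M by rewrite !mulr_ge0 ?powR_ge0// invr_ge0 mulr_ge0// ltW.
have key : ((M * psi x)%:E = (mollify rho f x)%:E + \int[mu]_y (J d (x - y) * psi y)%:E)%E.
  rewrite ge0_integral_truncated_mollify (mollifyE mrho rho0 int_rho mf f0 fN).
  have mG : measurable_fun setT (fun w : 'rV[R]_n => \int[mu]_y (J d (w - y) * phi y)%:E)%E.
    apply: (measurable_fun_fubini_tonelli_F (fun p : 'rV[R]_n * 'rV[R]_n =>
      (J d (p.1 - p.2) * phi p.2)%:E)).
      apply/measurable_EFinP; apply: measurable_funM; last exact: (measurableT_comp mphi measurable_snd).
      exact: (measurable_comp_sub2 (@measurable_truncated_kernel R n s d)).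
    by move=> p; rewrite lee_fin mulr_ge0.
  have G0 w : (0 <= \int[mu]_y (J d (w - y) * phi y)%:E)%E.
    by apply: integral_ge0 => y _; rewrite lee_fin mulr_ge0.
  have mr := measurable_rho_sub mrho x.
  rewrite -ge0_integralD//; last 4 first.
  - by move=> w _; rewrite lee_fin mulr_ge0.
  - by apply/measurable_EFinP; exact: measurable_funM.
  - by move=> w _; rewrite mule_ge0// lee_fin.
  - by apply: emeasurable_funM => //; exact/measurable_EFinP.
  rewrite EFinM psiE -ge0_integralZl//; last 2 first.
  - by apply/measurable_EFinP; exact: measurable_funM.
  - by move=> w _; rewrite lee_fin mulr_ge0.
  apply: eq_integral => w _.
  have [h|h] := leP (enorm (x - w)) e; last by rewrite rho_supp// !mul0r mul0e mule0 adde0.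
  by rewrite -EFinM mulrCA EFinM eqn// ge0_muleDr ?lee_fin.
(* Finiteness is read off [key], whose left-hand side is a real number. *)
have ipsi : mu.-integrable setT (fun y => (psi y * J d (x - y))%:E).
  apply/integrableP; split; first by apply/measurable_EFinP; exact: measurable_funM.
  under eq_integral => y _ do rewrite /= ger0_norm ?mulr_ge0// mulrC.
  move: key; case: (\int[mu]_y _)%E => [r _| |]//=; exact: ltry.
have ic : mu.-integrable setT (fun y => (psi x * J d (x - y))%:E).
  apply/integrableP; split; first by apply/measurable_EFinP; exact: measurable_funM.
  under eq_integral => y _ do rewrite /= ger0_norm ?mulr_ge0// EFinM.
  rewrite ge0_integralZl//; last 3 first.
  - exact/measurable_EFinP.
  - by move=> y _; rewrite lee_fin.
  - by rewrite lee_fin.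
  by rewrite IJ -EFinM ltry.
under eq_Rintegral do rewrite mulrBl.
rewrite (RintegralB measurableT ic ipsi) RintegralZl//; last first.
  apply/integrableP; split; first by apply/measurable_EFinP.
  by under eq_integral => y _ do rewrite /= ger0_norm//; rewrite IJ ltry.
rewrite {1}/Rintegral IJ /= mulrC.
have -> : \int[mu]_y (psi y * J d (x - y)) = fine (\int[mu]_y (J d (x - y) * psi y)%:E).
  by congr fine; apply: eq_integral => y _; rewrite mulrC.
move: key; case: (\int[mu]_y _)%E => [r| |]//= [->]; by rewrite addrK.
Qed.

End truncated_equation.

(** * Test functions *)

Lemma normr_diff2_le {R : realType} (t p q r : R) : 0 <= p <= t -> 0 <= q <= t -> 0 <= r <= t ->
  `|2 * p - q - r| <= 4 * t.
Proof.
by move=> /andP[p0 pt] /andP[q0 qt] /andP[r0 rt]; rewrite ler_norml; apply/andP; split; lra.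
Qed.

Section test_functions.
Context {R : realType} (n : nat) (s : R).
Hypotheses (n_gt0 : (0 < n)%N) (s_gt0 : 0 < s) (s_lt1 : s < 1).
Notation mu := (@borel_lebesgue_rV R n).
Notation k := (fine (@kappa R n)).
Notation J := (truncated_kernel s).
Notation omega := (fine (mu [set x | enorm x <= 1])).

Let s2 : 0 < 2 - 2 * s.
Proof. by rewrite -{1}(mulr1 2) -mulrBr mulr_gt0 ?subr_gt0. Qed.

Let k0 : 0 <= k.
Proof. by rewrite fine_ge0// kappa_ge0. Qed.

Lemma small_powR (c : R) : 0 < c -> exists2 d, 0 < d & forall t, 0 < t <= d -> t `^ (2 - 2 * s) <= c.
Proof.
move=> c0; exists (c `^ (2 - 2 * s)^-1); first by rewrite powR_gt0.
move=> t /andP[t0 tc]; have := ge0_ler_powR (ltW s2) _ _ tc; rewrite !nnegrE => h.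
by apply: (le_trans (h (ltW t0) (powR_ge0 _ _))); rewrite -powRrM mulVf ?(gt_eqF s2)// powRr1// ltW.
Qed.

(** On |x| < r the error in [barrier_supersolution] is at most c / 2 for small d, so the barrier
    times 2 / c dominates every f <= 1. The multiple A is independent of r, whereas the threshold on
    d is not. *)
Lemma exists_truncated_solution : exists2 A : R, 0 < A &
  forall (f : 'rV[R]_n -> R) (r : R), measurable_fun setT f -> (forall x, 0 <= f x <= 1) ->
    0 < r < 1 -> exists2 d1 : R, 0 < d1 & forall d, 0 < d <= d1 ->
    exists phi : 'rV[R]_n -> R,
      [/\ measurable_fun setT phi, forall x, 0 <= phi x <= A * barrier s x,
        forall x, r <= enorm x -> phi x = 0 &
        forall w, enorm w < r -> ((k * (d `^ (- (2 * s)) / (2 * s)) * phi w)%:E =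
          (f w)%:E + \int[mu]_y (J d (w - y) * phi y)%:E)%E].
Proof.
have [c c0 hc] := @barrier_supersolution R n s n_gt0 s_gt0 s_lt1.
have b0 (x : 'rV[R]_n) : 0 <= barrier s x by exact: pospow_ge0.
have J0 d z : 0 <= J d (z : 'rV[R]_n) by exact: truncated_kernel_ge0.
(* If k were 0, [barrier_supersolution] at the origin would read c <= 0. *)
have kp : 0 < k.
  rewrite lt_neqAle k0 andbT eq_sym; apply/eqP => kz.
  have h : (2^-1 : R) < 1 - enorm (0 : 'rV[R]_n) by rewrite enorm0 subr0 invf_lt1// ltr1n.
  have hh : 0 < 2^-1 :> R by rewrite invr_gt0.
  have := hc 0 2^-1 hh h; rewrite kz mul0r; apply/negP; rewrite -ltNge.
  apply: (@lt_le_trans _ _ c%:E); first by rewrite lte_fin.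
  rewrite leeDr//; apply: integral_ge0 => y _; rewrite lee_fin mulr_ge0//.
exists (2 / c); first by rewrite divr_gt0.
move=> f r mf f01 /andP[r0 r1].
have dl0 : 0 < 1 - r by rewrite subr_gt0.
(* When d^(2-2s) is below this value, the error 2 k (1 - r)^-2 d^(2-2s) is at most c / 2. *)
have cc : 0 < c * (1 - r) ^+ 2 / (4 * k) by rewrite divr_gt0 ?mulr_gt0 ?exprn_gt0.
have [d2 d20 hd2] := small_powR cc.
exists (Num.min d2 ((1 - r) / 2)); first by rewrite lt_min d20 divr_gt0.
move=> d; rewrite le_min => /andP[d0 /andP[dd2 ddl]].
set M := k * _.
have M0 : 0 < M by rewrite !mulr_gt0 ?powR_gt0// invr_gt0 mulr_gt0.
have mJ2 := measurable_comp_sub2 (@measurable_truncated_kernel R n s d).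
have mD : measurable [set x : 'rV[R]_n | enorm x < r].
  have := @measurable_enorm_set R n `]-oo, r[%classic (measurable_itv _).
  by under eq_set do rewrite /= in_itv/=.
have mb := @measurable_barrier R n s.
have A0 : 0 <= 2 / c by rewrite divr_ge0// ltW.
have f0 x : 0 <= f x by case/andP: (f01 x).
have B0 (x : 'rV[R]_n) : 0 <= 2 / c * barrier s x by rewrite mulr_ge0.
have mB : measurable_fun setT (fun x : 'rV[R]_n => 2 / c * barrier s x) by exact: measurable_funM.
have super (x : 'rV[R]_n) : enorm x < r -> ((f x)%:E +
    \int[mu]_y (J d (x - y) * (2 / c * barrier s y))%:E <= (M * (2 / c * barrier s x))%:E)%E.
  move=> xr.
  have dx : d < 1 - enorm x.
    by apply: (le_lt_trans ddl); move: xr dl0; lra.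
  have := hc x d d0 dx; set I := (\int[mu]_y _)%E.
  have -> : (\int[mu]_y (J d (x - y) * (2 / c * barrier s y))%:E = (2 / c)%:E * I)%E.
    under eq_integral do rewrite mulrCA EFinM.
    rewrite ge0_integralZl//.
    - apply/measurable_EFinP; apply: measurable_funM => //.
      exact: measurable_truncated_kernel_sub.
    - by move=> y _; rewrite lee_fin mulr_ge0//.
  have I0 : (0 <= I)%E.
    by apply: integral_ge0 => y _; rewrite lee_fin mulr_ge0//.
  case: I I0 => [i| |]// i0.
  rewrite -!EFinM -!EFinD !lee_fin => h.
  have ax : 1 - r <= 1 - enorm x by move: xr; lra.
  have ax0 : 0 < 1 - enorm x by apply: lt_le_trans ax.
  have e1 : (1 - enorm x) `^ s <= 1.
    apply: (@le_trans _ _ (1 `^ s)); last by rewrite powR1.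
    apply: ge0_ler_powR; rewrite ?nnegrE ?(ltW s_gt0) ?(ltW ax0)//.
    by rewrite gerBl.
  have e2 : (1 - enorm x) ^- 2 <= (1 - r) ^- 2.
    by rewrite lef_pV2 ?posrE ?exprn_gt0// ler_pXn2r// nnegrE; exact: ltW.
  have e3 : d `^ (2 - 2 * s) <= c * (1 - r) ^+ 2 / (4 * k).
    by apply: hd2; rewrite d0.
  have e4 : k * (2 * (1 - enorm x) `^ s * (1 - enorm x) ^- 2 * d `^ (2 - 2 * s)) <= c / 2.
    apply: (@le_trans _ _ (k * (2 * 1 * (1 - r) ^- 2 * (c * (1 - r) ^+ 2 / (4 * k))))).
      rewrite ler_wpM2l// ler_pM// ?powR_ge0//.
        by rewrite !mulr_ge0 ?powR_ge0// invr_ge0 sqr_ge0.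
      by rewrite ler_pM// ?mulr_ge0 ?powR_ge0// ?invr_ge0 ?sqr_ge0// ler_wpM2l.
    rewrite le_eqVlt; apply/orP; left; apply/eqP; field.
    by rewrite (gt_eqF kp) (gt_eqF dl0).
  rewrite mulrDr in h.
  have h2 : i + c / 2 <= M * barrier s x.
    by rewrite /M -mulrA; move: h e4; lra.
  rewrite (_ : M * (2 / c * _) = 2 / c * (M * barrier s x)); last by ring.
  apply: (@le_trans _ _ (2 / c * (i + c / 2))); last by rewrite ler_wpM2l.
  rewrite mulrDr (_ : 2 / c * (c / 2) = 1); last by field; rewrite (gt_eqF c0).
  by rewrite addrC lerD2l; case/andP: (f01 x).
have [phi [mphi phiB phiD phiE]] := @minimal_solution _ _ R mu (fun x y => J d (x - y)) M
  [set x : 'rV[R]_n | enorm x < r] f (fun x => 2 / c * barrier s x) mJ2 (fun x y => J0 d _) M0 mD mf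
  f0 mB B0 super.
exists phi; split => //.
by move=> x rx; apply: phiD; apply/negP; rewrite -leNgt.
Qed.

Lemma test_function_ball (psi : 'rV[R]_n -> R) (r : R) : r < 1 -> smooth psi ->
  (forall x, r < enorm x -> psi x = 0) -> test_function (unit_ball R n) psi.
Proof.
move=> r1 smo supp.
have clB : closed [set x : 'rV[R]_n | enorm x <= r].
  exact: (proj1 (continuous_closedP _) (@continuous_enorm R n) _ (@closed_le R r)).
have sub : tsupport psi `<=` [set x : 'rV[R]_n | enorm x <= r].
  rewrite /tsupport closureEbigcap => x; apply; split => //= y /eqP y0.
  by rewrite /= leNgt; apply/negP => /supp.
split => //.
  apply: bounded_closed_compact; last exact: closed_closure.
  exists r; split; first exact: num_real.
  by move=> t rt x /sub /= xr; rewrite (le_trans (norm_le_enorm x))// (le_trans xr)// ltW.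
by move=> x /sub /= xr; exact: le_lt_trans r1.
Qed.

Lemma integral_ball_le (phi : 'rV[R]_n -> R) (A : R) : measurable_fun setT phi -> 0 <= A ->
  (forall x, 0 <= phi x <= A) -> (forall x, 1 <= enorm x -> phi x = 0) ->
  mu.-integrable setT (EFin \o phi) /\ \int[mu]_x phi x <= A * omega.
Proof.
move=> mphi A0 phiA phi_supp; have mB := @measurable_cball R n 1.
have le : (\int[mu]_x (phi x)%:E <= (A * omega)%:E)%E.
  apply: (@le_trans _ _ (\int[mu]_x (A%:E * (\1_[set x | enorm x <= 1] x)%:E))%E).
    apply: ge0_le_integral => //.
    - by move=> x _; rewrite lee_fin; case/andP: (phiA x).
    - exact/measurable_EFinP.
    - by apply: emeasurable_funM => //; apply/measurable_EFinP; exact: measurable_indic.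
    - move=> x _; rewrite -EFinM lee_fin indicE.
      have [x1|x1] := leP (enorm x) 1; first by rewrite mem_set// mulr1; case/andP: (phiA x).
      by rewrite phi_supp ?mulr_ge0// ltW.
  rewrite ge0_integralZl//; last first.
    by apply/measurable_EFinP; exact: measurable_indic.
  by rewrite integral_indic// setIT EFinM fineK// ge0_fin_numE ?borel_ball_fin.
have iphi : mu.-integrable setT (EFin \o phi).
  apply/integrableP; split; first exact/measurable_EFinP.
  under eq_integral => x _.
    rewrite /= ger0_norm; last by case/andP: (phiA x).
    over.
  by apply: (le_lt_trans le); exact: ltry.
split => //; rewrite -lee_fin /Rintegral fineK//; exact: integrable_fin_num.
Qed.

(** Q is chosen before f, L and e because it multiplies e^-s in the limit. Q' may depend on all of
    them, since it only serves integrability. *)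
Lemma exists_test_function : exists2 Q : R, 0 <= Q &
  forall (f : 'rV[R]_n -> R) (L e : R), measurable_fun setT f -> (forall x, 0 <= f x <= 1) ->
    0 <= L -> (forall x y, `|f x - f y| <= L * enorm (x - y)) -> 0 < e < 4^-1 ->
  exists psi : 'rV[R]_n -> R, let l := singular_laplacian s psi in
    [/\ test_function (unit_ball R n) psi /\ (forall x, 0 <= psi x),
        measurable_fun setT l /\ (forall C x, fracLaplacian C s psi x = C * l x),
        exists Q' : R, forall x, `|l x| <= Q' / (1 + enorm x `^ (n%:R + 2 * s)),
        forall x, 1 <= enorm x -> l x <= 0 &
        (forall x, enorm x < 1 - 3 * e -> `|l x - f x| <= (1 + L) * e) /\
        (forall x, 1 - 3 * e <= enorm x < 1 -> `|l x| <= Q * e `^ (- s))].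
Proof.
have [A A_gt0 hA] := exists_truncated_solution; have A0 := ltW A_gt0.
have [A1 [rho [A10 hrho]]] := @exists_mollifier R n n_gt0.
have w0 : 0 <= omega by apply: fine_ge0.
(* The two terms are the bound of [le_integral_singular] at r = e and q = s. The first comes from
   the local second difference on a ball of radius 2 e, the second from the barrier. *)
exists (k * (A1 * A * 5 `^ s * 2 ^+ n * omega / (2 - 2 * s) + 4 * A * 5 `^ s / s)).
  by rewrite mulr_ge0// addr_ge0// ?mulr_ge0 ?powR_ge0 ?invr_ge0 ?(ltW s2) ?(ltW s_gt0)//.
move=> f L e mf f01 L0 fL /andP[e0 e4].
have [[mrho rhoB int_rho rho_supp rho2] smooth_rho] := hrho e e0.
set A2 := A1 * e ^- n.+2 in rho2.
have A20 : 0 <= A2 by rewrite mulr_ge0// invr_ge0 exprn_ge0// ltW.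
have rho0 x : 0 <= rho e x by case/andP: (rhoB x).
(* Solving on radius 1 - 2 e leaves a margin e on either side: psi vanishes beyond 1 - e, and the
   mollified equation holds inside 1 - 3 e. *)
have r01 : 0 < 1 - 2 * e < 1 by apply/andP; split; lra.
have [d1 d10 hd1] := hA f (1 - 2 * e) mf f01 r01.
pose a := A2 * (A * omega).
have a0 : 0 <= a := mulr_ge0 A20 (mulr_ge0 A0 w0).
have ka0 : 0 <= k * a by rewrite mulr_ge0.
(* This threshold makes the truncation error k a d^(2-2s) / (2 - 2s) at most e; as a contains
   e^-(n+2), d is tiny compared with e. *)
have cc : 0 < e * (2 - 2 * s) / (k * a + 1) by rewrite divr_gt0 ?mulr_gt0// ltr_wpDl.
have [d2 d20 hd2] := small_powR cc.
pose d := Num.min d1 d2.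
have d0 : 0 < d by rewrite lt_min d10.
have dd1 : 0 < d <= d1 by rewrite d0 ge_min lexx.
have dd2 : 0 < d <= d2 by rewrite d0 ge_min lexx orbT.
have [phi [mphi phiB phi_supp phiE]] := hd1 d dd1.
have phi0 x : 0 <= phi x by case/andP: (phiB x).
have phib (x : 'rV[R]_n) : phi x <= A * pospow s (1 - enorm x) by case/andP: (phiB x).
have phiA x : phi x <= A.
  apply: (le_trans (phib x)); rewrite -[leRHS]mulr1 ler_wpM2l//.
  apply: (@le_trans _ _ (pospow s 1)); first by apply: (le_pospow s_gt0); rewrite gerBl.
  by rewrite pospowE// powR1.
have phi1 x : 1 <= enorm x -> phi x = 0 by move=> x1; apply: phi_supp; move: x1 e0; lra.
have phi0A x : 0 <= phi x <= A by rewrite phi0 phiA.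
have [iphi Iphi] := integral_ball_le mphi A0 phi0A phi1.
pose psi := mollify (rho e) phi.
have psi_le x c : (forall y, enorm (x - y) <= e -> phi y <= c) -> psi x <= c.
  exact: (mollify_le mrho rho0 int_rho rho_supp e0 mphi phi0 phiA).
have psi0 x : 0 <= psi x by exact: mollify_ge0.
have psiA x : psi x <= A by apply: psi_le.
have psi_supp x : 1 - e < enorm x -> psi x = 0.
  move=> xe; apply/eqP; rewrite eq_le psi0 andbT; apply: psi_le => y yx.
  rewrite phi_supp//; have := ler_dist_enorm x y; have := ler_norm (enorm x - enorm y).
  by move: xe yx; lra.
have mpsi : measurable_fun setT psi by exact: measurable_mollify.
have psi2 x z : `|diff2 psi x z| <= a * enorm z ^+ 2.
  apply: (le_trans (diff2_mollify_le mrho rho0 int_rho rho2 mphi phi0 phiA iphi x z)).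
  rewrite /a mulrAC ler_wpM2r ?sqr_ge0// ler_wpM2l//.
have psiN x : `|psi x| <= A by rewrite ger0_norm.
have psi1 x : 1 <= enorm x -> psi x = 0 by move=> x1; apply: psi_supp; move: x1 e0; lra.
have psi_barrier x : psi x <= A * pospow s (1 - enorm x + e).
  apply: psi_le => y yx; apply: (le_trans (phib y)); rewrite ler_wpM2l//.
  apply: (le_pospow s_gt0).
  have := ler_dist_enorm x y; have := ler_norm (enorm x - enorm y).
  by move: yx; lra.
exists psi; split.
- split=> //; apply: (@test_function_ball _ (1 - e)) => //; first by rewrite gtrBl.
  exact: smooth_rho.
- split; first exact: measurable_singular_laplacian.
  by move=> C x; exact: (fracLaplacianE s_gt0 s_lt1 mpsi psiN a0 psi2).
- apply: (@singular_laplacian_decay R n s s_gt0 s_lt1 psi mpsi psi0 psi1 a A a0 psiA psi2).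
  by have [] := integral_ball_le mpsi A0 (fun x => introT andP (conj (psi0 x) (psiA x))) psi1.
- move=> x x1; apply: singular_laplacian_le0 => //; exact: psi1.
split.
  move=> x x3.
  have h := truncated_laplacian_dist s_gt0 s_lt1 mpsi psiN a0 psi2 x d0.
  have f0 y : 0 <= f y by case/andP: (f01 y).
  have f1 y : f y <= 1 by case/andP: (f01 y).
  have E := @truncated_laplacian_mollify R n s s_gt0 (rho e) e mrho rho0 int_rho rho_supp phi A
    mphi phi0 phiA f 1 mf f0 f1 d x d0 _.
  rewrite E in h; last first.
    move=> w xw; apply: phiE.
    have := ler_dist_enorm w x; have := ler_norm (enorm w - enorm x); rewrite enormB.
    by move: xw x3; lra.
  have h2 := mollify_dist mrho rho0 int_rho rho_supp mf f0 f1 L0 (fL x).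
  have h3 : k * a * (d `^ (2 - 2 * s) / (2 - 2 * s)) <= e.
    rewrite mulrA ler_pdivrMr//; have := hd2 d dd2; rewrite ler_pdivlMr ?ltr_wpDl//.
    by apply: le_trans; rewrite mulrC ler_wpM2l ?powR_ge0// lerDl.
  rewrite (_ : _ - f x = (singular_laplacian s psi x - mollify (rho e) f x) + (mollify (rho e) f x - f x)); last by ring.
  by rewrite (le_trans (ler_normD _ _))//; move: h h2 h3; lra.
move=> x /andP[x3 x1].
(* For |x| >= 1 - 3 e and |x - y| <= 2 e one has 1 - |y| <= 5 e. *)
pose c := A * (5 * e) `^ s; have c0 : 0 <= c by rewrite mulr_ge0// powR_ge0.
pose a' := A2 * (c * fine (mu [set x | enorm x <= 2 * e])).
have mB0 : 0 <= fine (mu [set x : 'rV[R]_n | enorm x <= 2 * e]) by apply: fine_ge0.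
have a'0 : 0 <= a' := mulr_ge0 A20 (mulr_ge0 c0 mB0).
pose b := 4 * A * 5 `^ s; have b0 : 0 <= b by rewrite !mulr_ge0// powR_ge0.
have near z : enorm z <= e -> `|diff2 psi x z| <= a' * enorm z ^+ 2.
  move=> ze; rewrite /a' mulrAC.
  apply: (diff2_mollify_local mrho rho0 int_rho rho_supp e0 A20 rho2 mphi phi0 phiA iphi ze).
  move=> y yx; apply: (le_trans (phib y)); rewrite ler_wpM2l//.
  rewrite (_ : (5 * e) `^ s = pospow s (5 * e)); last by rewrite pospowE// mulr_ge0// ltW.
  apply: (le_pospow s_gt0).
  have := ler_dist_enorm x y; have := ler_norm (enorm x - enorm y).
  by move: yx; lra.
(* At x, x + z and x - z the distance to the sphere plus e is at most 4 e + |z| <= 5 |z|, so the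
   barrier bounds all three values by multiples of |z|^s. *)
have far z : e < enorm z -> `|diff2 psi x z| <= b * enorm z `^ s.
  move=> ze.
  have P t : t <= 5 * enorm z -> A * pospow s t <= A * 5 `^ s * enorm z `^ s.
    move=> tz; rewrite -mulrA ler_wpM2l// -powRM// (_ : (5 * enorm z) `^ s = pospow s (5 * enorm z)); last first.
      by rewrite pospowE// mulr_ge0.
    by apply: (le_pospow s_gt0).
  have p1 : psi x <= A * 5 `^ s * enorm z `^ s.
    by apply: (le_trans (psi_barrier x)); apply: P; move: ze; lra.
  have p2 v : enorm v = enorm z -> psi (x + v) <= A * 5 `^ s * enorm z `^ s.
    move=> vz; apply: (le_trans (psi_barrier _)); apply: P.
    have := enormD (x + v) (- v); rewrite addrK enormN vz.
    by move: ze; lra.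
  rewrite (_ : b * _ = 4 * (A * 5 `^ s * enorm z `^ s)); last by rewrite /b; ring.
  by apply: normr_diff2_le; rewrite psi0/= ?p1 ?p2 ?enormN.
have s_lt2 : s < 2 * s by rewrite mulr_natl mulr2n ltrDl.
have [_ h] := le_integral_singular s_lt1 (measurable_diff2 mpsi x) a'0 b0 s_lt2 e0 near far.
rewrite /singular_laplacian normrM ger0_norm//.
apply: (@le_trans _ _ `|\int[mu]_z (diff2 psi x z * J 0 z)|).
  by rewrite ler_piMl// invf_le1// ler1n.
apply: (le_trans h); rewrite -mulrA ler_wpM2l// (_ : 2 * s - s = s); last by ring.
rewrite [leRHS]mulrDl; apply: lerD; last by rewrite /b mulrA mulrAC.
rewrite /a' borel_ball_scale ?mulr_gt0//.
rewrite fineM//; last by rewrite ge0_fin_numE ?borel_ball_fin.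
rewrite /= /A2 /c powRM ?(ltW e0)// exprMn.
(* In order: second difference of rho, barrier height, volume of the ball of radius 2 e, integrated
   singularity. *)
have -> : e `^ (- s) = e ^- n.+2 * e `^ s * e ^+ n * e `^ (2 - 2 * s).
  rewrite -!powR_mulrn ?(ltW e0)// -powRN -!powRD; try by rewrite (gt_eqF e0) implybT.
  by congr (_ `^ _); rewrite -[n.+2]addn2 natrD; ring.
by rewrite le_eqVlt; apply/orP; left; apply/eqP; ring.
Qed.

End test_functions.

(** * Passage to the limit *)

(** Young's inequality for (v / t) (t e^-s): the exponent 1 / s turns e^-s into 1 / e, which an
    annulus of measure O(e) just compensates. The parameter t makes what is left small. *)
Lemma young_boundary {R : realType} (s v t e : R) : 0 < s -> s < 1 -> 0 <= v -> 0 < t -> 0 < e ->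
  v * e `^ (- s) <= (v / t) `^ (1 / (1 - s)) + t `^ s^-1 / e.
Proof.
move=> s0 s1 v0 t0 e0; have s10 : 0 < 1 - s by rewrite subr_gt0.
have vt : 0 <= v / t by rewrite divr_ge0// ltW.
have te : 0 <= t * e `^ (- s) by rewrite mulr_ge0 ?powR_ge0// ltW.
have p0 : 0 < 1 / (1 - s) by rewrite divr_gt0.
have q0 : 0 < s^-1 by rewrite invr_gt0.
have pq : (1 / (1 - s))^-1 + s^-1^-1 = 1 by rewrite invf_div invrK divr1 subrK.
have := conjugate_powR vt te p0 q0 pq.
have -> : v / t * (t * e `^ (- s)) = v * e `^ (- s) by field; rewrite (gt_eqF t0).
move=> h; apply: (le_trans h); apply: lerD.
  by rewrite ler_pdivrMr// ler_peMr ?powR_ge0// ler_pdivlMr// mul1r gerBl ltW.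
rewrite powRM ?powR_ge0 ?(ltW t0)// -powRrM mulNr mulfV ?(gt_eqF s0)// powR_inv1 ?(ltW e0)//.
by rewrite invrK ler_piMr ?(ltW s1)// divr_ge0 ?powR_ge0// ltW.
Qed.

Section test_inequality.
Context d (T : measurableType d) (R : realType) (nu : {measure set T -> \bar R}).
Variables (U Ann : set T) (u l f : T -> R) (s t e K Q c : R).
Hypotheses (s_gt0 : 0 < s) (s_lt1 : s < 1) (t_gt0 : 0 < t) (e_gt0 : 0 < e) (K0 : 0 <= K) (Q0 : 0 <= Q).
Hypotheses (mU : measurable U) (mAnn : measurable Ann) (mu : measurable_fun setT u)
  (ml : measurable_fun setT l) (mf : measurable_fun setT f).
Notation p := (1 / (1 - s)).

(** This bounds |u| |l - f| except for the Young remainder Q t^(1/s) / e on the annulus, which is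
    kept apart because its integral does not vanish with e. *)
Definition test_majorant (x : T) : R := K * `|u x| + \1_Ann x * (`|u x| + Q * (`|u x| / t) `^ p).

Hypotheses (iul : nu.-integrable setT (fun x => (u x * l x)%:E))
  (iu : nu.-integrable U (EFin \o u)) (f01 : forall x, 0 <= f x <= 1).
Hypotheses (u_out : {ae nu, forall x, (~` U) x -> 0 <= u x}) (l_out : forall x, (~` U) x -> l x <= 0)
  (l_in : forall x, U x -> ~ Ann x -> `|l x - f x| <= K)
  (l_ann : forall x, U x -> Ann x -> `|l x| <= Q * e `^ (- s))
  (ul_ge0 : 0 <= \int[nu]_x (u x * l x)) (Ann_small : (nu (U `&` Ann) <= (c * e)%:E)%E).

Let measurable_majorant : measurable_fun setT test_majorant.
Proof.
have mn : measurable_fun setT (fun x => `|u x|) by exact: measurableT_comp.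
apply: measurable_funD; first exact: measurable_funM.
apply: measurable_funM; first exact: measurable_indic.
apply: measurable_funD => //; apply: measurable_funM => //.
by apply: (measurableT_comp (measurable_powR _)); exact: measurable_funM.
Qed.

Let majorant_ge0 x : 0 <= test_majorant x.
Proof. by rewrite addr_ge0 ?mulr_ge0// ?addr_ge0 ?mulr_ge0 ?powR_ge0// indicE. Qed.

(** Outside U the factors have opposite signs, so that part contributes at most 0 to a nonnegative
    total. *)
Lemma le_integral_inside : (\int[nu]_(x in U) (u x * l x)%:E >= 0)%E.
Proof.
have mUC : measurable (~` U) by exact: measurableC.
have h : (\int[nu]_x (u x * l x)%:E = \int[nu]_(x in U) (u x * l x)%:E + \int[nu]_(x in ~` U) (u x * l x)%:E)%E.
  have mm : measurable_fun setT (fun x => (u x * l x)%:E) by exact: measurable_int iul.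
  have := @integral_setU_EFin _ _ R nu U (~` U) (fun x => u x * l x) mU mUC.
  rewrite setUv; apply; first exact/measurable_EFinP.
  by apply/disj_setPS; rewrite setICr.
have neg : (\int[nu]_(x in ~` U) (u x * l x)%:E <= 0)%E.
  rewrite (@ae_eq_integral _ _ _ nu _ (fun x => - (`|u x * l x|)%:E)%E).
  - rewrite integral_ge0N//.
    by rewrite oppe_le0; apply: integral_ge0 => x _; rewrite lee_fin.
  - exact: mUC.
  - by apply: measurable_funTS; apply/measurable_EFinP; exact: measurable_funM.
  - apply: measurable_funTS; apply: measurableT_comp => //; apply/measurable_EFinP.
    by apply: measurableT_comp => //; exact: measurable_funM.
  - apply: filterS u_out => x /= ux xU; congr EFin.
    by rewrite ler0_norm ?opprK// mulr_ge0_le0// ?ux ?l_out.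
have fin : (\int[nu]_x (u x * l x)%:E \is a fin_num)%E by apply: integrable_fin_num.
have ul0 := ul_ge0; rewrite -lee_fin /Rintegral fineK// h in ul0.
by apply: (le_trans ul0); rewrite -[leRHS]adde0 leeD2l.
Qed.

Lemma test_inequality :
  ((- (\int[nu]_(x in U) (u x * f x)) - Q * t `^ s^-1 * c)%:E <=
   \int[nu]_(x in U) (test_majorant x)%:E)%E.
Proof.
have t0' : 0 <= t `^ s^-1 by exact: powR_ge0.
have f1 x : `|f x| <= 1 by case/andP: (f01 x) => f0 f1; rewrite ger0_norm.
have iulU : nu.-integrable U (fun x => (u x * l x)%:E).
  exact: (integrableS measurableT mU _ iul).
have iuf : nu.-integrable U (fun x => (u x * f x)%:E).
  apply: (@le_integrable _ _ _ nu U mU _ (EFin \o u)) => //.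
    by apply: measurable_funTS; apply/measurable_EFinP; exact: measurable_funM.
  by move=> x _; rewrite /= lee_fin normrM ler_piMr.
have i0 := le_integral_inside.
have fin : (\int[nu]_(x in U) (u x * l x)%:E \is a fin_num)%E by apply: integrable_fin_num.
pose D x := u x * l x - u x * f x.
have iD : nu.-integrable U (fun x => (D x)%:E) by exact: (integrableB mU iulU iuf).
have DE : \int[nu]_(x in U) D x = \int[nu]_(x in U) (u x * l x) - \int[nu]_(x in U) (u x * f x).
  exact: (RintegralB mU iulU iuf).
have l0 : 0 <= \int[nu]_(x in U) (u x * l x) by apply: fine_ge0.
have h1 : ((- \int[nu]_(x in U) (u x * f x))%:E <= \int[nu]_(x in U) `|(D x)%:E|)%E.
  apply: (@le_trans _ _ (\int[nu]_(x in U) D x)%:E).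
    by rewrite lee_fin DE lerDr.
  have finD : (\int[nu]_(x in U) (D x)%:E \is a fin_num)%E by apply: integrable_fin_num.
  rewrite /Rintegral fineK//; apply: (le_trans (lee_abs _)).
  by apply: le_abse_integral => //; exact: measurable_int iD.
rewrite EFinB leeBlDr//; apply: (le_trans h1).
(* Integrated over the annulus this gives at most b c e = Q t^(1/s) c, which no longer contains
   e. *)
pose b := Q * (t `^ s^-1 / e); have b0 : 0 <= b.
  by rewrite mulr_ge0// divr_ge0// ltW.
have mA : measurable_fun setT (fun x => b * \1_Ann x).
  by apply: measurable_funM => //; exact: measurable_indic.
apply: (@le_trans _ _ (\int[nu]_(x in U) ((test_majorant x)%:E + (b * \1_Ann x)%:E))%E).
  apply: ge0_le_integral => //.
  - apply: measurable_funTS; apply: measurableT_comp => //; apply/measurable_EFinP.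
    by apply: measurable_funB; exact: measurable_funM.
  - apply: emeasurable_funD; apply: measurable_funTS; exact/measurable_EFinP.
  - move=> x Ux; rewrite -EFinD lee_fin /D -mulrBr normrM /test_majorant indicE.
    have [xA|xA] := pselect (Ann x); last first.
      by rewrite memNset// mul0r mulr0 !addr0 mulrC ler_wpM2r// l_in.
    rewrite mem_set// [true%:R * _]mul1r [b * _]mulr1.
    apply: (@le_trans _ _ (`|u x| * (Q * e `^ (- s) + 1))).
      by rewrite ler_wpM2l// (le_trans (ler_normB _ _))// lerD// l_ann.
    have := young_boundary s_gt0 s_lt1 (normr_ge0 (u x)) t_gt0 e_gt0.
    move=> /(ler_wpM2l Q0) yb.
    apply: (@le_trans _ _ (`|u x| + (Q * (`|u x| / t) `^ p + b))).
      rewrite mulrDr mulr1 addrC lerD2l mulrCA; apply: (le_trans yb).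
      by rewrite mulrDr /b.
    by rewrite -[leRHS]addrA -[X in _ <= _ + X]addrA lerDr mulr_ge0.
rewrite ge0_integralD//; last 4 first.
- by move=> x _; rewrite lee_fin.
- by apply: measurable_funTS; exact/measurable_EFinP.
- by move=> x _; rewrite lee_fin mulr_ge0// indicE.
- by apply: measurable_funTS; exact/measurable_EFinP.
rewrite leeD2l//; under eq_integral do rewrite EFinM.
rewrite ge0_integralZl//; last first.
  by apply: measurable_funTS; apply/measurable_EFinP; exact: measurable_indic.
rewrite integral_indic// setIC.
apply: (@le_trans _ _ (b%:E * (c * e)%:E)%E); first exact: lee_wpmul2l.
by rewrite -EFinM lee_fin /b le_eqVlt; apply/orP; left; apply/eqP; field; rewrite (gt_eqF e_gt0).
Qed.

End test_inequality.

Lemma bernoulli_le {R : realType} (n : nat) (a : R) : 0 <= a <= 1 -> 1 - (1 - a) ^+ n <= n%:R * a.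
Proof.
move=> /andP[a0 a1]; elim: n => [|n IH]; first by rewrite expr0 subrr mul0r.
have x0 : 0 <= (1 - a) ^+ n by rewrite exprn_ge0// subr_ge0.
have x1 : (1 - a) ^+ n <= 1 by rewrite exprn_ile1// ?subr_ge0// gerBl.
have ax : a * (1 - a) ^+ n <= a by rewrite ler_piMr.
by rewrite exprS -natr1; lra.
Qed.

Section test_limit.
Context d (T : measurableType d) (R : realType) (nu : {measure set T -> \bar R}).
Variables (U : set T) (Ann : nat -> set T) (u f : T -> R) (l : nat -> T -> R).
Variables (e : nat -> R) (s L Q c : R).
Hypotheses (s_gt0 : 0 < s) (s_lt1 : s < 1) (e_gt0 : forall i, 0 < e i) (e_le1 : forall i, e i <= 1)
  (e_cvg : e i @[i --> \oo] --> (0 : R)) (L0 : 0 <= L) (Q0 : 0 <= Q) (c0 : 0 <= c).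
Hypotheses (mU : measurable U) (mAnn : forall i, measurable (Ann i)) (mu : measurable_fun setT u)
  (ml : forall i, measurable_fun setT (l i)) (mf : measurable_fun setT f).
Notation p := (1 / (1 - s)).
Hypotheses (iul : forall i, nu.-integrable setT (fun x => (u x * l i x)%:E))
  (iu : nu.-integrable U (EFin \o u)) (iup : nu.-integrable U (fun x => (`|u x| `^ p)%:E))
  (f01 : forall x, 0 <= f x <= 1).
Hypotheses (u_out : {ae nu, forall x, (~` U) x -> 0 <= u x})
  (l_out : forall i x, (~` U) x -> l i x <= 0)
  (l_in : forall i x, U x -> ~ Ann i x -> `|l i x - f x| <= L * e i)
  (l_ann : forall i x, U x -> Ann i x -> `|l i x| <= Q * e i `^ (- s))
  (ul_ge0 : forall i, 0 <= \int[nu]_x (u x * l i x))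
  (Ann_small : forall i, (nu (U `&` Ann i) <= (c * e i)%:E)%E)
  (Ann_vanish : forall x, U x -> \forall i \near \oo, ~ Ann i x).

(** Dominated convergence at fixed t: every point of U eventually leaves the annulus, and e i <= 1
    gives a common majorant. Its integrability uses [iup], the L^(1/(1-s)) hypothesis. *)
Lemma cvg_integral_test_majorant t : 0 < t ->
  (\int[nu]_(x in U) (test_majorant (Ann i) u s t (L * e i) Q x)%:E)%E @[i --> \oo] --> 0%E.
Proof.
move=> t0; pose g (x : T) : R := L * `|u x| + (`|u x| + Q * (`|u x| / t) `^ p).
have ig : nu.-integrable U (EFin \o g).
  have iu' : nu.-integrable U (fun x => (`|u x|)%:E) by exact: integrable_norm.
  have iup' : nu.-integrable U (fun x => (Q * (`|u x| / t) `^ p)%:E).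
    rewrite (_ : (fun x => _) = (fun x => (Q * t^-1 `^ p)%:E * (`|u x| `^ p)%:E)%E).
      exact: integrableZl.
    by apply/funext => x; rewrite -EFinM powRM ?invr_ge0 ?(ltW t0)//; congr EFin; ring.
  exact: (integrableD mU (integrableZl mU L iu') (integrableD mU iu' iup')).
have mn : measurable_fun setT (fun x => `|u x|) by exact: measurableT_comp.
rewrite -(@integral0 _ _ R nu U).
apply: (@dominated_cvg _ _ R nu U mU
  (fun i x => (test_majorant (Ann i) u s t (L * e i) Q x)%:E) (cst 0%E) (EFin \o g)) => //.
- move=> i; apply: measurable_funTS; apply/measurable_EFinP.
  apply: measurable_funD; first exact: measurable_funM.
  apply: measurable_funM; first exact: measurable_indic.
  apply: measurable_funD => //; apply: measurable_funM => //.
  by apply: (measurableT_comp (measurable_powR _)); exact: measurable_funM.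
- move=> x xU; apply: cvg_EFin; first by near=> i.
  have cK : L * e i * `|u x| @[i --> \oo] --> (0 : R).
    rewrite -[X in _ --> X](mul0r `|u x|); apply: cvgMl.
    by rewrite -[X in _ --> X](mulr0 L); exact: cvgMr.
  apply: cvg_trans cK.
  apply: near_eq_cvg; near=> i; rewrite /test_majorant /= indicE memNset ?mul0r ?addr0//=.
  by near: i; exact: Ann_vanish.
- move=> i x xU; rewrite /= lee_fin ger0_norm; last first.
    by rewrite addr_ge0 ?mulr_ge0// ?addr_ge0// ?mulr_ge0 ?powR_ge0// ?(ltW (e_gt0 i))// indicE.
  rewrite /test_majorant /g; apply: lerD; first by rewrite ler_wpM2r// ler_piMr.
  by rewrite ler_piMl ?addr_ge0 ?mulr_ge0 ?powR_ge0// indicE; case: (_ \in _).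
Unshelve. all: by end_near.
Qed.

Lemma test_limit : 0 <= \int[nu]_(x in U) (u x * f x).
Proof.
set I := \int[nu]_(x in U) (u x * f x).
have key t : 0 < t -> - I - Q * t `^ s^-1 * c <= 0.
  move=> t0; rewrite -lee_fin; apply: (cvge_ge _ (cvg_integral_test_majorant t0)).
  apply: nearW => i; have K0 : 0 <= L * e i by rewrite mulr_ge0// ltW.
  by apply: (@test_inequality _ _ R nu U (Ann i) u (l i) f s t (e i)) => //; move=> x; [exact: l_out|exact: l_in|exact: l_ann].
rewrite leNgt; apply/negP => I0.
(* With t^(1/s) equal to this value, Q c t^(1/s) < - I, contradicting [key]; the summand 1 covers Q
   c = 0. *)
have v0 : 0 < - I / (2 * (Q * c + 1)) by rewrite divr_gt0 ?oppr_gt0// mulr_gt0// ltr_wpDl// mulr_ge0.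
have := key ((- I / (2 * (Q * c + 1))) `^ s) (powR_gt0 _ v0).
rewrite -powRrM mulfV ?(gt_eqF s_gt0)// powRr1 ?(ltW v0)//.
apply/negP; rewrite -ltNge subr_gt0 mulrAC mulrA ltr_pdivrMr; last first.
  by rewrite mulr_gt0// ltr_wpDl// mulr_ge0.
rewrite mulrC ltr_pM2l ?oppr_gt0//.
by have := mulr_ge0 Q0 c0; lra.
Qed.

End test_limit.

(** * Lipschitz test functions on the unit ball *)

Section ball_test.
Context {R : realType} (n : nat) (s C : R) (u : 'rV[R]_n -> R).
Hypotheses (n_gt0 : (0 < n)%N) (s_gt0 : 0 < s) (s_lt1 : s < 1) (C_gt0 : 0 < C) (uL : calL s u)
  (uLp : u \_ (unit_ball R n) \in Lfun (lebesgue_rV R n) (1 / (1 - s))%:E)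
  (u_super : fracLaplacian_ge0 (unit_ball R n) C s u)
  (u_ext : {ae lebesgue_rV R n, forall x, (~` unit_ball R n) x -> 0 <= u x}).
Notation nu := (lebesgue_rV R n).
Notation U := (unit_ball R n : set (lebesgue_rV_type R n)).
Notation k := (fine (@kappa R n)).
Notation p := (1 / (1 - s)).

Lemma measurable_unit_ball : measurable (unit_ball R n).
Proof.
have := @measurable_enorm_set R n `]-oo, 1[%classic (measurable_itv _).
by under eq_set do rewrite /= in_itv/=.
Qed.

Let mU : measurable U.
Proof. exact: measurable_lebesgue_rV measurable_unit_ball. Qed.

Let mu : measurable_fun [set: lebesgue_rV_type R n] (u : lebesgue_rV_type R n -> R).
Proof. by case: uL. Qed.

Let w (x : 'rV[R]_n) : R := 1 + enorm x `^ (n%:R + 2 * s).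

Let w_gt0 x : 0 < w x.
Proof. by rewrite ltr_pwDl// powR_ge0. Qed.

Let mw : measurable_fun [set: lebesgue_rV_type R n] (fun x : lebesgue_rV_type R n => (w x)^-1).
Proof.
apply: (@measurable_fun_lebesgue_rV R n _ _ (fun x : 'rV[R]_n => (w x)^-1)).
rewrite (_ : (fun x => _) = (fun x => (w x) `^ (-1))); last first.
  by apply/funext => x; rewrite powR_inv1// ltW.
apply: (measurableT_comp (measurable_powR _)); apply: measurable_funD => //.
exact: (measurableT_comp (measurable_powR _) measurable_enorm).
Qed.

Let iw : nu.-integrable setT (fun x : lebesgue_rV_type R n => (u x / w x)%:E).
Proof.
apply/integrableP; split; first by apply/measurable_EFinP; exact: measurable_funM.
under eq_integral => x _ do rewrite /= normrM (gtr0_norm (_ : 0 < (w x)^-1)) ?invr_gt0//.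
by case: uL.
Qed.

Lemma integrable_calL_mul (l : 'rV[R]_n -> R) (Q : R) : measurable_fun setT l ->
  (forall x, `|l x| <= Q / w x) ->
  nu.-integrable setT (fun x : lebesgue_rV_type R n => (u x * l x)%:E).
Proof.
move=> ml hl.
apply: (@le_integrable _ _ _ nu setT measurableT _ (fun x => Q%:E * (u x / w x)%:E)%E).
- apply/measurable_EFinP; apply: measurable_funM => //; exact: measurable_fun_lebesgue_rV.
- move=> x _; rewrite -EFinM !abse_EFin lee_fin !normrM mulrCA ler_wpM2l//.
  apply: (le_trans (hl x)); rewrite -normrM; exact: ler_norm.
- exact: integrableZl.
Qed.

Lemma integrable_calL_ball : nu.-integrable U (fun x : lebesgue_rV_type R n => (u x)%:E).
Proof.
apply: (@le_integrable _ _ _ nu U mU _ (fun x => 2%:E * (u x / w x)%:E)%E).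
- by apply: measurable_funTS; exact/measurable_EFinP.
- move=> x xU; rewrite -EFinM !abse_EFin lee_fin !normrM mulrCA -[leLHS]mulr1 ler_wpM2l//.
  rewrite !ger0_norm// ?invr_ge0 ?(ltW (w_gt0 x))// ler_pdivlMr// mul1r.
  rewrite /w -[leRHS]/(1 + 1) lerD2l; apply: (@le_trans _ _ (1 `^ (n%:R + 2 * s))); last by rewrite powR1.
  by apply: ge0_ler_powR; rewrite ?nnegrE// ?addr_ge0// ?mulr_ge0// ltW.
- exact: (integrableS measurableT mU _ (integrableZl measurableT 2 iw)).
Qed.

Let iup : nu.-integrable U (fun x : lebesgue_rV_type R n => (`|u x| `^ p)%:E).
Proof.
have p1 : 1 <= p by rewrite ler_pdivlMr ?subr_gt0// mul1r gerBl ltW.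
have := integrableS measurableT mU _ (Lfun_integrable p1 uLp).
move=> /(_ (@subsetT _ _)); apply: eq_integrable => // x /set_mem xU.
by rewrite patchE mem_set.
Qed.

(** The exact volume is k (1 - (1 - 3 e)^n) / n, and Bernoulli's inequality cancels the n. *)
Lemma lebesgue_annulus (e : R) : 0 < e < 4^-1 ->
  (nu (U `&` [set x : lebesgue_rV_type R n | (1 - 3 * e <= enorm (x : 'rV[R]_n))%R]) <= (k * 3 * e)%:E)%E.
Proof.
move=> /andP[e0 e4]; have r0 : 0 < 1 - 3 * e by lra.
have r1 : 1 - 3 * e < 1 by lra.
have mA : measurable [set x : 'rV[R]_n | 1 - 3 * e <= enorm x <= 1].
  have := @measurable_enorm_set R n `[1 - 3 * e, 1]%classic (measurable_itv _).
  by under eq_set do rewrite /= in_itv/=.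
have mA' : measurable [set x : 'rV[R]_n | 1 - 3 * e <= enorm x].
  have := @measurable_enorm_set R n `[1 - 3 * e, +oo[%classic (measurable_itv _).
  by under eq_set do rewrite /= in_itv/= andbT.
apply: (@le_trans _ _ (nu [set x : lebesgue_rV_type R n | (1 - 3 * e <= enorm (x : 'rV[R]_n) <= 1)%R])).
  apply: le_measure; rewrite ?inE.
  - by apply: measurableI => //; exact: measurable_lebesgue_rV mA'.
  - exact: measurable_lebesgue_rV mA.
  - by move=> x [/= x1 x3]; rewrite x3 ltW.
rewrite (lebesgue_rVE mA) borel_annulus// kappaE -EFinM lee_fin -mulrA.
have k0 : 0 <= k by rewrite fine_ge0// kappa_ge0.
rewrite ler_wpM2l// expr1n ler_pdivrMr ?ltr0n// [leRHS]mulrC.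
by apply: bernoulli_le; apply/andP; split; lra.
Qed.

Lemma integral_ball_test_ge0 (f : 'rV[R]_n -> R) (L : R) : measurable_fun setT f ->
  (forall x, 0 <= f x <= 1) -> 0 <= L -> (forall x y, `|f x - f y| <= L * enorm (x - y)) ->
  0 <= \int[nu]_(x in U) (u x * f x).
Proof.
move=> mf f01 L0 fL.
have [Q Q0 hQ] := @exists_test_function R n s n_gt0 s_gt0 s_lt1.
have k0 : 0 <= k by rewrite fine_ge0// kappa_ge0.
(* Dividing by 5 keeps even the first term strictly below 1/4. *)
pose e (i : nat) : R := i.+1%:R^-1 / 5.
have e0 i : 0 < e i by rewrite divr_gt0 ?invr_gt0.
have e4 i : 0 < e i < 4^-1.
  rewrite e0/= ltr_pdivrMr//; apply: (@le_lt_trans _ _ 1); first by rewrite invf_le1 ?ler1n.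
  by rewrite mulrC ltr_pdivlMr// mul1r ltr_nat.
have e1 i : e i <= 1.
  by case/andP: (e4 i) => _ h; rewrite (le_trans (ltW h))// invf_le1// ler1n.
have ce : e i @[i --> \oo] --> (0 : R).
  by rewrite -[X in _ --> X](mul0r 5^-1); apply: cvgMl; exact: cvg_harmonic.
pose Ann i := [set x : lebesgue_rV_type R n | 1 - 3 * e i <= enorm (x : 'rV[R]_n)].
have mAnn i : measurable (Ann i).
  apply: measurable_lebesgue_rV.
  have := @measurable_enorm_set R n `[1 - 3 * e i, +oo[%classic (measurable_itv _).
  by under eq_set do rewrite /= in_itv/= andbT.
have [psi hpsi] := choice (fun i => hQ f L (e i) mf f01 L0 fL (e4 i)).
pose l i := singular_laplacian s (psi i).
have ml i : measurable_fun setT (l i) by case: (hpsi i) => _ [].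
have iul i : nu.-integrable setT (fun x : lebesgue_rV_type R n => (u x * l i x)%:E).
  by case: (hpsi i) => _ _ [Q' hQ'] _ _; exact: (integrable_calL_mul (ml i) hQ').
have L10 : 0 <= 1 + L by rewrite addr_ge0.
have k30 : 0 <= k * 3 by rewrite mulr_ge0.
apply: (@test_limit _ _ R nu U Ann u f l e s (1 + L) Q (k * 3) s_gt0 s_lt1 e0 e1 ce L10 Q0 k30 mU
  mAnn mu (fun i => measurable_fun_lebesgue_rV (ml i)) (measurable_fun_lebesgue_rV mf) iul integrable_calL_ball iup f01 u_ext).
- by move=> i x /= /negP; rewrite -leNgt; case: (hpsi i) => _ _ _ l_out _; exact: l_out.
- by move=> i x _ /= /negP; rewrite -ltNge; case: (hpsi i) => _ _ _ _ [l_in _]; exact: l_in.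
- by move=> i x xU xA; case: (hpsi i) => _ _ _ _ [_ l_ann]; apply: l_ann; apply/andP.
- move=> i; case: (hpsi i) => -[tpsi psi0] [_ lE] _ _ _.
  have := u_super tpsi psi0; rewrite /distr_fracLaplacian.
  under eq_Rintegral do rewrite lE mulrCA.
  by rewrite (RintegralZl C measurableT (iul i)) pmulr_rge0.
- by move=> i; exact: lebesgue_annulus.
- move=> x xU; have x1 : 0 < (1 - enorm (x : 'rV[R]_n)) / 3 by rewrite divr_gt0// subr_gt0.
  near=> i; apply/negP; rewrite -ltNge ltrBrDl -ltrBrDr.
  have : `|0 - e i| < (1 - enorm (x : 'rV[R]_n)) / 3.
    by near: i; move/cvgrPdist_lt : ce => /(_ _ x1).
  by rewrite sub0r normrN gtr0_norm// ltr_pdivlMr//; lra.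
Unshelve. all: by end_near.
Qed.

End ball_test.

(** * Approximation of Borel sets by Lipschitz functions *)

Section sigma_algebra_approximation.
Context d (T : measurableType d) (R : realType) (nu : {measure set T -> \bar R}).
Variables (U : set T) (v : T -> R) (P : set (T -> R)).
Hypotheses (mU : measurable U) (mv : measurable_fun setT v) (v0 : forall x, 0 <= v x)
  (iv : nu.-integrable U (EFin \o v)).
Hypotheses (P0 : P (fun=> 0)) (PC : forall f, P f -> P (fun x => 1 - f x))
  (Pmax : forall f g, P f -> P g -> P (fun x => Num.max (f x) (g x)))
  (Pm : forall f, P f -> measurable_fun setT f) (P01 : forall f, P f -> forall x, 0 <= f x <= 1).

(** Approximation of the indicator in L^1 of U with density v. With v = |u|, nonnegativity of the
    integral of u f passes from f in P to indicators. *)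
Definition approximable (A : set T) : Prop := measurable A /\ forall e : R, 0 < e ->
  exists2 f, P f & (\int[nu]_(x in U) (v x * `|f x - \1_A x|)%:E <= e%:E)%E.

Let mdist (f g : T -> R) : measurable_fun setT f -> measurable_fun setT g ->
  measurable_fun U (fun x => (v x * `|f x - g x|)%:E).
Proof.
move=> mf mg; apply: measurable_funTS; apply/measurable_EFinP; apply: measurable_funM => //.
by apply: measurableT_comp => //; exact: measurable_funB.
Qed.

Let le_dist (f g f1 g1 f2 g2 : T -> R) (e1 e2 : R) :
  measurable_fun setT f -> measurable_fun setT g ->
  measurable_fun setT f1 -> measurable_fun setT g1 ->
  measurable_fun setT f2 -> measurable_fun setT g2 ->
  (forall x, `|f x - g x| <= `|f1 x - g1 x| + `|f2 x - g2 x|) ->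
  (\int[nu]_(x in U) (v x * `|f1 x - g1 x|)%:E <= e1%:E)%E ->
  (\int[nu]_(x in U) (v x * `|f2 x - g2 x|)%:E <= e2%:E)%E ->
  (\int[nu]_(x in U) (v x * `|f x - g x|)%:E <= (e1 + e2)%:E)%E.
Proof.
move=> mf mg mf1 mg1 mf2 mg2 h h1 h2; rewrite EFinD.
apply: le_trans (leeD h1 h2).
have m1 := mdist mf1 mg1; have m2 := mdist mf2 mg2.
rewrite -ge0_integralD//; last 2 first.
- by move=> x _; rewrite lee_fin mulr_ge0.
- by move=> x _; rewrite lee_fin mulr_ge0.
apply: ge0_le_integral => //.
- by move=> x _; rewrite lee_fin mulr_ge0.
- exact: mdist.
- exact: emeasurable_funD.
- by move=> x _; rewrite -EFinD lee_fin -mulrDr ler_wpM2l.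
Qed.

Lemma approximable_set0 : approximable set0.
Proof.
split=> // e e0; exists (fun=> 0) => //.
rewrite (eq_integral (cst 0%E)) ?integral0 ?lee_fin ?(ltW e0)// => x _.
by rewrite indic0 subrr normr0 mulr0.
Qed.

Lemma approximableC A : approximable A -> approximable (~` A).
Proof.
move=> [mA hA]; split; first exact: measurableC.
move=> e e0; have [f Pf hf] := hA e e0; exists (fun x => 1 - f x); first exact: PC.
rewrite (eq_integral (fun x => (v x * `|f x - \1_A x|)%:E))// => x _.
congr (_ * _)%:E; rewrite !indicE in_setC distrC.
by case: (x \in A) => /=; rewrite ?mulr0n ?mulr1n; congr `|_|; ring.
Qed.

Lemma approximableU A B : approximable A -> approximable B -> approximable (A `|` B).
Proof.
move=> [mA hA] [mB hB]; split; first exact: measurableU.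
move=> e e0; have e20 : 0 < e / 2 by rewrite divr_gt0.
have [f Pf hf] := hA _ e20; have [g Pg hg] := hB _ e20.
exists (fun x => Num.max (f x) (g x)); first exact: Pmax.
rewrite [e](splitr e).
apply: (le_dist _ _ _ _ _ _ _ hf hg); try exact: measurable_indic; try exact: Pm.
- exact: (Pm (Pmax Pf Pg)).
- by apply: measurable_indic; exact: measurableU.
move=> x; have /andP[f0 f1] := P01 Pf x; have /andP[g0 g1] := P01 Pg x.
rewrite !indicE in_setU; case: (x \in A); case: (x \in B) => /=; rewrite ?mulr0n ?mulr1n.
- by case: (leP (f x) (g x)) => fg; rewrite !ler0_norm ?subr_le0//; lra.
- by case: (leP (f x) (g x)) => fg; rewrite subr0 (ger0_norm g0) !ler0_norm ?subr_le0//; lra.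
- by case: (leP (f x) (g x)) => fg; rewrite subr0 (ger0_norm f0) !ler0_norm ?subr_le0//; lra.
- by case: (leP (f x) (g x)) => fg; rewrite !subr0 !ger0_norm//; lra.
Qed.

Lemma exists_le_integral_dist (A : set T) (h : nat -> T -> R) (e : R) : 0 < e -> measurable A ->
  (forall k, measurable_fun setT (h k)) -> (forall k x, 0 <= h k x <= 1) ->
  (forall x, h k x @[k --> \oo] --> (\1_A x : R)) ->
  exists k, (\int[nu]_(x in U) (v x * `|h k x - \1_A x|)%:E <= e%:E)%E.
Proof.
move=> e0 mA mh h01 hA.
have mi : measurable_fun setT (\1_A : T -> R) by exact: measurable_indic.
have h1 k x : `|h k x - \1_A x| <= 1.
  have /andP[h0 h1] := h01 k x.
  by rewrite indicE; case: (_ \in _) => /=; rewrite ler_norml; apply/andP; split; lra.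
have : (\int[nu]_(x in U) (v x * `|h k x - \1_A x|)%:E)%E @[k --> \oo] --> 0%E.
  rewrite -(@integral0 _ _ R nu U).
  apply: (@dominated_cvg _ _ R nu U mU
    (fun k x => (v x * `|h k x - \1_A x|)%:E) (cst 0%E) (EFin \o v)) => //.
  - by move=> k; exact: mdist.
  - move=> x _; apply: cvg_EFin; first by near=> k.
    rewrite -[X in _ --> X](mulr0 (v x)); apply: cvgMr.
    rewrite -(normr0 R) -(subrr (\1_A x : R)).
    by apply: cvg_norm; apply: cvgB; [exact: hA|exact: cvg_cst].
  - by move=> k x _; rewrite /= lee_fin ger0_norm ?mulr_ge0// ler_piMr.
move=> /fine_cvgP[_ /cvgrPdist_le /(_ _ e0)[k _ hk]]; exists k.
have i0 : (0 <= \int[nu]_(x in U) (v x * `|h k x - \1_A x|)%:E)%E.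
  by apply: integral_ge0 => x _; rewrite lee_fin mulr_ge0.
have := hk k (leqnn k); rewrite /= sub0r normrN ger0_norm; last exact: fine_ge0.
rewrite -lee_fin fineK// ge0_fin_numE//.
have [_] := integrableP _ _ _ iv; apply: le_lt_trans; apply: ge0_le_integral => //.
- by move=> x _; rewrite lee_fin mulr_ge0.
- exact: mdist.
- by apply: measurableT_comp => //; exact: measurable_int iv.
- by move=> x _; rewrite lee_fin ger0_norm// ler_piMr.
Unshelve. all: by end_near.
Qed.

Lemma approximable_lim (A : set T) (f : nat -> T -> R) : measurable A -> (forall k, P (f k)) ->
  (forall x, f k x @[k --> \oo] --> (\1_A x : R)) -> approximable A.
Proof.
move=> mA Pf fA; split=> // e e0.
have [k hk] := exists_le_integral_dist e0 mA (fun k => Pm (Pf k)) (fun k => P01 (Pf k)) fA.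
by exists (f k).
Qed.

Lemma approximable_cvg (A : set T) (B : nat -> set T) : measurable A ->
  (forall k, approximable (B k)) ->
  (forall x, \1_(B k) x @[k --> \oo] --> (\1_A x : R)) -> approximable A.
Proof.
move=> mA hB BA; split=> // e e0; have e20 : 0 < e / 2 by rewrite divr_gt0.
have mi (D : set T) : measurable D -> measurable_fun setT (\1_D : T -> R) by exact: measurable_indic.
have mB k : measurable_fun setT (\1_(B k) : T -> R) by apply: mi; case: (hB k).
have B01 k x : 0 <= (\1_(B k) x : R) <= 1 by rewrite indicE; case: (_ \in _); rewrite ler01 lexx.
have [k hk] := exists_le_integral_dist e20 mA mB B01 BA.
have [f Pf hf] := (hB k).2 _ e20; exists f => //.
have mf := Pm Pf; have mA' := mi _ mA.
rewrite [e](splitr e); apply: (le_dist mf mA' mf (mB k) (mB k) mA' _ hf hk) => x.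
by apply: (le_trans _ (ler_normD _ _)); rewrite addrA subrK.
Qed.

Lemma approximable_bigcup (A : nat -> set T) :
  (forall k, approximable (A k)) -> approximable (\bigcup_k A k).
Proof.
move=> hA; have mA k : measurable (A k) by case: (hA k).
apply: (@approximable_cvg _ (fun k => \big[setU/set0]_(i < k) A i)).
- exact: bigcup_measurable.
- elim=> [|k IH]; first by rewrite big_ord0; exact: approximable_set0.
  by rewrite big_ord_recr; exact: approximableU.
- move=> x; have [[j _ Ajx]|h] := pselect ((\bigcup_k A k) x).
    apply: cvg_near_cst; near=> k; rewrite !indicE !mem_set//; first by exists j.
    rewrite -bigcup_mkord; exists j => //=; near: k; exact: nbhs_infty_gt.
  apply: cvg_near_cst; near=> k; rewrite !indicE !memNset// -bigcup_mkord => -[i _ Aix].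
  by apply: h; exists i.
Unshelve. all: by end_near.
Qed.

(** Complements come from 1 - f and finite unions from the maximum; dominated convergence along
    partial unions gives countable ones. *)
Lemma sigma_algebra_approximable : sigma_algebra setT approximable.
Proof.
split; [exact: approximable_set0| |exact: approximable_bigcup].
by move=> A hA; rewrite setTD; exact: approximableC.
Qed.

End sigma_algebra_approximation.

Section ball_nonneg.
Context {R : realType} (n : nat) (u : 'rV[R]_n -> R).
Notation nu := (lebesgue_rV R n).
Notation U := (unit_ball R n : set (lebesgue_rV_type R n)).
Hypotheses (mu : measurable_fun [set: lebesgue_rV_type R n] (u : lebesgue_rV_type R n -> R))
  (iu : nu.-integrable U (fun x : lebesgue_rV_type R n => (u x)%:E)).

Definition lipschitz01 (f : 'rV[R]_n -> R) : Prop :=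
  [/\ measurable_fun setT f, forall x, 0 <= f x <= 1 &
    exists2 L, 0 <= L & forall x y, `|f x - f y| <= L * enorm (x - y)].

Hypothesis test_ge0 : forall f, lipschitz01 f -> 0 <= \int[nu]_(x in U) (u x * f x).

Let mU : measurable U.
Proof. exact: measurable_lebesgue_rV (@measurable_unit_ball R n). Qed.

Lemma normr_max_le (a b c d : R) : `|Num.max a b - Num.max c d| <= `|a - c| + `|b - d|.
Proof.
have := ler_norm (a - c); have := ler_norm (c - a); have := ler_norm (b - d); have := ler_norm (d - b).
rewrite (distrC c) (distrC d); have := normr_ge0 (a - c); have := normr_ge0 (b - d).
by case: (leP a b) => ab; case: (leP c d) => cd => *; rewrite ler_norml; apply/andP; split; lra.
Qed.

Lemma lipschitz01_cst0 : lipschitz01 (fun=> 0).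
Proof.
by split => //; [move=> x; rewrite lexx ler01|exists 0 => // x y; rewrite subrr normr0 mul0r].
Qed.

Lemma lipschitz01C f : lipschitz01 f -> lipschitz01 (fun x => 1 - f x).
Proof.
move=> [mf f01 [L L0 fL]]; split; first exact: measurable_funB.
- by move=> x; case/andP: (f01 x) => f0 f1; rewrite subr_ge0 f1 gerBl.
- by exists L => // x y; rewrite opprB addrC addrA subrK distrC.
Qed.

Lemma lipschitz01_max f g : lipschitz01 f -> lipschitz01 g ->
  lipschitz01 (fun x => Num.max (f x) (g x)).
Proof.
move=> [mf f01 [L L0 fL]] [mg g01 [M M0 gM]]; split; first exact: measurable_maxr.
- by move=> x; case/andP: (f01 x) => f0 f1; case/andP: (g01 x) => g0 g1; rewrite le_max f0 ge_max f1.
- by exists (L + M) => [|x y]; rewrite ?addr_ge0// (le_trans (normr_max_le _ _ _ _))// mulrDl lerD.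
Qed.

(** This is k (x_i - a) clipped to [0, 1]. The minimum is expressed through 1 - max, so that
    [normr_max_le] alone yields the Lipschitz bound. *)
Definition ramp (i : 'I_n) (a : R) (k : nat) (x : 'rV[R]_n) : R :=
  1 - Num.max 0 (1 - Num.max 0 (k%:R * (x ord0 i - a))).

Lemma lipschitz01_ramp i a k : lipschitz01 (ramp i a k).
Proof.
split.
- apply: measurable_funB => //; apply: measurable_maxr => //; apply: measurable_funB => //.
  apply: measurable_maxr => //; apply: measurable_funM => //; apply: measurable_funB => //.
  exact: measurable_coord.
- move=> x; rewrite /ramp subr_ge0 gerBl ge_max ler01/= gerBl !le_max !lexx//.
- exists k%:R => // x y; rewrite /ramp opprB addrC addrA subrK.
  apply: (le_trans (normr_max_le _ _ _ _)); rewrite subrr normr0 add0r.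
  rewrite opprB addrC addrA subrK.
  apply: (le_trans (normr_max_le _ _ _ _)); rewrite subrr normr0 add0r.
  rewrite -mulrBr opprB addrA subrK normrM ger0_norm// ler_wpM2l//.
  by rewrite (le_trans _ (le_coord_enorm (x - y) i))// !mxE.
Qed.

Lemma cvg_ramp i a x :
  ramp i a k x @[k --> \oo] --> (\1_[set x : 'rV[R]_n | a < x ord0 i] x : R).
Proof.
have [ax|ax] := ltP a (x ord0 i); last first.
  apply: cvg_near_cst; apply: nearW => k; rewrite indicE memNset; last by apply/negP; rewrite -leNgt.
  by rewrite /ramp (max_l (_ : k%:R * _ <= 0)) ?subr0 ?max_r// ?subrr// mulr_ge0_le0 ?subr_le0.
rewrite indicE mem_set//; apply: cvg_near_cst; near=> k.
have xa : 0 < x ord0 i - a by rewrite subr_gt0.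
have kx : 1 <= k%:R * (x ord0 i - a).
  by rewrite -ler_pdivrMr// mul1r; near: k; exact: nbhs_infty_ger.
rewrite /ramp (max_r (_ : 0 <= k%:R * _)) ?(le_trans ler01)//.
by rewrite max_l ?subr0// subr_le0.
Unshelve. all: by end_near.
Qed.

Let v (x : lebesgue_rV_type R n) : R := `|u x|.

Let mv : measurable_fun [set: lebesgue_rV_type R n] v.
Proof. exact: measurableT_comp. Qed.

Let iv : nu.-integrable U (EFin \o v).
Proof. exact: integrable_norm. Qed.

Let v0 x : 0 <= v x. Proof. exact: normr_ge0. Qed.

Let Pm (f : lebesgue_rV_type R n -> R) : lipschitz01 f -> measurable_fun [set: lebesgue_rV_type R n] f.
Proof. by move=> [mf _ _]; exact: measurable_fun_lebesgue_rV. Qed.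

Let P01 (f : lebesgue_rV_type R n -> R) : lipschitz01 f -> forall x, 0 <= f x <= 1.
Proof. by case. Qed.

Let appr := @approximable _ _ R nu U v lipschitz01.

Let sigma_appr : sigma_algebra setT appr.
Proof.
exact: (sigma_algebra_approximable mU mv v0 iv lipschitz01_cst0 lipschitz01C lipschitz01_max Pm P01).
Qed.

(** Open half-lines generate the Borel sets of R, and on their preimages the ramps converge
    pointwise to the indicator. *)
Lemma approximable_coord (i : 'I_n) (Y : set (measurableTypeR R)) : measurable Y ->
  appr ((fun x : 'rV[R]_n => x ord0 i) @^-1` Y).
Proof.
have [s0 sC sU] := sigma_appr.
rewrite [X in X Y](RGenOInfty.measurableE R) => mY.
apply: (@smallest_sub _ (sigma_algebra setT) (@RGenOInfty.G R)
  [set Y | appr ((fun x : 'rV[R]_n => x ord0 i) @^-1` Y)] _ _ _ mY).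
  split => /=; first by rewrite preimage_set0.
  - by move=> A hA; rewrite setTD preimage_setC -setTD; exact: sC.
  - by move=> A hA; rewrite preimage_bigcup; exact: sU.
move=> _ [a ->] /=; rewrite (_ : _ @^-1` _ = [set x : 'rV[R]_n | a < x ord0 i]); last first.
  by apply/seteqP; split => x /=; rewrite in_itv/= andbT.
apply: (approximable_lim mU mv v0 iv Pm P01 (f := ramp i a)).
- apply: measurable_lebesgue_rV; rewrite -[X in measurable X]setTI.
  have := @measurable_coord R n i measurableT `]a, +oo[%classic (measurable_itv _).
  by rewrite (_ : _ @^-1` _ = [set x : 'rV[R]_n | a < x ord0 i])//; apply/seteqP; split => x /=; rewrite in_itv/= andbT.
- by move=> k; exact: lipschitz01_ramp.
- by move=> x; exact: cvg_ramp.
Qed.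

Lemma approximable_borel (A : set 'rV[R]_n) : measurable A -> appr A.
Proof.
move=> mA; apply: (@smallest_sub _ (sigma_algebra setT) _ appr sigma_appr _ _ mA).
move=> B; rewrite -bigcup_seq/= => -[i _ [Y mY <-]]; rewrite setTI.
exact: approximable_coord.
Qed.

Lemma integral_borel_ge0 (A : set 'rV[R]_n) : measurable A ->
  0 <= \int[nu]_(x in U) (u x * \1_A x).
Proof.
move=> mA; have [mA' hA] := approximable_borel mA.
have mi : measurable_fun [set: lebesgue_rV_type R n] (\1_A : lebesgue_rV_type R n -> R).
  exact: measurable_indic.
have ib (f : lebesgue_rV_type R n -> R) : measurable_fun [set: lebesgue_rV_type R n] f ->
    (forall x, 0 <= f x <= 1) -> nu.-integrable U (fun x => (u x * f x)%:E).
  move=> mf f01; apply: (le_integrable mU _ _ iu).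
    by apply: measurable_funTS; apply/measurable_EFinP; exact: (measurable_funM mu mf).
  by move=> x _; case/andP: (f01 x) => f0 f1; rewrite !abse_EFin lee_fin normrM (ger0_norm f0) ler_piMr.
have iA : nu.-integrable U (fun x => (u x * \1_A x)%:E).
  by apply: ib => // x; rewrite indicE; case: (_ \in _); rewrite ler01 lexx.
apply/ler_addgt0Pl => e e0; have [f Pf hf] := hA e e0.
have iF := ib f (Pm Pf) (P01 Pf).
have dE := RintegralB mU iA iF.
have iD := integrableB mU iA iF.
have d1 : `|\int[nu]_(x in U) (u x * \1_A x - u x * f x)| <= e.
  apply: (le_trans (le_normr_Rintegral mU iD)).
  rewrite -lee_fin; apply: le_trans hf; rewrite /Rintegral fineK; last first.
    by apply: integrable_fin_num => //; exact: (integrable_norm iD).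
  rewrite le_eqVlt; apply/orP; left; apply/eqP; apply: eq_integral => x _.
  by rewrite -mulrBr normrM distrC.
move: d1; rewrite dE ler_norml => /andP[d1 _].
by move: (test_ge0 Pf) d1; lra.
Qed.

(** Indicators can be tested only for Borel sets, while {u < 0} is merely Lebesgue measurable. As
    [nu] is given by an outer measure, intersecting covers of excess 1 / (j + 1) yields a Borel
    superset of equal measure. *)
Let borel_hull (N : set 'rV[R]_n) : (nu N < +oo)%E ->
  exists B : set 'rV[R]_n, [/\ measurable B, N `<=` B & (nu B <= nu N)%E].
Proof.
move=> Nfin; have N0 : (0 <= nu N)%E by exact: mu_ext_ge0.
have fN : nu N \is a fin_num by rewrite ge0_fin_numE.
have h (j : nat) : exists F : set 'rV[R]_n,
    [/\ measurable F, N `<=` F & (nu F <= nu N + j.+1%:R^-1%:E)%E].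
  have j0 : 0 < j.+1%:R^-1 :> R by rewrite invr_gt0.
  have [_ [A [mA NA] <-] le] := lb_ereal_inf_adherent j0 fN.
  have mF : measurable (\bigcup_k A k) by exact: bigcup_measurable.
  exists (\bigcup_k A k); split=> //; rewrite (lebesgue_rVE mF).
  by apply: le_trans (ltW le); apply: measure_sigma_subadditive.
have [F hF] := choice h.
have mB : measurable (\bigcap_j F j) by apply: bigcapT_measurable => j; case: (hF j).
exists (\bigcap_j F j); split=> //.
  by move=> x Nx j _; case: (hF j) => _ NF _; exact: NF.
apply/lee_addgt0Pr => e e0.
have [j je] : exists j : nat, j.+1%:R^-1 <= e.
  by have := near_infty_natSinv_lt (PosNum e0); case=> j _ /(_ j (leqnn j)) /= /ltW; exists j.
have [mF _ Fj] := hF j.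
apply: (@le_trans _ _ (nu (F j))).
  by apply: le_mu_ext; exact: bigcap_inf.
by apply: (le_trans Fj); rewrite leeD2l// lee_fin.
Qed.

(** Testing with the Borel hull of N = {u < 0} in the ball costs only a null set, so the integral of
    u over N is nonnegative. Its integrand is nonpositive, hence 0 almost everywhere. *)
Lemma ae_ge0_ball : {ae nu, forall x, unit_ball R n x -> 0 <= u x}.
Proof.
pose N : set (lebesgue_rV_type R n) := U `&` [set x | u x < 0].
have mN : measurable N.
  apply: measurableI => //; rewrite -[X in measurable X]setTI.
  have := mu measurableT (measurable_itv `]-oo, (0 : R)[).
  by rewrite (_ : _ @^-1` _ = [set x : lebesgue_rV_type R n | u x < 0])//; apply/seteqP; split => x /=; rewrite in_itv.
have Ufin : (nu U < +oo)%E.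
  apply: (@le_lt_trans _ _ (nu [set x : lebesgue_rV_type R n | (enorm (x : 'rV[R]_n) <= 1)%R])).
    by apply: le_mu_ext => x /= x1; exact: ltW.
  by rewrite (lebesgue_rVE (@measurable_cball R n 1)) borel_ball_fin.
have Nfin : (nu N < +oo)%E by apply: le_lt_trans Ufin; apply: le_mu_ext => x [].
have [B [mB NB nuB]] := borel_hull Nfin.
have mB' : measurable (B : set (lebesgue_rV_type R n)) by exact: measurable_lebesgue_rV.
have BN0 : nu (B `\` N) = 0%E.
  have Bfin := le_lt_trans nuB Nfin.
  have nuE : nu B = nu N by apply/eqP; rewrite eq_le nuB; exact: le_mu_ext.
  have E : nu (B `\` N) = (nu B - nu (B `&` N))%E := measureD mB' mN Bfin.
  by rewrite E (setIidr NB) nuE subee// ge0_fin_numE//; exact: mu_ext_ge0.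
have i0 := integral_borel_ge0 mB.
have mi (D : set (lebesgue_rV_type R n)) : measurable D ->
    measurable_fun U (fun x : lebesgue_rV_type R n => (u x * \1_D x)%:E).
  move=> mD; apply: measurable_funTS; apply/measurable_EFinP.
  exact: (measurable_funM mu (measurable_indic mD)).
have eBN : (\int[nu]_(x in U) (u x * \1_B x)%:E = \int[nu]_(x in U) (u x * \1_N x)%:E)%E.
  apply: ae_eq_integral; [exact: mU|exact: mi|exact: mi|].
  exists (B `\` N); split => //; first exact: measurableD.
  move=> x /= /not_implyP[_]; apply: contra_notP => /not_andP BNx; congr (_ * _)%:E.
  rewrite !indicE; have [xN|xN] := pselect (N x); first by rewrite !mem_set//; exact: NB.
  have xB : ~ B x by case: BNx => // /notK.
  by rewrite !memNset.
have le0 x : U x -> u x * \1_N x <= 0.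
  move=> Ux; rewrite indicE; have [[_ xN]|xN] := pselect (N x); first by rewrite mem_set// mulr1 ltW.
  by rewrite memNset// mulr0.
have abs0 : (\int[nu]_(x in U) `|(u x * \1_N x)%:E| = 0)%E.
  have E : (\int[nu]_(x in U) (u x * \1_N x)%:E = - \int[nu]_(x in U) `|(u x * \1_N x)%:E|)%E.
    rewrite -integral_ge0N//; apply: eq_integral => x /set_mem xU.
    by rewrite abse_EFin ler0_norm ?le0// EFinN oppeK.
  have A0 : (0 <= \int[nu]_(x in U) `|(u x * \1_N x)%:E|)%E by exact: integral_ge0.
  have Aoo : (\int[nu]_(x in U) `|(u x * \1_N x)%:E| < +oo)%E.
    suff iN : nu.-integrable U (fun x : lebesgue_rV_type R n => (u x * \1_N x)%:E).
      by have [] := integrableP _ _ _ iN.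
    apply: (le_integrable mU (mi _ mN) _ iu) => x _; rewrite !abse_EFin lee_fin normrM ler_piMr//.
    by rewrite indicE; case: (_ \in _); rewrite ?normr1 ?normr0.
  (* A real-valued integral is 0 by convention when the extended one is infinite, so [i0] is
     conclusive only together with the finiteness [Aoo]. *)
  move: i0 Aoo; rewrite /Rintegral eBN E; case: (integral _ _ _) A0 => [r| |]//=.
    by rewrite lee_fin oppr_ge0 => r0 r1 _; congr EFin; apply/eqP; rewrite eq_le r0 r1.
have := proj1 (ae_eq_integral_abs nu mU (mi _ mN)) abs0.
apply: filterS => x /= h xU; rewrite leNgt; apply/negP => ux.
move: (h xU) => -[]; rewrite indicE mem_set// mulr1 => u0.
by rewrite u0 ltxx in ux.
Qed.

End ball_nonneg.

Theorem theorem1p7 (R : realType) (n : nat) (s C : R) (u : 'rV[R]_n -> R)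
    (n_gt0 : (0 < n)%N) (s_gt0 : 0 < s) (s_lt1 : s < 1) (C_gt0 : 0 < C)
    (uL : calL s u)
    (uLp : u \_ (unit_ball R n) \in Lfun (lebesgue_rV R n) (1 / (1 - s))%:E)
    (u_super : fracLaplacian_ge0 (unit_ball R n) C s u)
    (u_ext : {ae lebesgue_rV R n, forall x, (~` unit_ball R n) x -> 0 <= u x}) :
  {ae lebesgue_rV R n, forall x, unit_ball R n x -> 0 <= u x}.
Proof.
apply: (ae_ge0_ball (proj1 uL) (integrable_calL_ball s_gt0 uL)) => f [mf f01 [L L0 fL]].
exact: (integral_ball_test_ge0 n_gt0 s_gt0 s_lt1 C_gt0 uL uLp u_super u_ext mf f01 L0 fL).
Qed.
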